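(* Suppose that $\mathbf{Q}=\mathbf{Q}_1\vee\dots\vee\mathbf{Q}_\kappa$, where $Q_i\in\mathbf{Q}_\alpha$ and $Q_j\in\mathbf{Q}_\beta$ are in the same $(\varepsilon,q)$-orbit only if $\alpha=\beta$. Let $t_\alpha=|\mathbf{Q}_\alpha|$ for $1\le\alpha\le\kappa$. Then $\mathscr{H}_{r,p,n}(\mathbf{Q})$ is Morita equivalent to the algebra $$\bigoplus_{\substack{b_1,\dots,b_\kappa\ge 0\\ b_1+\dots+b_\kappa=n}}\Big(\mathscr{H}_{pt_1,b_1}(\mathbf{Q}_1)\otimes\cdots\otimes\mathscr{H}_{pt_\kappa,b_\kappa}(\mathbf{Q}_\kappa)\Big)\rtimes\mathbb{Z}_p,$$ where $\mathbb{Z}_p$ acts on $\mathscr{H}_{pt_1,b_1}(\mathbf{Q}_1)\otimes\cdots\otimes\mathscr{H}_{pt_\kappa,b_\kappa}(\mathbf{Q}_\kappa)$ through the automorphism $\sigma_1\otimes\dots\otimes\sigma_\kappa$.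
   Context: Fix positive integers $r,p,n,t$ with $r=pt$, $p>1$ and $n\ge 3$. Let $K$ be an algebraically closed field containing a primitive $p$th root of unity $\varepsilon$ (so the characteristic of $K$ is coprime to $p$). Fix $q,Q_1,\dots,Q_t\in K^\times$ and let $\mathbf{Q}=(Q_1,\dots,Q_t)$. For a tuple $\mathbf{X}=(X_1,\dots,X_s)$ of elements of $K^\times$, write $|\mathbf{X}|=s$, and for an integer $m\ge 1$ let $\mathscr{H}_{ps,m}(\mathbf{X})$ be the unital associative $K$-algebra generated by $T_0,T_1,\dots,T_{m-1}$ subject to the relations $(T_0^p-X_1^p)\cdots(T_0^p-X_s^p)=0$; $T_0T_1T_0T_1=T_1T_0T_1T_0$; $(T_i+1)(T_i-q)=0$ for $1\le i\le m-1$; $T_iT_{i+1}T_i=T_{i+1}T_iT_{i+1}$ for $1\le i\le m-2$; $T_iT_j=T_jT_i$ for $0\le i<j-1\le m-2$. Put $\mathscr{H}_{ps,0}(\mathbf{X})=K$. In particular $\mathscr{H}_{r,n}(\mathbf{Q})$ is defined. $\mathscr{H}_{r,p,n}(\mathbf{Q})$ is the subalgebra of $\mathscr{H}_{r,n}(\mathbf{Q})$ generated by $T_0^p$, $T_0^{-1}T_1T_0$ and $T_1,T_2,\dots,T_{n-1}$. Two parameters $Q_i,Q_j$ are in the same $(\varepsilon,q)$-orbit if $Q_i=\varepsilon^aq^bQ_j$ for some $a,b\in\mathbb{Z}$. For tuples, $(X_1,\dots,X_s)\vee(Y_1,\dots,Y_l)=(X_1,\dots,X_s,Y_1,\dots,Y_l)$.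 $\sigma_\alpha$ is the $K$-algebra automorphism of $\mathscr{H}_{pt_\alpha,b_\alpha}(\mathbf{Q}_\alpha)$ with $\sigma_\alpha(T_0)=\varepsilon T_0$ and $\sigma_\alpha(T_i)=T_i$ for $1\le i<b_\alpha$ (trivial if $b_\alpha=0$). If $\mathbb{Z}_p$ acts on an algebra $A$ by algebra automorphisms, written $b\mapsto b^g$, then $A\rtimes\mathbb{Z}_p$ is the free left $A$-module with basis $\mathbb{Z}_p$ and multiplication $ag\cdot bh=ab^g\cdot gh$ for $a,b\in A$, $g,h\in\mathbb{Z}_p$. *)

(* Defs.v *)
From HB Require Import structures.
From mathcomp Require Import all_boot all_order all_algebra.
From mathcomp Require Import boolp finmap monalg.

Set Implicit Arguments.
Unset Strict Implicit.
Unset Printing Implicit Defensive.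
Import GRing.Theory.
Local Open Scope quotient_scope.
Local Open Scope ring_scope.

(* A K-algebra is a ring with a ring morphism from K to its centre.  The      *)
(* library's algType is not used because it excludes the zero ring, which     *)
(* does occur here: H_{0,b}() = 0 for b > 0, as its relation on T_0 is an     *)
(* empty product equal to 0.                                                  *)
Record kalgebra (K : fieldType) := KAlgebra {
  kalg_ring :> pzRingType;
  kconst : {rmorphism K -> kalg_ring};
  kconstC : forall c x, kconst c * x = x * kconst c }.
Arguments kconst {K} A : rename.

Definition kscale (K : fieldType) (A : kalgebra K) (c : K) (x : A) : A :=
  kconst A c * x.

Section ScaleTheory.
Variables (K : fieldType) (A : kalgebra K).
Implicit Types (c : K) (x y : A).

Lemma kscaleAl c x y : kscale c x * y = kscale c (x * y).
Proof. by rewrite /kscale mulrA. Qed.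
Lemma kscaleAr c x y : x * kscale c y = kscale c (x * y).
Proof. by rewrite /kscale !mulrA kconstC. Qed.
Lemma kscaleB c x y : kscale c (x - y) = kscale c x - kscale c y.
Proof. by rewrite /kscale mulrBr. Qed.
Lemma kscale0 c : kscale c (0 : A) = 0.
Proof. by rewrite /kscale mulr0. Qed.
Lemma kscale1 x : kscale 1 x = x.
Proof. by rewrite /kscale rmorph1 mul1r. Qed.
Lemma kscaleX c x n : kscale c x ^+ n = kscale (c ^+ n) (x ^+ n).
Proof. by rewrite /kscale exprMn_comm ?rmorphXn //; apply: kconstC. Qed.

End ScaleTheory.

Record kalg_hom (K : fieldType) (A B : kalgebra K) := KalgHom {
  kalg_hom_fun :> {rmorphism A -> B};
  kalg_hom_const : forall c, kalg_hom_fun (kconst A c) = kconst B c }.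

Section HomTheory.
Variables (K : fieldType) (A B : kalgebra K) (f : kalg_hom A B).

Lemma kalg_hom0 : f 0 = 0. Proof. exact: rmorph0. Qed.
Lemma kalg_hom1 : f 1 = 1. Proof. exact: rmorph1. Qed.
Lemma kalg_homD x y : f (x + y) = f x + f y. Proof. exact: rmorphD. Qed.
Lemma kalg_homB x y : f (x - y) = f x - f y. Proof. exact: rmorphB. Qed.
Lemma kalg_homM x y : f (x * y) = f x * f y. Proof. exact: rmorphM. Qed.
Lemma kalg_homX x n : f (x ^+ n) = f x ^+ n. Proof. exact: rmorphXn. Qed.
Lemma kalg_hom_prod I (s : seq I) (F : I -> A) :
  f (\prod_(i <- s) F i) = \prod_(i <- s) f (F i).
Proof. exact: rmorph_prod. Qed.

End HomTheory.

Lemma kalg_hom_scale (K : fieldType) (A B : kalgebra K) (f : kalg_hom A B) c x :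
  f (kscale c x) = kscale c (f x).
Proof. by rewrite /kscale rmorphM kalg_hom_const. Qed.

(* As with the library's x^-1, the inverse is total: a non-invertible x is    *)
(* its own inverse.                                                           *)
Definition kinv (R : pzRingType) (x : R) : R :=
  if pselect (exists y, y * x = 1 /\ x * y = 1) is left h
  then projT1 (cid h) else x.

Lemma kinvP (R : pzRingType) (x : R) :
  (exists y, y * x = 1 /\ x * y = 1) -> kinv x * x = 1 /\ x * kinv x = 1.
Proof. by rewrite /kinv; case: pselect => // h _; case: (cid h). Qed.

Section BaseAlgebra.
Variable K : fieldType.

Fact base_const_comm (c x : K) : idfun c * x = x * idfun c.
Proof. exact: mulrC. Qed.
Definition base_kalg : kalgebra K := KAlgebra base_const_comm.

End BaseAlgebra.

Section HomComposition.
Variables (K : fieldType) (A : kalgebra K).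

Fact kalg_id_const c : idfun (kconst A c) = kconst A c.
Proof. by []. Qed.
Definition kalg_id : kalg_hom A A := KalgHom kalg_id_const.

Fact kalg_comp_const (B C : kalgebra K) (f : kalg_hom B C) (g : kalg_hom A B) c :
  (f \o g) (kconst A c) = kconst C c.
Proof. by rewrite /= !kalg_hom_const. Qed.
Definition kalg_comp (B C : kalgebra K) (f : kalg_hom B C) (g : kalg_hom A B) :
  kalg_hom A C := KalgHom (kalg_comp_const f g).

Definition kalg_iter (f : kalg_hom A A) (m : nat) : kalg_hom A A :=
  iter m (kalg_comp f) kalg_id.

Lemma kalg_iterE (f : kalg_hom A A) m x : kalg_iter f m x = iter m f x.
Proof. by elim: m => //= m <-. Qed.

End HomComposition.

Section TwoSidedQuotient.
Variables (K : fieldType) (A : kalgebra K) (S : A -> Prop).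

Inductive in_ideal : A -> Prop :=
| ideal_gen x of S x : in_ideal x
| ideal_zero : in_ideal 0
| ideal_sub x y of in_ideal x & in_ideal y : in_ideal (x - y)
| ideal_mull a x of in_ideal x : in_ideal (a * x)
| ideal_mulr a x of in_ideal x : in_ideal (x * a).

Definition ideal_pred : {pred A} := fun x => `[< in_ideal x >].

Fact ideal_zmod_closed : zmod_closed ideal_pred.
Proof.
split=> [|x y /asboolP xI /asboolP yI]; apply/asboolP.
  exact: ideal_zero.
exact: ideal_sub.
Qed.
HB.instance Definition _ :=
  GRing.isZmodClosed.Build A ideal_pred ideal_zmod_closed.

Definition quot_type := Quotient.quot (ideal_pred : zmodClosed A).
HB.instance Definition _ := Quotient.on quot_type.
HB.instance Definition _ := GRing.Zmodule.on quot_type.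

Definition quot_proj (x : A) : quot_type := \pi_quot_type x.

Lemma quot_projP x y : quot_proj x = quot_proj y <-> in_ideal (x - y).
Proof.
split=> [/eqP|xyI]; last apply/eqP; rewrite /quot_proj -Quotient.idealrBE.
  by move/asboolP.
exact/asboolP.
Qed.

Lemma quot_projW (P : quot_type -> Prop) :
  (forall x, P (quot_proj x)) -> forall z, P z.
Proof. by move=> Pproj z; rewrite -[z]reprK; apply: Pproj. Qed.

Lemma quot_projB : {morph quot_proj : x y / x - y}.
Proof. by move=> x y; rewrite /quot_proj raddfB. Qed.

Lemma quot_projD : {morph quot_proj : x y / x + y}.
Proof. by move=> x y; rewrite /quot_proj raddfD. Qed.

Definition quot_mul (x y : quot_type) : quot_type := quot_proj (repr x * repr y).

Lemma quot_projM x y : quot_mul (quot_proj x) (quot_proj y) = quot_proj (x * y).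
Proof.
have reprI z : in_ideal (repr (quot_proj z) - z).
  by apply/quot_projP; rewrite /quot_proj reprK.
apply/quot_projP; set x' := repr _; set y' := repr _.
have -> : x' * y' - x * y = (x' - x) * y' - x * (y - y').
  by rewrite mulrBl mulrBr opprB addrA subrK.
apply: ideal_sub; first exact/ideal_mulr/reprI.
apply: ideal_mull; rewrite -opprB -[- _]add0r.
by apply: ideal_sub; [exact: ideal_zero | exact: reprI].
Qed.

Fact quot_mulA : associative quot_mul.
Proof.
by elim/quot_projW=> x; elim/quot_projW=> y; elim/quot_projW=> z;
  rewrite !quot_projM mulrA.
Qed.
Fact quot_mul1 : left_id (quot_proj 1) quot_mul.
Proof. by elim/quot_projW=> x; rewrite quot_projM mul1r. Qed.
Fact quot_mulr1 : right_id (quot_proj 1) quot_mul.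
Proof. by elim/quot_projW=> x; rewrite quot_projM mulr1. Qed.
Fact quot_mulDl : left_distributive quot_mul +%R.
Proof.
by elim/quot_projW=> x; elim/quot_projW=> y; elim/quot_projW=> z;
  rewrite -quot_projD !quot_projM mulrDl quot_projD.
Qed.
Fact quot_mulDr : right_distributive quot_mul +%R.
Proof.
by elim/quot_projW=> x; elim/quot_projW=> y; elim/quot_projW=> z;
  rewrite -quot_projD !quot_projM mulrDr quot_projD.
Qed.
HB.instance Definition _ := GRing.Zmodule_isPzRing.Build quot_type
  quot_mulA quot_mul1 quot_mulr1 quot_mulDl quot_mulDr.

Fact quot_proj_monoid : monoid_morphism quot_proj.
Proof. by split=> // x y; rewrite -quot_projM. Qed.
HB.instance Definition _ := GRing.isZmodMorphism.Build A quot_type quot_proj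
  quot_projB.
HB.instance Definition _ := GRing.isMonoidMorphism.Build A quot_type quot_proj
  quot_proj_monoid.

Fact quot_constC c (x : quot_type) :
  (quot_proj \o kconst A) c * x = x * (quot_proj \o kconst A) c.
Proof.
by elim/quot_projW: x => x; rewrite /= -!rmorphM kconstC.
Qed.
Definition quot_kalg : kalgebra K := KAlgebra quot_constC.

Fact quot_proj_const c : quot_proj (kconst A c) = kconst quot_kalg c.
Proof. by []. Qed.
Definition quot_hom : kalg_hom A quot_kalg :=
  @KalgHom K A quot_kalg quot_proj quot_proj_const.

Lemma quot_hom_rel x : S x -> quot_hom x = 0.
Proof.
move=> Sx; rewrite -[RHS](rmorph0 quot_hom); apply/quot_projP.
by rewrite subr0; apply: ideal_gen.
Qed.

Section Lift.
Variables (B : kalgebra K) (f : kalg_hom A B) (fS : forall x, S x -> f x = 0).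

Definition quot_lift_fun (z : quot_type) : B := f (repr z).

Lemma quot_lift_proj x : quot_lift_fun (quot_proj x) = f x.
Proof.
have ker y : in_ideal y -> f y = 0.
  elim=> [|| y' z _ fy _ fz| a y' _ fy| a y' _ fy] //; first exact: rmorph0.
  - by rewrite rmorphB fy fz subr0.
  - by rewrite rmorphM fy mulr0.
  - by rewrite rmorphM fy mul0r.
apply/eqP; rewrite -subr_eq0 -rmorphB; apply/eqP/ker/quot_projP.
by rewrite /quot_proj reprK.
Qed.

Fact quot_lift_zmod : zmod_morphism quot_lift_fun.
Proof.
by elim/quot_projW=> x; elim/quot_projW=> y;
  rewrite -quot_projB !quot_lift_proj rmorphB.
Qed.
Fact quot_lift_monoid : monoid_morphism quot_lift_fun.
Proof.
split; first by rewrite quot_lift_proj rmorph1.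
by elim/quot_projW=> x; elim/quot_projW=> y;
  rewrite -rmorphM !quot_lift_proj rmorphM.
Qed.
HB.instance Definition _ := GRing.isZmodMorphism.Build quot_type B quot_lift_fun
  quot_lift_zmod.
HB.instance Definition _ := GRing.isMonoidMorphism.Build quot_type B
  quot_lift_fun quot_lift_monoid.

Fact quot_lift_const c : quot_lift_fun (kconst quot_kalg c) = kconst B c.
Proof. by rewrite quot_lift_proj kalg_hom_const. Qed.
Definition quot_lift : kalg_hom quot_kalg B :=
  @KalgHom K quot_kalg B quot_lift_fun quot_lift_const.

Lemma quot_liftE x : quot_lift (quot_hom x) = f x.
Proof. exact: quot_lift_proj. Qed.

End Lift.
End TwoSidedQuotient.

(* For a finite family this is also the direct sum of algebras.               *)
Section Product.
Variables (K : fieldType) (I : finType) (A : I -> kalgebra K).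

Definition prod_type := forall i, A i.
HB.instance Definition _ := gen_eqMixin prod_type.
HB.instance Definition _ := gen_choiceMixin prod_type.

Implicit Types x y z : prod_type.

Definition prod_zero : prod_type := fun=> 0.
Definition prod_opp x : prod_type := fun i => - x i.
Definition prod_add x y : prod_type := fun i => x i + y i.
Definition prod_one : prod_type := fun=> 1.
Definition prod_mul x y : prod_type := fun i => x i * y i.

Fact prod_addA : associative prod_add.
Proof. by move=> x y z; apply: functional_extensionality_dep => i; apply: addrA. Qed.
Fact prod_addC : commutative prod_add.
Proof. by move=> x y; apply: functional_extensionality_dep => i; apply: addrC. Qed.
Fact prod_add0 : left_id prod_zero prod_add.
Proof. by move=> x; apply: functional_extensionality_dep => i; apply: add0r. Qed.
Fact prod_addN : left_inverse prod_zero prod_opp prod_add.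
Proof. by move=> x; apply: functional_extensionality_dep => i; apply: addNr. Qed.
HB.instance Definition _ :=
  GRing.isZmodule.Build prod_type prod_addA prod_addC prod_add0 prod_addN.

Fact prod_mulA : associative prod_mul.
Proof. by move=> x y z; apply: functional_extensionality_dep => i; apply: mulrA. Qed.
Fact prod_mul1 : left_id prod_one prod_mul.
Proof. by move=> x; apply: functional_extensionality_dep => i; apply: mul1r. Qed.
Fact prod_mulr1 : right_id prod_one prod_mul.
Proof. by move=> x; apply: functional_extensionality_dep => i; apply: mulr1. Qed.
Fact prod_mulDl : left_distributive prod_mul +%R.
Proof. by move=> x y z; apply: functional_extensionality_dep => i; apply: mulrDl. Qed.
Fact prod_mulDr : right_distributive prod_mul +%R.
Proof. by move=> x y z; apply: functional_extensionality_dep => i; apply: mulrDr. Qed.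
HB.instance Definition _ := GRing.Zmodule_isPzRing.Build prod_type
  prod_mulA prod_mul1 prod_mulr1 prod_mulDl prod_mulDr.

Definition prod_const (c : K) : prod_type := fun i => kconst (A i) c.

Fact prod_const_zmod : zmod_morphism prod_const.
Proof.
by move=> c d; apply: functional_extensionality_dep => i; apply: rmorphB.
Qed.
Fact prod_const_monoid : monoid_morphism prod_const.
Proof.
by split=> [|c d]; apply: functional_extensionality_dep => i;
  [apply: rmorph1 | apply: rmorphM].
Qed.
HB.instance Definition _ :=
  GRing.isZmodMorphism.Build K prod_type prod_const prod_const_zmod.
HB.instance Definition _ :=
  GRing.isMonoidMorphism.Build K prod_type prod_const prod_const_monoid.

Fact prod_constC c x : prod_const c * x = x * prod_const c.
Proof. by apply: functional_extensionality_dep => i; apply: kconstC. Qed.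
Definition prod_kalg : kalgebra K := KAlgebra prod_constC.

End Product.

Section LinearExtension.
Variables (K : fieldType) (X : choiceType).
Local Notation V := {malg K[X]}.

Section Def.
Variables (W : zmodType) (F : X -> K -> W).
Definition malg_ext (g : V) : W := \sum_(k <- msupp g) F k g@_k.
Hypothesis F_add : forall k, {morph F k : c d / c + d}.

Lemma malg_ext0 k : F k 0 = 0.
Proof. by apply: (addIr (F k 0)); rewrite -F_add !add0r. Qed.

Lemma malg_extw (d : {fset X}) (g : V) :
  (msupp g `<=` d)%fset -> malg_ext g = \sum_(k <- d) F k g@_k.
Proof.
move=> le_gd; apply: (big_fset_incl _ le_gd) => k _ /mcoeff_outdom ->.
exact: malg_ext0.
Qed.

Lemma malg_extD : {morph malg_ext : g h / g + h}.
Proof.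
move=> g h; rewrite (malg_extw (fsubsetUl (msupp g) (msupp h))).
rewrite (malg_extw (fsubsetUr (msupp g) (msupp h))) (malg_extw (msuppD_le g h)).
by rewrite -big_split; apply: eq_bigr => k _; rewrite mcoeffD F_add.
Qed.

Lemma malg_extU k c : malg_ext << c *g k >> = F k c.
Proof.
by rewrite (malg_extw (@msuppU_le _ _ k c)) big_seq_fset1 mcoeffUU.
Qed.

Lemma malg_extB : {morph malg_ext : g h / g - h}.
Proof.
by move=> g h; apply/eqP; rewrite eq_sym subr_eq -malg_extD subrK.
Qed.
End Def.

Lemma malg_ind (P : V -> Prop) :
  P 0 -> (forall g h, P g -> P h -> P (g + h)) ->
  (forall c k, P << c *g k >>) -> forall g, P g.
Proof. by move=> P0 PD PU g; rewrite [g]monalgE; apply: big_ind. Qed.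

End LinearExtension.

(* The library makes {malg K[M]} a ring only for a monoid M without           *)
(* non-trivial units, hence the construction for the multiplicative monoid    *)
(* of an arbitrary ring.                                                      *)
Section MonoidAlgebra.
Variables (K : fieldType) (M : pzRingType).

Definition monalg_type := {malg K[M]}.
HB.instance Definition _ := GRing.Lmodule.on monalg_type.

Definition monalg_mul (g h : monalg_type) : monalg_type :=
  malg_ext (fun a c => malg_ext (fun b d => << c * d *g a * b >>) h) g.

Let mulF (a : M) (c : K) (b : M) (d : K) : monalg_type := << c * d *g a * b >>.

Fact mulF_add a c b : {morph mulF a c b : d e / d + e}.
Proof. by move=> d e; rewrite /mulF mulrDr monalgUD. Qed.

Fact mulF_addl h a : {morph (fun c => malg_ext (mulF a c) h) : c d / c + d}.
Proof.
move=> c d; rewrite /malg_ext -big_split; apply: eq_bigr => b _ /=.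
by rewrite /mulF mulrDl monalgUD.
Qed.

Fact monalg_mulDl : left_distributive monalg_mul +%R.
Proof. by move=> g g' h; apply: malg_extD => a; apply: mulF_addl. Qed.

Fact monalg_mulDr : right_distributive monalg_mul +%R.
Proof.
move=> g h h'; rewrite /monalg_mul {1 2 3}/malg_ext -big_split.
by apply: eq_bigr => a _; apply: malg_extD => b; apply: mulF_add.
Qed.

Lemma monalg_mulU c d a b :
  monalg_mul << c *g a >> << d *g b >> = << c * d *g a * b >>.
Proof.
rewrite /monalg_mul malg_extU; last exact: mulF_addl.
by rewrite malg_extU //; apply: mulF_add.
Qed.

Fact monalg_mul0g h : monalg_mul 0 h = 0.
Proof. by apply: (addIr (monalg_mul 0 h)); rewrite -monalg_mulDl !add0r. Qed.
Fact monalg_mulg0 h : monalg_mul h 0 = 0.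
Proof. by apply: (addIr (monalg_mul h 0)); rewrite -monalg_mulDr !add0r. Qed.

Fact monalg_mulA : associative monalg_mul.
Proof.
elim/malg_ind=> [|g g' IH IH'|c a]; first by move=> h k; rewrite !monalg_mul0g.
  by move=> h k; rewrite !monalg_mulDl IH IH'.
elim/malg_ind=> [|g g' IH IH'|d b]; first by move=> k; rewrite !(monalg_mul0g, monalg_mulg0).
  by move=> k; rewrite !(monalg_mulDl, monalg_mulDr) IH IH'.
elim/malg_ind=> [|g g' IH IH'|e f]; first by rewrite !monalg_mulg0.
  by rewrite !monalg_mulDr IH IH'.
by rewrite !monalg_mulU !mulrA.
Qed.
Fact monalg_mul1 : left_id << 1 >> monalg_mul.
Proof.
elim/malg_ind=> [|g g' IH IH'|c a]; first by rewrite monalg_mulg0.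
  by rewrite monalg_mulDr IH IH'.
by rewrite monalg_mulU !mul1r.
Qed.
Fact monalg_mulr1 : right_id << 1 >> monalg_mul.
Proof.
elim/malg_ind=> [|g g' IH IH'|c a]; first by rewrite monalg_mul0g.
  by rewrite monalg_mulDl IH IH'.
by rewrite monalg_mulU !mulr1.
Qed.
HB.instance Definition _ := GRing.Zmodule_isPzRing.Build monalg_type
  monalg_mulA monalg_mul1 monalg_mulr1 monalg_mulDl monalg_mulDr.

Lemma monalgUM c d a b :
  (<< c *g a >> : monalg_type) * << d *g b >> = << c * d *g a * b >>.
Proof. exact: monalg_mulU. Qed.

Definition monalg_const (c : K) : monalg_type := << c *g 1 >>.
Fact monalg_const_zmod : zmod_morphism monalg_const.
Proof. by move=> c d; apply: monalgUB. Qed.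
Fact monalg_const_monoid : monoid_morphism monalg_const.
Proof. by split=> // c d; rewrite /monalg_const monalgUM mul1r. Qed.
HB.instance Definition _ :=
  GRing.isZmodMorphism.Build K monalg_type monalg_const monalg_const_zmod.
HB.instance Definition _ :=
  GRing.isMonoidMorphism.Build K monalg_type monalg_const monalg_const_monoid.

Fact monalg_constC c x : monalg_const c * x = x * monalg_const c.
Proof.
elim/malg_ind: x => [|g g' IH IH'|d a]; first by rewrite mulr0 mul0r.
  by rewrite mulrDr mulrDl IH IH'.
by rewrite /monalg_const !monalgUM mul1r mulr1 mulrC.
Qed.
Definition monalg_kalg : kalgebra K := KAlgebra monalg_constC.

Definition monalg_gen (a : M) : monalg_kalg := << a >>.

Section Lift.
Variables (B : kalgebra K) (h : M -> B).
Hypothesis h_monoid : monoid_morphism h.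

Definition monalg_lift_fun (g : monalg_type) : B :=
  malg_ext (fun a c => kscale c (h a)) g.

Fact monalg_lift_add a : {morph (fun c => kscale c (h a)) : c d / c + d}.
Proof. by move=> c d; rewrite /kscale rmorphD mulrDl. Qed.

Fact monalg_lift_zmod : zmod_morphism monalg_lift_fun.
Proof. exact: malg_extB monalg_lift_add. Qed.
HB.instance Definition _ :=
  GRing.isZmodMorphism.Build monalg_type B monalg_lift_fun monalg_lift_zmod.

Lemma monalg_liftU c a : monalg_lift_fun << c *g a >> = kscale c (h a).
Proof. exact: malg_extU monalg_lift_add _ _. Qed.

Fact monalg_lift_monoid : monoid_morphism monalg_lift_fun.
Proof.
case: h_monoid => h1 hM; split.
  by rewrite monalg_liftU h1 /kscale rmorph1 mulr1.
elim/malg_ind=> [|g g' IH IH'|c a] x; first by rewrite mul0r raddf0 mul0r.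
  by rewrite mulrDl !raddfD mulrDl /= IH IH'.
elim/malg_ind: x => [|g g' IH IH'|d b]; first by rewrite mulr0 raddf0 mulr0.
  by rewrite mulrDr !raddfD mulrDr /= IH IH'.
rewrite monalgUM !monalg_liftU hM /kscale rmorphM -!mulrA; congr (_ * _).
by rewrite !mulrA kconstC.
Qed.
HB.instance Definition _ :=
  GRing.isMonoidMorphism.Build monalg_type B monalg_lift_fun monalg_lift_monoid.

Fact monalg_lift_const c : monalg_lift_fun (kconst monalg_kalg c) = kconst B c.
Proof. by rewrite monalg_liftU /kscale h_monoid.1 mulr1. Qed.
Definition monalg_lift : kalg_hom monalg_kalg B :=
  @KalgHom K monalg_kalg B monalg_lift_fun monalg_lift_const.

Lemma monalg_liftE a : monalg_lift (monalg_gen a) = h a.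
Proof. by rewrite [LHS]monalg_liftU /kscale rmorph1 mul1r. Qed.

End Lift.
End MonoidAlgebra.

(* The tensor product is the free vector space on the families (x_i) modulo   *)
(* the multilinearity relations, with (x_i)(y_i) = (x_i y_i).  The span of    *)
(* these relations is stable under left and right multiplication by every     *)
(* family, so it equals the two-sided ideal that they generate.               *)
Section Tensor.
Variables (K : fieldType) (I : finType) (A : I -> kalgebra K).
Local Notation P := (prod_kalg A).
Local Notation fam x := (monalg_gen K (x : P)).

Inductive multilinear_rel : monalg_kalg K P -> Prop :=
| multilinear_add (x : P) i (u v : A i) :
    multilinear_rel
      (fam (dfwith x (u + v)) - fam (dfwith x u) - fam (dfwith x v))
| multilinear_scale (x : P) i c (u : A i) :
    multilinear_rel
      (fam (dfwith x (kscale c u)) - kscale c (fam (dfwith x u))).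

Definition tensor : kalgebra K := quot_kalg multilinear_rel.

Definition pure_tensor (x : forall i, A i) : tensor := quot_hom _ (fam x).

Lemma pure_tensorM (x y : P) : pure_tensor (x * y) = pure_tensor x * pure_tensor y.
Proof. by rewrite /pure_tensor -rmorphM /monalg_gen monalgUM mulr1. Qed.

Lemma pure_tensor1 : pure_tensor (1 : P) = 1.
Proof. by rewrite /pure_tensor -[RHS](rmorph1 (quot_hom multilinear_rel)). Qed.

Lemma pure_tensorD (x : P) i (u v : A i) :
  pure_tensor (dfwith x (u + v)) = pure_tensor (dfwith x u) + pure_tensor (dfwith x v).
Proof.
apply/eqP; rewrite -subr_eq0 opprD addrA /pure_tensor -!rmorphB; apply/eqP.
rewrite -(rmorph0 (quot_hom multilinear_rel)); apply/quot_projP; rewrite subr0.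
exact/ideal_gen/multilinear_add.
Qed.

Lemma pure_tensorZ (x : P) i c (u : A i) :
  pure_tensor (dfwith x (kscale c u)) = kscale c (pure_tensor (dfwith x u)).
Proof.
rewrite -[RHS]kalg_hom_scale; apply/quot_projP.
exact/ideal_gen/multilinear_scale.
Qed.

Lemma tensor_ind (T : tensor -> Prop) :
  T 0 -> (forall y z, T y -> T z -> T (y + z)) ->
  (forall c x, T (kscale c (pure_tensor x))) -> forall z, T z.
Proof.
move=> T0 TD TU; elim/quot_projW; elim/malg_ind => [|g h Tg Th|c x].
- by rewrite rmorph0.
- by rewrite rmorphD; apply: TD.
- have := TU c x; rewrite /pure_tensor -kalg_hom_scale; congr (T (quot_proj _ _)).
  by rewrite /kscale /monalg_gen [LHS]monalgUM mulr1 mul1r.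
Qed.

End Tensor.

Section TensorMap.
Variables (K : fieldType) (I : finType) (A B : I -> kalgebra K).
Variable f : forall i, kalg_hom (A i) (B i).

Definition pure_map (x : prod_kalg A) : tensor B := pure_tensor (fun i => f i (x i)).

Fact pure_map_monoid : monoid_morphism pure_map.
Proof.
split=> [|x y].
  rewrite /pure_map -[RHS]pure_tensor1; congr pure_tensor.
  by apply: functional_extensionality_dep => i; apply: rmorph1.
rewrite /pure_map -[RHS]pure_tensorM; congr pure_tensor.
by apply: functional_extensionality_dep => i; apply: rmorphM.
Qed.

Lemma dfwith_map (x : prod_kalg A) i (u : A i) :
  (fun j => f j (dfwith x u j)) = dfwith (fun j => f j (x j)) (f i u).
Proof.
apply: functional_extensionality_dep => j.
by case: (eqVneq i j) => [<-|ij]; rewrite ?dfwith_in ?dfwith_out.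
Qed.

Fact tensor_map_rel g :
  multilinear_rel g -> monalg_lift pure_map_monoid g = 0.
Proof.
case=> [x i u v|x i c u]; rewrite !rmorphB ?kalg_hom_scale !monalg_liftE.
  by rewrite /pure_map !dfwith_map rmorphD pure_tensorD addrAC addrK subrr.
by rewrite /pure_map !dfwith_map kalg_hom_scale pure_tensorZ subrr.
Qed.

Definition tensor_map : kalg_hom (tensor A) (tensor B) :=
  quot_lift tensor_map_rel.

Lemma tensor_map_pure x : tensor_map (pure_tensor x) = pure_tensor (fun i => f i (x i)).
Proof. by rewrite quot_liftE monalg_liftE. Qed.

End TensorMap.

Record kalg_action (K : fieldType) (G : finZmodType) (A : kalgebra K) :=
  KalgAction {
    kact :> G -> kalg_hom A A;
    kact0 : forall x, kact 0 x = x;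
    kactD : forall g h x, kact (g + h) x = kact g (kact h x) }.

(* An element f stands for the sum of the f(g) g, and G is written            *)
(* additively.                                                                *)
Section CrossedProduct.
Variables (K : fieldType) (G : finZmodType) (A : kalgebra K).
Variable act : kalg_action G A.

Definition crossed_type := {ffun G -> A}.
HB.instance Definition _ := GRing.Zmodule.on crossed_type.

Implicit Types f h l : crossed_type.

Definition crossed_single (a : A) (g : G) : crossed_type :=
  [ffun k => if k == g then a else 0].

Definition crossed_mul f h : crossed_type :=
  [ffun k => \sum_g f g * act g (h (k - g))].

Fact crossed_mulA : associative crossed_mul.
Proof.
move=> f h l; apply/ffunP=> k; rewrite !ffunE.
transitivity (\sum_g \sum_u f g * act g (h (u - g)) * act u (l (k - u))).
  apply: eq_bigr => g _; rewrite ffunE rmorph_sum mulr_sumr.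
  rewrite (reindex_inj (addIr (- g))) /=; apply: eq_bigr => u _.
  rewrite rmorphM mulrA -kactD addrCA subrr addr0; congr (_ * act _ (l _)).
  by rewrite opprB addrA subrK.
rewrite exchange_big; apply: eq_bigr => u _ /=.
by rewrite ffunE mulr_suml.
Qed.

Lemma crossed_single_mull a g h k :
  crossed_mul (crossed_single a g) h k = a * act g (h (k - g)).
Proof.
rewrite ffunE (bigD1 g) //= ffunE eqxx big1 ?addr0 // => u /negPf ug.
by rewrite ffunE ug mul0r.
Qed.

Lemma crossed_single_mulr a f k :
  crossed_mul f (crossed_single a 0) k = f k * act k a.
Proof.
rewrite ffunE (bigD1 k) //= ffunE subrr eqxx big1 ?addr0 // => u uk.
by rewrite ffunE subr_eq0 eq_sym (negPf uk) rmorph0 mulr0.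
Qed.

Fact crossed_mul1 : left_id (crossed_single 1 0) crossed_mul.
Proof.
by move=> f; apply/ffunP=> k; rewrite crossed_single_mull mul1r kact0 subr0.
Qed.
Fact crossed_mulr1 : right_id (crossed_single 1 0) crossed_mul.
Proof.
by move=> f; apply/ffunP=> k; rewrite crossed_single_mulr rmorph1 mulr1.
Qed.
Fact crossed_mulDl : left_distributive crossed_mul +%R.
Proof.
move=> f h l; apply/ffunP=> k; rewrite !ffunE -big_split.
by apply: eq_bigr => g _; rewrite ffunE mulrDl.
Qed.
Fact crossed_mulDr : right_distributive crossed_mul +%R.
Proof.
move=> f h l; apply/ffunP=> k; rewrite !ffunE -big_split.
by apply: eq_bigr => g _; rewrite ffunE rmorphD mulrDr.
Qed.
HB.instance Definition _ := GRing.Zmodule_isPzRing.Build crossed_type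
  crossed_mulA crossed_mul1 crossed_mulr1 crossed_mulDl crossed_mulDr.

Lemma crossed_singleM (a b : A) (g u : G) :
  crossed_single a g * crossed_single b u = crossed_single (a * act g b) (g + u).
Proof.
apply/ffunP=> k; rewrite [LHS]crossed_single_mull !ffunE subr_eq [u + g]addrC.
by case: eqP => // _; rewrite rmorph0 mulr0.
Qed.

Definition crossed_const (c : K) : crossed_type := crossed_single (kconst A c) 0.
Fact crossed_const_zmod : zmod_morphism crossed_const.
Proof.
move=> c d; apply/ffunP=> k; rewrite !ffunE.
by case: eqP => _; rewrite ?rmorphB ?subr0.
Qed.
Fact crossed_const_monoid : monoid_morphism crossed_const.
Proof.
split=> [|c d]; first by rewrite /crossed_const rmorph1.
by rewrite /crossed_const crossed_singleM kact0 rmorphM addr0.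
Qed.
HB.instance Definition _ :=
  GRing.isZmodMorphism.Build K crossed_type crossed_const crossed_const_zmod.
HB.instance Definition _ :=
  GRing.isMonoidMorphism.Build K crossed_type crossed_const crossed_const_monoid.

Fact crossed_constC c f : crossed_const c * f = f * crossed_const c.
Proof.
apply/ffunP=> k; rewrite [LHS]crossed_single_mull [RHS]crossed_single_mulr.
by rewrite kact0 subr0 kalg_hom_const kconstC.
Qed.
Definition crossed : kalgebra K := KAlgebra crossed_constC.

End CrossedProduct.

Section CyclicAction.
Variables (K : fieldType) (A : kalgebra K) (s : kalg_hom A A) (p : nat).
Hypotheses (p_gt1 : (1 < p)%N) (sp : forall x, iter p s x = x).

Let zp_act (g : 'Z_p) : kalg_hom A A := kalg_iter s g.

Fact zp_act0 x : zp_act 0 x = x.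
Proof. by []. Qed.

Fact zp_actD g h x : zp_act (g + h) x = zp_act g (zp_act h x).
Proof.
rewrite /zp_act !kalg_iterE -iterD.
have iter_mul m y : iter (m * p) s y = y.
  by elim: m => //= m IHm; rewrite mulSn iterD IHm sp.
have -> : (g + h)%R = ((g + h) %% p)%N :> nat.
  exact: (congr1 (modn (g + h)) (Zp_cast p_gt1)).
by rewrite [in RHS](divn_eq (g + h) p) addnC iterD iter_mul.
Qed.

(* 'Z_p acts through s: its generator 1 acts as s.                            *)
Definition cyclic_action : kalg_action 'Z_p A := KalgAction zp_act0 zp_actD.

End CyclicAction.

Section Subalgebra.
Variables (K : fieldType) (A : kalgebra K) (S : A -> Prop).

Inductive in_subalg : A -> Prop :=
| subalg_gen x of S x : in_subalg x
| subalg_const c : in_subalg (kconst A c)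
| subalg_sub x y of in_subalg x & in_subalg y : in_subalg (x - y)
| subalg_mul x y of in_subalg x & in_subalg y : in_subalg (x * y).

Definition subalg_pred : {pred A} := fun x => `[< in_subalg x >].

Fact subalg_subring_closed : subring_closed subalg_pred.
Proof.
split=> [|x y /asboolP xS /asboolP yS|x y /asboolP xS /asboolP yS];
  apply/asboolP; [|exact: subalg_sub|exact: subalg_mul].
by rewrite -(rmorph1 (kconst A)); apply: subalg_const.
Qed.

Definition subalg_type := {x : A | subalg_pred x}.
HB.instance Definition _ := SubChoice.on subalg_type.
HB.instance Definition _ :=
  GRing.SubChoice_isSubPzRing.Build A subalg_pred subalg_type
    subalg_subring_closed.

Fact subalg_const_pred c : subalg_pred (kconst A c).
Proof. by apply/asboolP/subalg_const. Qed.
Definition subalg_kconst (c : K) : subalg_type := 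
  exist (fun x : A => subalg_pred x) _ (subalg_const_pred c).

Fact subalg_kconst_zmod : zmod_morphism subalg_kconst.
Proof. by move=> c d; apply: val_inj; rewrite raddfB /= rmorphB. Qed.
Fact subalg_kconst_monoid : monoid_morphism subalg_kconst.
Proof.
split=> [|c d]; apply: val_inj; first by rewrite rmorph1 /= rmorph1.
by rewrite rmorphM /= rmorphM.
Qed.
HB.instance Definition _ :=
  GRing.isZmodMorphism.Build K subalg_type subalg_kconst subalg_kconst_zmod.
HB.instance Definition _ :=
  GRing.isMonoidMorphism.Build K subalg_type subalg_kconst subalg_kconst_monoid.

Fact subalg_kconstC c x : subalg_kconst c * x = x * subalg_kconst c.
Proof. by apply: val_inj; rewrite !rmorphM /= kconstC. Qed.
Definition subalg : kalgebra K := KAlgebra subalg_kconstC.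

End Subalgebra.

Section FreeAlgebra.
Variables (K : fieldType) (I : choiceType).
Local Notation F := {malg K[{fmonom I}]}.

Fact free_constC c (x : F) :
  mkmalgU (mone : {fmonom I}) c * x = x * mkmalgU (mone : {fmonom I}) c.
Proof.
elim/malg_ind: x => [|g g' IH IH'|d a]; first by rewrite mulr0 mul0r.
  by rewrite mulrDr mulrDl IH IH'.
by rewrite !malgM_def !fgmulUU mul1m mulm1 mulrC.
Qed.
Definition free_kalg : kalgebra K := @KAlgebra K F _ free_constC.

Definition free_gen (i : I) : free_kalg := << fmu i >>.

Section Lift.
Variables (B : kalgebra K) (u : I -> B).

Definition free_lift_fun (g : F) : B :=
  malg_ext (fun (m : {fmonom I}) c => kscale c (\prod_(i <- m) u i)) g.

Fact free_lift_add (m : {fmonom I}) :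
  {morph (fun c => kscale c (\prod_(i <- m) u i)) : c d / c + d}.
Proof. by move=> c d; rewrite /kscale rmorphD mulrDl. Qed.

Fact free_lift_zmod : zmod_morphism free_lift_fun.
Proof. exact: malg_extB free_lift_add. Qed.
HB.instance Definition _ :=
  GRing.isZmodMorphism.Build F B free_lift_fun free_lift_zmod.

Lemma free_liftU c m :
  free_lift_fun << c *g m >> = kscale c (\prod_(i <- m) u i).
Proof. exact: malg_extU free_lift_add _ _. Qed.

Lemma free_liftD : {morph free_lift_fun : g h / g + h}.
Proof. exact: malg_extD free_lift_add. Qed.
Lemma free_lift0 : free_lift_fun 0 = 0.
Proof. exact: raddf0. Qed.

Fact free_lift_monoid : monoid_morphism free_lift_fun.
Proof.
split; first by rewrite free_liftU fm1 big_nil /kscale rmorph1 mulr1.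
elim/malg_ind=> [|g g' IH IH'|c a] x; first by rewrite mul0r free_lift0 mul0r.
  by rewrite mulrDl !free_liftD mulrDl IH IH'.
elim/malg_ind: x => [|g g' IH IH'|d b]; first by rewrite mulr0 free_lift0 mulr0.
  by rewrite mulrDr !free_liftD mulrDr IH IH'.
rewrite malgM_def fgmulUU !free_liftU fmM big_cat /kscale rmorphM -!mulrA.
by congr (_ * _); rewrite !mulrA kconstC.
Qed.
HB.instance Definition _ :=
  GRing.isMonoidMorphism.Build F B free_lift_fun free_lift_monoid.

Fact free_lift_const c : free_lift_fun (kconst free_kalg c) = kconst B c.
Proof. by rewrite free_liftU fm1 big_nil /kscale mulr1. Qed.
Definition free_lift : kalg_hom free_kalg B :=
  @KalgHom K free_kalg B free_lift_fun free_lift_const.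

Lemma free_liftE i : free_lift (free_gen i) = u i.
Proof. by rewrite [LHS]free_liftU fmU big_seq1 /kscale rmorph1 mul1r. Qed.

End Lift.

Lemma free_hom_ext (B : kalgebra K) (f g : kalg_hom free_kalg B) :
  (forall i, f (free_gen i) = g (free_gen i)) -> f =1 g.
Proof.
move=> fg; elim/malg_ind => [|x y fgx fgy|c [m]]; first by rewrite !rmorph0.
  by rewrite !rmorphD fgx fgy.
have -> : << c *g FMonom m >> =
    kconst free_kalg c * \prod_(i <- m) free_gen i.
  elim: m c => [|i m IHm] c; first by rewrite big_nil mulr1 -fmoneE.
  rewrite big_cons mulrA kconstC -mulrA -IHm.
  by rewrite [RHS]malgM_def fgmulUU mul1r /mmul /= fmuE fmmulE.
rewrite !rmorphM !kalg_hom_const !rmorph_prod; congr (_ * _).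
exact: eq_bigr.
Qed.

End FreeAlgebra.

Section RootInverse.
Variables (K : fieldType) (A : kalgebra K) (u : A).

Lemma root_inv (s : seq K) :
  (forall c, c \in s -> c != 0) -> \prod_(c <- s) (u - kconst A c) = 0 ->
  exists w, w * u = 1 /\ u * w = 1.
Proof.
have commc c : GRing.comm u (kconst A c) by apply/esym/kconstC.
move=> s0 prod0.
have [w uw [d d0 Es]] : exists2 w, GRing.comm u w &
    exists2 d, d != 0 & \prod_(c <- s) (u - kconst A c) = u * w + kconst A d.
  elim: s s0 {prod0} => [|c s IHs] s0.
    exists 0; first exact: commr0.
    by exists 1; rewrite ?oner_neq0 // big_nil rmorph1 mulr0 add0r.
  have [|w uw [d d0 Es]] := IHs.
    by move=> x xs; apply: s0; rewrite inE xs orbT.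
  exists (u * w + kconst A d - kconst A c * w).
    by apply: commrB; [apply: commrD|]; rewrite //; apply: commrM.
  exists (- (c * d)); first by rewrite oppr_eq0 mulf_neq0 // s0 ?mem_head.
  rewrite big_cons Es mulrBl rmorphN rmorphM mulrBr -addrA; congr (_ + _).
  by rewrite mulrDr opprD !mulrA kconstC.
exists (- (kconst A d^-1 * w)).
have uwE : u * w = - kconst A d by apply/eqP; rewrite -addr_eq0 -Es prod0.
rewrite mulrN mulNr mulrA -kconstC -!mulrA -uw uwE mulrN opprK -rmorphM.
by rewrite mulVf ?rmorph1.
Qed.

End RootInverse.

Lemma root_expr_inv (K : fieldType) (A : kalgebra K) (u : A) p (s : seq K) :
  (0 < p)%N -> (forall c, c \in s -> c != 0) ->
  \prod_(c <- s) (u ^+ p - kconst A (c ^+ p)) = 0 ->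
  exists w, w * u = 1 /\ u * w = 1.
Proof.
case: p => // p _ s0 prod0.
have [||w [wu uw]] := @root_inv K A (u ^+ p.+1) [seq c ^+ p.+1 | c <- s].
- by move=> _ /mapP[c cs ->]; rewrite expf_neq0 ?s0.
- by rewrite big_map.
have uv : u * (u ^+ p * w) = 1 by rewrite mulrA -exprS.
have vu : w * u ^+ p * u = 1 by rewrite -mulrA -exprSr.
exists (u ^+ p * w); split=> //.
by rewrite -[u ^+ p * w]mul1r -vu -[_ * u * _]mulrA uv mulr1.
Qed.


Section CyclotomicHecke.
Variables (K : fieldType) (p : nat) (q : K) (X : seq K).

Section Relations.
Variables (A : kalgebra K) (m : nat) (T : 'I_m.+1 -> A).
Local Notation kc := (kconst A).

(* The elements z for which z = 0 is a defining relation of H_{ps,m+1}(X).    *)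
Inductive hecke_rel : A -> Prop :=
| hecke_cyclotomic :
    hecke_rel (\prod_(x <- X) (T ord0 ^+ p - kc (x ^+ p)))
| hecke_braid4 (i : 'I_m.+1) of i = 1%N :> nat :
    hecke_rel (T ord0 * T i * T ord0 * T i - T i * T ord0 * T i * T ord0)
| hecke_quadratic (i : 'I_m.+1) of (0 < i)%N :
    hecke_rel ((T i + 1) * (T i - kc q))
| hecke_braid3 (i j : 'I_m.+1) of (0 < i)%N & j = i.+1 :> nat :
    hecke_rel (T i * T j * T i - T j * T i * T j)
| hecke_comm (i j : 'I_m.+1) of (i.+1 < j)%N :
    hecke_rel (T i * T j - T j * T i).

Lemma hecke_rel_twist (B : kalgebra K) (f g : kalg_hom A B) (eps : K) z :
  eps ^+ p = 1 ->
  (forall i, f (T i) = if i == ord0 then kscale eps (g (T i)) else g (T i)) ->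
  hecke_rel z -> g z = 0 -> f z = 0.
Proof.
move=> eps_p fT.
have ne0 (i : 'I_m.+1) : (0 < i)%N -> (i == ord0) = false by case: i => -[].
pose homE := (kalg_homB, kalg_homD, kalg_homM, kalg_hom1, kalg_hom_const).
case=> [|i i1|i i0|i j i0 ij|i j ij].
- rewrite !kalg_hom_prod => <-; apply: eq_bigr => x _.
  by rewrite !homE !kalg_homX fT eqxx kscaleX eps_p kscale1.
- rewrite !homE !fT eqxx ne0 ?i1 // => R0.
  by rewrite !(kscaleAl, kscaleAr) -!kscaleB R0 !kscale0.
- by rewrite !homE !fT ne0.
- by rewrite !homE !fT !ne0 // ij.
- rewrite !homE !fT (ne0 j) ?(leq_trans _ ij) //; case: ifP => // _ R0.
  by rewrite !(kscaleAl, kscaleAr) -!kscaleB R0 !kscale0.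
Qed.

End Relations.

Lemma twist_iter (B : kalgebra K) (s : kalg_hom B B) (eps : K) (b : bool) t k :
  s t = (if b then kscale eps t else t) ->
  iter k s t = if b then kscale (eps ^+ k) t else t.
Proof.
move=> st; elim: k => [|k /= ->]; first by rewrite kscale1 if_same.
case: b st => st; last by rewrite st.
by rewrite kalg_hom_scale st /kscale mulrA -rmorphM exprSr.
Qed.

Section Presentation.
Variable m : nat.

Definition hecke_pos : kalgebra K := quot_kalg (hecke_rel (@free_gen K 'I_m.+1)).

Definition heckeT_pos (i : 'I_m.+1) : hecke_pos :=
  quot_hom (hecke_rel (@free_gen K 'I_m.+1)) (free_gen K i).

End Presentation.

(* H_{ps,m}(X) for s = size X.                                                *)
Definition hecke (m : nat) : kalgebra K :=
  if m is m'.+1 then hecke_pos m' else base_kalg K.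

Definition heckeT (m : nat) : 'I_m -> hecke m :=
  if m is m'.+1 return 'I_m -> hecke m then @heckeT_pos m' else fun=> 0.

Section Sigma.
Variables (eps : K) (eps_p : eps ^+ p = 1).

Section Positive.
Variable m : nat.

Definition sigma_gen (i : 'I_m.+1) : hecke_pos m :=
  if i == ord0 then kscale eps (heckeT_pos i) else heckeT_pos i.

Fact sigma_rel z :
  hecke_rel (@free_gen K 'I_m.+1) z -> free_lift sigma_gen z = 0.
Proof.
move=> Rz; apply: (hecke_rel_twist (g := quot_hom _) eps_p _ Rz).
  by move=> i; rewrite free_liftE.
exact: quot_hom_rel.
Qed.

Definition sigma_pos : kalg_hom (hecke_pos m) (hecke_pos m) :=
  quot_lift sigma_rel.

Lemma sigma_posE i : sigma_pos (heckeT_pos i) = sigma_gen i.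
Proof. by rewrite quot_liftE free_liftE. Qed.

End Positive.

Definition sigma (m : nat) : kalg_hom (hecke m) (hecke m) :=
  if m is m'.+1 return kalg_hom (hecke m) (hecke m) then sigma_pos m'
  else kalg_id _.

Lemma sigmaE m (i : 'I_m) :
  sigma m (heckeT i) =
    if i == 0%N :> nat then kscale eps (heckeT i) else heckeT i.
Proof. by case: m i => [[]|m i] //; apply: sigma_posE. Qed.

Lemma sigma_order m x : iter p (sigma m) x = x.
Proof.
case: m x => [|m] x; first by elim: p => //= k ->.
elim/quot_projW: x => x; rewrite -kalg_iterE.
have := @free_hom_ext K 'I_m.+1 _
  (kalg_comp (kalg_iter (sigma_pos m) p) (quot_hom _))
  (quot_hom _).
apply=> i; rewrite /= kalg_iterE -[quot_proj _ _]/(heckeT_pos i).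
rewrite (twist_iter _ (sigma_posE i)) eps_p.
by case: ifP => _ //; rewrite ?kscale1.
Qed.

End Sigma.

(* The subalgebra H_{r,p,n}(X), r = p * size X.                               *)
Inductive hecke_rpn_gen (n : nat) : hecke n -> Prop :=
| rpn_T0p (i : 'I_n) of i = 0%N :> nat : hecke_rpn_gen (heckeT i ^+ p)
| rpn_T0T1T0 (i j : 'I_n) of i = 0%N :> nat & j = 1%N :> nat :
    hecke_rpn_gen (kinv (heckeT i) * heckeT j * heckeT i)
| rpn_T (j : 'I_n) of (0 < j)%N : hecke_rpn_gen (heckeT j).

Definition hecke_rpn (n : nat) : kalgebra K := subalg (@hecke_rpn_gen n).

Lemma heckeT0_inv m (i : 'I_m) :
  (0 < p)%N -> (forall x, x \in X -> x != 0) -> i = 0%N :> nat ->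
  kinv (heckeT i) * heckeT i = 1 /\ heckeT i * kinv (heckeT i) = 1.
Proof.
case: m i => [[]//|m] i p0 X0 i0; apply/kinvP/(root_expr_inv p0 X0).
have -> : i = ord0 by apply/val_inj.
rewrite -[RHS](quot_hom_rel (hecke_cyclotomic (@free_gen K 'I_m.+1))).
rewrite kalg_hom_prod; apply: eq_bigr => x _.
by rewrite kalg_homB kalg_homX kalg_hom_const.
Qed.

End CyclotomicHecke.

Section TensorSigma.
Variables (K : fieldType) (p : nat) (q eps : K) (kappa : nat).
Variables (Qs : 'I_kappa -> seq K) (b : 'I_kappa -> nat).
Hypotheses (p_gt1 : (1 < p)%N) (eps_p : eps ^+ p = 1).

Definition hecke_tensor : kalgebra K :=
  tensor (fun a => hecke p q (Qs a) (b a)).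

Definition tensor_sigma : kalg_hom hecke_tensor hecke_tensor :=
  tensor_map (fun a => sigma q (Qs a) eps_p (b a)).

Fact tensor_sigma_order z : iter p tensor_sigma z = z.
Proof.
rewrite -kalg_iterE; elim/tensor_ind: z => [|y z IHy IHz|c x].
- exact: kalg_hom0.
- by rewrite kalg_homD IHy IHz.
rewrite kalg_hom_scale kalg_iterE; congr kscale.
have -> k : iter k tensor_sigma (pure_tensor x) =
    pure_tensor (fun a => iter k (sigma q (Qs a) eps_p (b a)) (x a)).
  by elim: k => //= k ->; apply: tensor_map_pure.
congr pure_tensor; apply: functional_extensionality_dep => a.
exact: sigma_order.
Qed.

Definition hecke_tensor_crossed : kalgebra K :=
  crossed (cyclic_action p_gt1 tensor_sigma_order).

End TensorSigma.

(* The tuples (b_1, ..., b_kappa) of natural numbers of sum n.                *)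
Definition composition (kappa n : nat) :=
  {b : {ffun 'I_kappa -> 'I_n.+1} | (\sum_a b a == n)%N}.

Definition hecke_sum (K : fieldType) (p : nat) (q eps : K) (kappa : nat)
    (Qs : 'I_kappa -> seq K) (n : nat)
    (p_gt1 : (1 < p)%N) (eps_p : eps ^+ p = 1) : kalgebra K :=
  prod_kalg (fun b : composition kappa n =>
    hecke_tensor_crossed q Qs (fun a => val b a) p_gt1 eps_p).

Definition same_orbit (K : fieldType) (eps q x y : K) : Prop :=
  exists a b : int, x = eps ^ a * q ^ b * y.

Section Morita.
Variable K : fieldType.

(* K-linear functors from left A-modules to left B-modules; a K-algebra acts  *)
(* on its modules through its structure map, and so does K.                   *)
Record mod_functor (A B : kalgebra K) := ModFunctor {
  fobj :> lmodType A -> lmodType B;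
  fmor : forall M N : lmodType A, {linear M -> N} -> {linear fobj M -> fobj N};
  fmor_id : forall (M : lmodType A) (x : fobj M), fmor idfun x = x;
  fmor_comp : forall (M N P : lmodType A) (f : {linear N -> P})
      (g : {linear M -> N}) (x : fobj M),
    fmor (f \o g) x = fmor f (fmor g x);
  fmor_linear : forall (M N : lmodType A) (c : K) (f g h : {linear M -> N}),
    (forall x, h x = kconst A c *: f x + g x) ->
    forall y, fmor h y = kconst B c *: fmor f y + fmor g y }.

Definition morita_equivalent (A B : kalgebra K) : Prop :=
  exists (F : mod_functor A B) (G : mod_functor B A)
         (eta : forall M : lmodType A, {linear M -> G (F M)})
         (theta : forall N : lmodType B, {linear F (G N) -> N}),
  [/\ forall M, bijective (eta M),
      forall N, bijective (theta N),
      forall (M M' : lmodType A) (f : {linear M -> M'}) x,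
        eta M' (f x) = fmor G (fmor F f) (eta M x)
    & forall (N N' : lmodType B) (f : {linear N -> N'}) y,
        f (theta N y) = theta N' (fmor F (fmor G f) y)].

End Morita.

(* Main.v *)
(* Let H = H_{r,n}(Q), let sigma(T_0) = eps T_0 and C = H x| Z_p.  Both        *)
(* algebras are isomorphic to full corners of C.                              *)
(*                                                                            *)
(* The idempotent e = p^-1 sum_g g cuts out the algebra H^sigma of fixed      *)
(* points.  Since T_0 normalizes H_{r,p,n}(Q), H is spanned by the products   *)
(* T_0^k h with h in H_{r,p,n}(Q), and averaging over Z_p gives               *)
(* H^sigma = H_{r,p,n}(Q).  It is full since C contains the sum of the        *)
(* T_0^-k e T_0^k for k < p, which is 1.                                      *)
(*                                                                            *)
(* For the other corner let L_0 = T_0 and L_i = q^-1 T_i L_{i-1} T_i.  The    *)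
(* eigenvalues of L_i^p are among the x^p q^{pk} with x in Q, and the         *)
(* hypothesis on orbits says that those with x in different Q_alpha are       *)
(* distinct.  Simultaneous spectral projections give orthogonal               *)
(* sigma-invariant idempotents e(a) of sum 1, for a in {1..kappa}^n.  The     *)
(* intertwiners T_i L_{i-1} - L_{i-1} T_i exchange e(a) and e(s_i a), and     *)
(* are invertible there if a_{i-1} and a_i differ, so the e(a) with a sorted  *)
(* generate the unit ideal.  Let a be the sorted word in which alpha occurs   *)
(* b_alpha times.  Mapping T_0 of the factor alpha to the first L_i of the    *)
(* block alpha of a gives a homomorphism from the tensor product of the       *)
(* H_{p t_alpha,b_alpha}(Q_alpha) to e(a) H e(a).  It is onto because H e(a)  *)
(* is spanned by products of intertwiners times its image, and injective      *)
(* because H acts on the functions from the words of content b to the tensor  *)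
(* product, and the image acts by left multiplication at the word a.          *)

Require Import Defs.
From HB Require Import structures.
From mathcomp Require Import all_boot all_order all_algebra.
From mathcomp Require Import boolp finmap monalg zify.
From Stdlib Require Ncring Ncring_tac.

Set Implicit Arguments.
Unset Strict Implicit.
Unset Printing Implicit Defensive.
Import GRing.Theory.
Local Open Scope ring_scope.

(** * Morita equivalence with a full corner *)

(** A corner [e R e] with [R e R = R] is Morita equivalent to [R] ([morita_full_corner]). Both
    algebras are realized as such corners of one crossed product, by [rpn_corner] and
    [block_sum_corner].

    The first uses only that T_0 is invertible, is scaled by sigma and normalizes the subalgebra
    ([fixed_corner]). The second rests on the Jucys-Murphy elements L_i. The eigenvalues of L_i^p
    are confined to the x^p times powers of q^p ([jm_spectrum]), and the orbit hypothesis keeps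
    those of different Q_alpha apart even up to powers of q^p ([cyc_poly_separated]). Working with
    p-th powers makes the resulting idempotents e(a) invariant under sigma. Where adjacent letters
    of a differ, L_{i+1} - q^j L_i is invertible on e(a), hence so is the intertwiner
    ([psi_sq_unit]), and sorted words suffice ([ew_ideal]). Where they agree, T_{i+1} commutes with
    e(a) ([T_ew]). Together with [first_occurrence], which finds the cyclotomic relation of a factor
    at the start of its block, this yields the homomorphism [block_map] from the tensor product to
    e(a) H e(a).

    Surjectivity ([block_onto]) comes from the spanning set [span_all]. Injectivity
    ([block_map_inj]) uses no dimension count: an explicit representation of H on functions of words
    is built in which the image acts by left multiplication ([rep_block_map]). The delicate relation
    there is the braid relation, [rep_T_braid]. *)

Section InverseLinear.
Variables (R : pzRingType) (M N : lmodType R) (f : {linear M -> N}).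
Hypothesis f_bij : bijective f.

Lemma bij_linear_inv :
  exists2 g : {linear N -> M}, cancel f g & cancel g f.
Proof.
case: f_bij => g fK gK.
have glin : linear g.
  by move=> a x y; apply: (can_inj fK); rewrite linearP !gK.
pose G := GRing.isLinear.Build R N M *:%R g glin.
pose GL : {linear N -> M} := HB.pack g G.
by exists GL.
Qed.

End InverseLinear.

Section MoritaEquivalenceRelation.
Variable K : fieldType.

(** The case c = 0 of [fmor_linear]. It compares functors on maps that agree pointwise, without an
    equality of bundled linear maps. *)
Lemma fmor_ext (A B : kalgebra K) (F : mod_functor A B) (M N : lmodType A)
    (f g : {linear M -> N}) : f =1 g -> fmor F f =1 fmor F g.
Proof.
move=> fg x; have := @fmor_linear _ _ _ F M N 0 f g f.
by rewrite !rmorph0 => ->; rewrite ?scale0r ?add0r // => y; rewrite scale0r add0r.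
Qed.

Definition mod_comp (A B C : kalgebra K) (F : mod_functor B C)
    (G : mod_functor A B) : mod_functor A C.
Proof.
exists (fun M => F (G M)) (fun M N f => fmor F (fmor G f)).
- move=> M x; rewrite -[RHS](fmor_id (m:=F)); apply: fmor_ext => y.
  exact: fmor_id.
- move=> M N P f g x; rewrite -fmor_comp; apply: fmor_ext => y.
  exact: fmor_comp.
- move=> M N c f g h hE y; apply: fmor_linear => x.
  exact: fmor_linear.
Defined.

Lemma morita_sym (A B : kalgebra K) :
  morita_equivalent A B -> morita_equivalent B A.
Proof.
case=> F [G [eta [theta [etab thetab etan thetan]]]].
have etaI M := bij_linear_inv (etab M).
have thetaI N := bij_linear_inv (thetab N).
pose eta' N := s2val (cid2 (thetaI N)).
have eta'K N : cancel (eta' N) (theta N) by exact: (s2valP' (cid2 (thetaI N))).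
have Keta' N : cancel (theta N) (eta' N) by exact: (s2valP (cid2 (thetaI N))).
pose theta' N := s2val (cid2 (etaI N)).
have theta'K N : cancel (theta' N) (eta N) by exact: (s2valP' (cid2 (etaI N))).
have Ktheta' N : cancel (eta N) (theta' N) by exact: (s2valP (cid2 (etaI N))).
exists G, F, eta', theta'; split.
- by move=> N; exact: Bijective (eta'K N) (Keta' N).
- by move=> M; exact: Bijective (theta'K M) (Ktheta' M).
- by move=> M M' f x; apply: (can_inj (Keta' M')); rewrite eta'K -thetan eta'K.
- by move=> N N' f y; apply: (can_inj (Ktheta' N')); rewrite etan !theta'K.
Qed.

Lemma fmor_bij (A B : kalgebra K) (F : mod_functor A B) (M N : lmodType A)
    (f : {linear M -> N}) : bijective f -> bijective (fmor F f).
Proof.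
move=> /bij_linear_inv[g fK gK]; exists (fmor F g) => x.
  by rewrite -fmor_comp -[RHS](fmor_id (m:=F)); apply: fmor_ext => y /=; rewrite fK.
by rewrite -fmor_comp -[RHS](fmor_id (m:=F)); apply: fmor_ext => y /=; rewrite gK.
Qed.

Lemma morita_trans (A B C : kalgebra K) :
  morita_equivalent A B -> morita_equivalent B C -> morita_equivalent A C.
Proof.
case=> F [G [eta [theta [etab thetab etan thetan]]]].
case=> F' [G' [eta' [theta' [etab' thetab' etan' thetan']]]].
exists (mod_comp F' F), (mod_comp G G').
exists (fun M => fmor G (eta' (F M)) \o eta M : {linear _ -> _}).
exists (fun N => theta' N \o fmor F' (theta (G' N)) : {linear _ -> _}).
split=> /=.
- by move=> M; exact: bij_comp (fmor_bij G (etab' (F M))) (etab M).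
- by move=> N; exact: bij_comp (thetab' N) (fmor_bij F' (thetab (G' N))).
- move=> M M' f x /=; rewrite etan -!fmor_comp; apply: fmor_ext => y /=.
  exact: etan'.
- move=> N N' f y /=; rewrite thetan'; congr (theta' _ _).
  rewrite -!fmor_comp; apply: fmor_ext => z /=; exact: thetan.
Qed.

End MoritaEquivalenceRelation.

(* An isomorphism j of S onto the corner e R e, for a full idempotent e.      *)
Record full_corner (K : fieldType) (R S : kalgebra K) := FullCorner {
  cidem : R;
  cmap :> S -> R;
  cmapD : {morph cmap : x y / x + y};
  cmapM : {morph cmap : x y / x * y};
  cmapC : forall c, cmap (kconst S c) = kconst R c * cidem;
  cmap_inj : injective cmap;
  cmap_onto : forall x, exists s, cmap s = cidem * x * cidem;
  cidem_full : in_ideal (fun x => x = cidem) (1 : R) }.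

Section CornerFunctors.
Variables (K : fieldType) (R S : kalgebra K) (j : full_corner R S).
Local Notation e := (cidem j).

Lemma cmap1 : j 1 = e.
Proof. by rewrite -(rmorph1 (kconst S)) cmapC rmorph1 mul1r. Qed.
Lemma cidemM : e * e = e.
Proof. by rewrite -!cmap1 -cmapM mulr1. Qed.
Lemma cidem_cmap s : e * j s = j s.
Proof. by rewrite -cmap1 -cmapM mul1r. Qed.
Lemma cmap_cidem s : j s * e = j s.
Proof. by rewrite -cmap1 -cmapM mulr1. Qed.

(** Fullness in the form that inverts the unit: the pairs (a, b) with sum of a e b equal to 1 play
    the part of a dual basis. *)
Lemma cidem_full_sum : exists s : seq (R * R), 1 = \sum_(ab <- s) ab.1 * e * ab.2.
Proof.
have : forall x, in_ideal (fun x => x = e) x ->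
    exists s : seq (R * R), x = \sum_(ab <- s) ab.1 * e * ab.2.
  move=> x; elim=> {x} [x ->||x y _ [s1 ->] _ [s2 ->]|a x _ [s ->]|a x _ [s ->]].
  - by exists [:: (1, 1)]; rewrite big_seq1 mul1r mulr1.
  - by exists [::]; rewrite big_nil.
  - exists (s1 ++ [seq (- ab.1, ab.2) | ab <- s2]); rewrite big_cat big_map /=.
    by congr (_ + _); rewrite -sumrN; apply: eq_bigr => ab _; rewrite !mulNr.
  - exists [seq (a * ab.1, ab.2) | ab <- s]; rewrite big_map mulr_sumr.
    by apply: eq_bigr => ab _; rewrite !mulrA.
  - exists [seq (ab.1, ab.2 * a) | ab <- s]; rewrite big_map mulr_suml.
    by apply: eq_bigr => ab _; rewrite !mulrA.
apply; exact: cidem_full.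
Qed.

Definition cinv (x : R) : S := projT1 (cid (cmap_onto j x)).
Lemma cinvE x : j (cinv x) = e * x * e.
Proof. exact: (projT2 (cid (cmap_onto j x))). Qed.

Section Restriction.
Variable M : lmodType R.

Definition corner_pred (_ : full_corner R S) : {pred M} := fun m => e *: m == m.
Fact corner_zmod_closed : zmod_closed (corner_pred j).
Proof.
split=> [|x y /eqP ex /eqP ey]; apply/eqP; first by rewrite scaler0.
by rewrite scalerBr ex ey.
Qed.
HB.instance Definition _ :=
  GRing.isZmodClosed.Build M (corner_pred j) corner_zmod_closed.

Definition corner_type := {m : M | corner_pred j m}.
HB.instance Definition _ := SubChoice.on corner_type.
HB.instance Definition _ :=
  GRing.SubChoice_isSubZmodule.Build M (corner_pred j) corner_type corner_zmod_closed.

Fact corner_scale_subproof s (m : corner_type) : corner_pred j (j s *: val m).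
Proof. by apply/eqP; rewrite scalerA cidem_cmap. Qed.
Definition corner_scale s (m : corner_type) : corner_type :=
  exist (fun m => corner_pred j m) _ (corner_scale_subproof s m).

Fact corner_scaleA a b v : corner_scale a (corner_scale b v) = corner_scale (a * b) v.
Proof. by apply: val_inj; rewrite /= scalerA cmapM. Qed.
Fact corner_scale1 : left_id 1 corner_scale.
Proof. by move=> [m me]; apply: val_inj; rewrite /= cmap1; apply/eqP. Qed.
Fact corner_scaleDr : right_distributive corner_scale +%R.
Proof. by move=> a x y; apply: val_inj; rewrite /= -scalerDr. Qed.
Fact corner_scaleDl v : {morph corner_scale^~ v : a b / a + b}.
Proof. by move=> a b; apply: val_inj; rewrite /= cmapD scalerDl. Qed.
HB.instance Definition _ := GRing.Zmodule_isLmodule.Build S corner_type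
  corner_scaleA corner_scale1 corner_scaleDr corner_scaleDl.

Lemma corner_valZ s (m : corner_type) : val (s *: m) = j s *: val m.
Proof. by []. Qed.
Lemma corner_valD (m m' : corner_type) : val (m + m') = val m + val m'.
Proof. by []. Qed.
Lemma corner_val_sum I (s : seq I) (F : I -> corner_type) :
  val (\sum_(i <- s) F i) = \sum_(i <- s) val (F i).
Proof.
elim: s => [|i s IHs]; first by rewrite !big_nil.
by rewrite !big_cons corner_valD IHs.
Qed.
Lemma corner_valP (m : corner_type) : e *: val m = val m.
Proof. exact/eqP/(valP m). Qed.

Definition to_corner (m : M) : corner_type.
Proof.
exists (e *: m); apply/eqP; by rewrite scalerA cidemM.
Defined.

End Restriction.

Section RestrictionMap.
Variables (M N : lmodType R) (f : {linear M -> N}).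
Definition corner_map (m : corner_type M) : corner_type N := to_corner (f (val m)).
Lemma corner_mapE m : val (corner_map m) = f (val m).
Proof. by rewrite /= -linearZ /= corner_valP. Qed.
Fact corner_map_linear : linear corner_map.
Proof.
move=> s x y; apply: val_inj; rewrite corner_mapE !(corner_valD, corner_valZ).
by rewrite !corner_mapE linearP.
Qed.
HB.instance Definition _ :=
  GRing.isLinear.Build S (corner_type M) (corner_type N) *:%R corner_map corner_map_linear.
End RestrictionMap.

Definition corner_functor : mod_functor R S.
Proof.
exists (fun M => corner_type M : lmodType S) (fun M N f => corner_map f : {linear _ -> _}).
- by move=> M x; apply: val_inj; rewrite corner_mapE.
- by move=> M N P f g x; apply: val_inj; rewrite !corner_mapE.
- move=> M N c f g h hE y; apply: val_inj.
  rewrite corner_valD corner_valZ !corner_mapE hE cmapC.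
  by rewrite -scalerA -[e *: f _]linearZ /= corner_valP.
Defined.

(* The S-module N is sent to Hom_S(e R, N); its elements are extended to R    *)
(* by zero on (1 - e) R.                                                      *)
Section Coinduction.
Variable N : lmodType S.

Record hom_type := HomType {
  hom_fun :> R -> N;
  hom_funD : {morph hom_fun : x y / x + y};
  hom_funZ : forall s x, hom_fun (j s * x) = s *: hom_fun x;
  hom_fune : forall x, hom_fun (e * x) = hom_fun x }.

Lemma hom_ext (f g : hom_type) : f =1 g -> f = g.
Proof.
case: f => f fD fZ fe; case: g => g gD gZ ge /= /funext fg.
case: g / fg in gD gZ ge *.
by congr HomType; apply: Prop_irrelevance.
Qed.

HB.instance Definition _ := gen_eqMixin hom_type.
HB.instance Definition _ := gen_choiceMixin hom_type.

Definition hom_zero : hom_type.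
Proof.
exists (fun=> 0) => [x y|s x|//]; first by rewrite addr0.
by rewrite scaler0.
Defined.
Definition hom_opp (f : hom_type) : hom_type.
Proof.
exists (fun x => - f x) => [x y|s x|x]; last by rewrite hom_fune.
  by rewrite hom_funD opprD.
by rewrite hom_funZ scalerN.
Defined.
Definition hom_add (f g : hom_type) : hom_type.
Proof.
exists (fun x => f x + g x) => [x y|s x|x]; last by rewrite !hom_fune.
  by rewrite !hom_funD addrACA.
by rewrite !hom_funZ scalerDr.
Defined.
Fact hom_addA : associative hom_add.
Proof. by move=> x y z; apply: hom_ext => i; apply: addrA. Qed.
Fact hom_addC : commutative hom_add.
Proof. by move=> x y; apply: hom_ext => i; apply: addrC. Qed.
Fact hom_add0 : left_id hom_zero hom_add.
Proof. by move=> x; apply: hom_ext => i; apply: add0r. Qed.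
Fact hom_addN : left_inverse hom_zero hom_opp hom_add.
Proof. by move=> x; apply: hom_ext => i; apply: addNr. Qed.
HB.instance Definition _ :=
  GRing.isZmodule.Build hom_type hom_addA hom_addC hom_add0 hom_addN.

Definition hom_scale (r : R) (f : hom_type) : hom_type.
Proof.
exists (fun x => f (x * r)) => [x y|s x|x]; first by rewrite mulrDl hom_funD.
  by rewrite -mulrA hom_funZ.
by rewrite -mulrA hom_fune.
Defined.
Fact hom_scaleA a b v : hom_scale a (hom_scale b v) = hom_scale (a * b) v.
Proof. by apply: hom_ext => x /=; rewrite mulrA. Qed.
Fact hom_scale1 : left_id 1 hom_scale.
Proof. by move=> f; apply: hom_ext => x /=; rewrite mulr1. Qed.
Fact hom_scaleDr : right_distributive hom_scale +%R.
Proof. by move=> a x y; apply: hom_ext. Qed.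
Fact hom_scaleDl v : {morph hom_scale^~ v : a b / a + b}.
Proof. by move=> a b; apply: hom_ext => x /=; rewrite mulrDr hom_funD. Qed.
HB.instance Definition _ := GRing.Zmodule_isLmodule.Build R hom_type
  hom_scaleA hom_scale1 hom_scaleDr hom_scaleDl.

Lemma hom_addE (f g : hom_type) x : (f + g) x = f x + g x. Proof. by []. Qed.
Lemma hom_scaleE r (f : hom_type) x : (r *: f) x = f (x * r). Proof. by []. Qed.
Lemma hom_fun0 (f : hom_type) : f 0 = 0.
Proof. by apply: (addIr (f 0)); rewrite -hom_funD !add0r. Qed.
Lemma hom_fun_sum (f : hom_type) I (s : seq I) (F : I -> R) :
  f (\sum_(i <- s) F i) = \sum_(i <- s) f (F i).
Proof.
elim: s => [|i s IHs]; first by rewrite !big_nil hom_fun0.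
by rewrite !big_cons hom_funD IHs.
Qed.
Lemma hom_funC (f : hom_type) c x : f (kconst R c * x) = kconst S c *: f x.
Proof. by rewrite -hom_fune mulrA -kconstC -cmapC hom_funZ. Qed.

End Coinduction.

Section CoinductionMap.
Variables (M N : lmodType S) (f : {linear M -> N}).
Definition hom_map (h : hom_type M) : hom_type N.
Proof.
exists (fun x => f (h x)) => [x y|s x|x]; first by rewrite hom_funD raddfD.
  by rewrite hom_funZ linearZ.
by rewrite hom_fune.
Defined.
Fact hom_map_linear : linear hom_map.
Proof. by move=> s x y; apply: hom_ext => z; rewrite hom_addE /= raddfD. Qed.
HB.instance Definition _ :=
  GRing.isLinear.Build R (hom_type M) (hom_type N) *:%R hom_map hom_map_linear.
End CoinductionMap.

Definition hom_functor : mod_functor S R.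
Proof.
exists (fun M => hom_type M : lmodType R) (fun M N f => hom_map f : {linear _ -> _}).
- by move=> M x; apply: hom_ext.
- by move=> M N P f g x; apply: hom_ext.
- move=> M N c f g h hE y; apply: hom_ext => x.
  by rewrite hom_addE hom_scaleE /= hE -kconstC hom_funC linearZ.
Defined.

Section Unit.
Variable M : lmodType R.
Definition unit_fun (m : M) : hom_type (corner_type M).
Proof.
exists (fun x => to_corner (x *: m)) => [x y|s x|x]; apply: val_inj => /=.
- by rewrite scalerDl scalerDr.
- by rewrite !scalerA !mulrA cidem_cmap cmap_cidem.
- by rewrite !scalerA mulrA cidemM.
Defined.
Fact unit_linear : linear unit_fun.
Proof.
move=> s x y; apply: hom_ext => z; rewrite hom_addE hom_scaleE; apply: val_inj => /=.
by rewrite !scalerDr !scalerA mulrA.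
Qed.
HB.instance Definition _ :=
  GRing.isLinear.Build R M (hom_type (corner_type M)) *:%R unit_fun unit_linear.

Lemma unit_bij : bijective unit_fun.
Proof.
have [s s1] := cidem_full_sum.
(* With 1 = sum of a e b, the map f = (x -> e x m) returns the sum of a e b m, which is m. *)
exists (fun f : hom_type (corner_type M) => \sum_(ab <- s) ab.1 *: val (f ab.2)).
  move=> m /=; rewrite -[RHS]scale1r s1 scaler_suml.
  by apply: eq_bigr => ab _; rewrite !scalerA.
move=> f; apply: hom_ext => x; apply: val_inj.
have -> : f x = \sum_(ab <- s) f (x * (ab.1 * e * ab.2)).
  by rewrite -hom_fun_sum -mulr_sumr -s1 mulr1.
rewrite corner_val_sum /= scalerA scaler_sumr.
apply: eq_bigr => ab _.
(* [e x a e] lies in the corner, so it comes from S and moves inside f by S-linearity. *)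
rewrite -[val (f ab.2)]corner_valP !scalerA -(mulrA e) -cinvE -corner_valZ.
by rewrite -hom_funZ cinvE -!mulrA hom_fune.
Qed.
End Unit.

Section Counit.
Variable N : lmodType S.
Definition counit_fun (f : corner_type (hom_type N)) : N := val f 1.
Lemma counit_e (f : corner_type (hom_type N)) x : val f (x * e) = val f x.
Proof. by rewrite -hom_scaleE corner_valP. Qed.
Fact counit_linear : linear counit_fun.
Proof.
move=> s x y; rewrite /counit_fun corner_valD hom_addE corner_valZ hom_scaleE mul1r.
by rewrite -[j s]mulr1 hom_funZ.
Qed.
HB.instance Definition _ :=
  GRing.isLinear.Build S (corner_type (hom_type N)) N *:%R counit_fun counit_linear.

Lemma cinvD x y : cinv (x + y) = cinv x + cinv y.
Proof. by apply: (@cmap_inj _ _ _ j); rewrite cmapD !cinvE mulrDr mulrDl. Qed.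
Lemma cinvZ s x : cinv (j s * x) = s * cinv x.
Proof.
apply: (@cmap_inj _ _ _ j).
by rewrite cmapM !cinvE !mulrA cidem_cmap cmap_cidem.
Qed.
Lemma cinv_idem x : cinv (e * x) = cinv x.
Proof. by apply: (@cmap_inj _ _ _ j); rewrite !cinvE mulrA cidemM. Qed.

Definition counit_inv_hom (n : N) : hom_type N.
Proof.
exists (fun x => cinv x *: n) => [x y|s x|x].
- by rewrite cinvD scalerDl.
- by rewrite cinvZ scalerA.
- by rewrite cinv_idem.
Defined.

Fact counit_inv_subproof n : corner_pred j (counit_inv_hom n).
Proof.
apply/eqP; apply: hom_ext => x; rewrite hom_scaleE /=; congr (_ *: _).
by apply: (@cmap_inj _ _ _ j); rewrite !cinvE -!mulrA cidemM.
Qed.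
Definition counit_inv n : corner_type (hom_type N) :=
  exist (fun m => corner_pred j m) _ (counit_inv_subproof n).

(** An f fixed by e satisfies f(x) = f(e x e), and e x e comes from S, so f is determined by
    f(1). *)
Lemma counit_bij : bijective counit_fun.
Proof.
exists counit_inv => [f|n].
  apply: val_inj; apply: hom_ext => x.
  rewrite -[LHS]/(cinv x *: (val f : hom_type N) 1) -hom_funZ mulr1.
  by rewrite cinvE -mulrA hom_fune counit_e.
rewrite /counit_fun /=; have -> : cinv 1 = 1; last by rewrite scale1r.
by apply: (@cmap_inj _ _ _ j); rewrite cinvE cmap1 mulr1 cidemM.
Qed.
End Counit.

Lemma morita_full_corner : morita_equivalent R S.
Proof.
exists corner_functor, hom_functor.
exists (fun M => @unit_fun M : {linear _ -> _}).
exists (fun N => @counit_fun N : {linear _ -> _}); split.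
- exact: unit_bij.
- exact: counit_bij.
- move=> M M' f x; apply: hom_ext => z; apply: val_inj.
  transitivity (f (e *: (z *: x))); first by rewrite !linearZ.
  by symmetry; apply: (corner_mapE f (to_corner (z *: x))).
- move=> N N' f y; rewrite /counit_fun.
  by rewrite -[f (val y 1)]/(hom_map f (val y) 1) -corner_mapE.
Qed.

End CornerFunctors.

(** * Affine Hecke relations *)

(** Lets [ncring] decide the identities valid in every ring; the relations at hand are applied
    beforehand by rewriting. *)
#[export] Instance nc_ops (R : pzRingType) :
  @Ncring.Ring_ops R 0 1 +%R *%R (fun x y => x - y) -%R eq := {}.
#[export] Instance nc_ring (R : pzRingType) : Ncring.Ring (Ro := nc_ops R).
Proof.
split; try exact _; try by [].
- exact: add0r.
- exact: addrC.
- exact: addrA.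
- exact: mul1r.
- exact: mulr1.
- exact: mulrA.
- exact: mulrDl.
- by move=> x y z; exact: mulrDr.
- exact: subrr.
Qed.
Ltac ncring := Ncring_tac.non_commutative_ring.

(** In the left-associated product [z * a * b] the factor [a * b] is not a subterm, so each
    rewriting rule is also needed in this form. *)
Lemma mulr_left (R : pzRingType) (a b c : R) : a * b = c -> forall z, z * a * b = z * c.
Proof. by move=> <- z; rewrite mulrA. Qed.

Lemma mulr_left3 (R : pzRingType) (a b c d : R) :
  a * b * c = d -> forall z, z * a * b * c = z * d.
Proof. by move=> <- z; rewrite !mulrA. Qed.

(* (T, X, Y) satisfies the relations of (T_i, X_i, X_{i+1}) in an affine      *)
(* Hecke algebra with parameter h + 1; here h is central.                     *)
Section RankTwo.
Variables (R : pzRingType) (h C' T X Y : R).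
Hypotheses (hc : forall x, x * h = h * x) (C'C : C' * (h + 1) = 1).
Hypotheses (TT : T * T = h * T + h + 1) (TXT : T * X * T = (h + 1) * Y).

Lemma mulC_inj (a b : R) : (h + 1) * a = (h + 1) * b -> a = b.
Proof. by move=> /(congr1 ( *%R C')); rewrite !mulrA C'C !mul1r. Qed.

(** As [h + 1] can be cancelled, Y may be replaced by T X T, and then the quadratic relation applies
    to T T. *)
Lemma bernstein_TY : T * Y = X * T + h * Y.
Proof.
apply: mulC_inj; transitivity (T * ((h + 1) * Y)).
  by rewrite mulrA mulrDl -hc; ncring.
rewrite -TXT !mulrA TT; transitivity (h * (T * X * T) + (h + 1) * (X * T)).
  by ncring.
by rewrite TXT; ncring.
Qed.

Lemma bernstein_TX : T * X = Y * T - h * Y.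
Proof.
apply: mulC_inj; transitivity ((h + 1) * Y * T - h * ((h + 1) * Y)); last by ncring.
rewrite -TXT -(mulrA (T * X)) TT.
transitivity (T * X * h * T + T * X * h + T * X - h * (T * X * T)); last by ncring.
by rewrite (hc (T * X)); ncring.
Qed.

Hypothesis YX : Y * X = X * Y.

Definition intertwiner (t x : R) := t * x - x * t.
Local Notation psi := (intertwiner T X).

(** A rewriting system whose normal forms are combinations of monomials with h first, then X and Y,
    and T last. *)
Definition rank2_nf := (YX, mulr_left YX, TT, mulr_left TT, bernstein_TX,
  mulr_left bernstein_TX, bernstein_TY, mulr_left bernstein_TY,
  hc T, hc X, hc Y, mulr_left (hc T), mulr_left (hc X), mulr_left (hc Y),
  (mulrDl, mulrDr, mulNr, mulrN, mulrA, mulr1, mul1r)).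

Lemma intertwiner_X : psi * X = Y * psi.
Proof. by rewrite /intertwiner !rank2_nf; ncring. Qed.

Lemma intertwiner_Y : psi * Y = X * psi.
Proof. by rewrite /intertwiner !rank2_nf; ncring. Qed.

(** With q = h + 1 this is -q (Y - q X)(Y - q^-1 X). It governs both where the intertwiner is
    invertible and how far the spectrum of Y can be from that of X. *)
Lemma intertwiner_sq : psi * psi = ((h + 1) * X - Y) * ((h + 1) * Y - X).
Proof. by rewrite /intertwiner !rank2_nf; ncring. Qed.

Lemma intertwiner_diff : T * (X - Y) = psi - h * Y.
Proof. by rewrite /intertwiner !rank2_nf; ncring. Qed.

(** With [commT_prod]: T commutes with the elementary symmetric functions of X and Y. This is
    extended to p-th powers in [comm_sym_prod]. *)
Lemma commT_sum : T * (X + Y) = (X + Y) * T.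
Proof. by rewrite !rank2_nf; ncring. Qed.

Lemma commT_prod : T * (X * Y) = X * Y * T.
Proof. by rewrite !rank2_nf; ncring. Qed.
End RankTwo.

Section RankThree.
Variables (R : pzRingType) (h C' T U X Y Z : R).
Hypotheses (hc : forall x, x * h = h * x) (C'C : C' * (h + 1) = 1).
Hypotheses (TT : T * T = h * T + h + 1) (TXT : T * X * T = (h + 1) * Y).
Hypotheses (UU : U * U = h * U + h + 1) (UYU : U * Y * U = (h + 1) * Z).
Hypotheses (YX : Y * X = X * Y) (ZX : Z * X = X * Z) (ZY : Z * Y = Y * Z).
Hypotheses (TZ : T * Z = Z * T) (UX : U * X = X * U).

Let TX := bernstein_TX hc C'C TT TXT.
Let TY := bernstein_TY hc C'C TT TXT.
Let UY := bernstein_TX hc C'C UU UYU.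
Let UZ := bernstein_TY hc C'C UU UYU.

Definition rank3_nf := (TX, mulr_left TX, TY, mulr_left TY, TZ, mulr_left TZ,
  UX, mulr_left UX, UY, mulr_left UY, UZ, mulr_left UZ,
  YX, mulr_left YX, ZX, mulr_left ZX, ZY, mulr_left ZY,
  (TT, mulr_left TT, UU, mulr_left UU),
  (hc T, hc U, hc X, hc Y, hc Z, mulr_left (hc T), mulr_left (hc U),
   mulr_left (hc X), mulr_left (hc Y), mulr_left (hc Z)),
  (mulrDl, mulrDr, mulNr, mulrN, mulrA, mulr1, mul1r)).

Local Notation psi := (intertwiner T X).
Local Notation phi := (intertwiner U Y).

Section Braid.
Hypothesis TUT : T * U * T = U * T * U.

Lemma intertwiner_braid1 : T * (phi * psi) = phi * psi * U.
Proof.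
have UTU := esym TUT.
by rewrite /intertwiner !(rank3_nf, UTU, mulr_left3 UTU); ncring.
Qed.

Lemma intertwiner_braid2 : U * (psi * phi) = psi * phi * T.
Proof.
have UTU := esym TUT.
by rewrite /intertwiner !(rank3_nf, UTU, mulr_left3 UTU); ncring.
Qed.

(** Moving phi psi from left to right turns U into T ([intertwiner_braid1]) and Y into X, hence phi
    = U Y - Y U into psi = T X - X T. This avoids expanding a product of three intertwiners. *)
Lemma intertwiner_braid : psi * phi * psi = phi * psi * phi.
Proof.
have phiY := intertwiner_Y hc C'C UU UYU ZY.
have psiY := intertwiner_Y hc C'C TT TXT YX.
have phiX : phi * X = X * phi by rewrite /intertwiner !rank3_nf; ncring.
have B1 := intertwiner_braid1.
have W : phi * psi * Y = X * (phi * psi).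
  by rewrite -mulrA psiY mulrA phiX mulrA.
have E1 : phi * psi * U * Y = T * X * (phi * psi).
  by rewrite -B1 -(mulrA T) W mulrA.
have E2 : phi * psi * Y * U = X * T * (phi * psi).
  by rewrite W -(mulrA X) -B1 mulrA.
transitivity ((T * X - X * T) * (phi * psi)); first by rewrite mulrA.
transitivity (phi * psi * (U * Y - Y * U)); last by [].
by rewrite (mulrBl (phi * psi)) (mulrBr (phi * psi)) -E1 -E2 !mulrA.
Qed.
End Braid.

(* The defect D of the braid relation satisfies the commutation relations of  *)
(* T_{w_0}, because the lower terms of T U T and of U T U agree.              *)
Let D := T * U * T - U * T * U.

Lemma braid_defect_X : D * X = Z * D.
Proof. by rewrite /D !rank3_nf; ncring. Qed.
Lemma braid_defect_Y : D * Y = Y * D.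
Proof. by rewrite /D !rank3_nf; ncring. Qed.
Lemma braid_defect_Z : D * Z = X * D.
Proof. by rewrite /D !rank3_nf; ncring. Qed.
Lemma braid_defect_T : D * T = (h - U) * D.
Proof. by rewrite /D !rank3_nf; ncring. Qed.
Lemma braid_defect_U : D * U = (h - T) * D.
Proof. by rewrite /D !rank3_nf; ncring. Qed.
End RankThree.

(** * Subalgebras and evaluation of polynomials *)

Section SubalgebraClosure.
Variables (K : fieldType) (A : kalgebra K) (S : A -> Prop).

Lemma subalg1 : in_subalg S 1.
Proof. by rewrite -(rmorph1 (kconst A)); apply: subalg_const. Qed.
Lemma subalg0 : in_subalg S 0.
Proof. by rewrite -(rmorph0 (kconst A)); apply: subalg_const. Qed.
Lemma subalgD x y : in_subalg S x -> in_subalg S y -> in_subalg S (x + y).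
Proof.
move=> Sx Sy; rewrite -[y]opprK -[- y]sub0r.
by apply: subalg_sub => //; apply: subalg_sub => //; apply: subalg0.
Qed.
Lemma subalgX x n : in_subalg S x -> in_subalg S (x ^+ n).
Proof.
move=> Sx; elim: n => [|n IHn]; first exact: subalg1.
by rewrite exprS; apply: subalg_mul.
Qed.
Lemma subalgZ c x : in_subalg S x -> in_subalg S (kscale c x).
Proof. by move=> Sx; apply: subalg_mul => //; apply: subalg_const. Qed.

Lemma subalg_comm y : (forall x, S x -> x * y = y * x) ->
  forall x, in_subalg S x -> x * y = y * x.
Proof.
move=> yS x; elim=> {x} [x /yS //|c|x z _ xy _ zy|x z _ xy _ zy].
- exact: kconstC.
- by rewrite mulrBl mulrBr xy zy.
- by rewrite mulrA -xy -!mulrA zy.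
Qed.

Fact subalg_val_const c :
  (\val : {rmorphism subalg_type S -> A}) (kconst (subalg S) c) = kconst A c.
Proof. by []. Qed.
Definition subalg_val : kalg_hom (subalg S) A :=
  @KalgHom K (subalg S) A (\val : {rmorphism subalg_type S -> A}) subalg_val_const.
End SubalgebraClosure.

Lemma subalg_trans (K : fieldType) (A : kalgebra K) (S S' : A -> Prop) x :
  (forall x, S x -> in_subalg S' x) -> in_subalg S x -> in_subalg S' x.
Proof.
move=> SS'; elim=> {x} [x /SS' //|c|x y _ Sx _ Sy|x y _ Sx _ Sy].
- exact: subalg_const.
- exact: subalg_sub.
- exact: subalg_mul.
Qed.

Lemma subalg_hom (K : fieldType) (A B : kalgebra K) (f : kalg_hom A B)
    (S : A -> Prop) (S' : B -> Prop) x :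
  (forall x, S x -> in_subalg S' (f x)) -> in_subalg S x -> in_subalg S' (f x).
Proof.
move=> SS'; elim=> {x} [x /SS' //|c|x y _ Sx _ Sy|x y _ Sx _ Sy].
- by rewrite kalg_hom_const; apply: subalg_const.
- by rewrite rmorphB; apply: subalg_sub.
- by rewrite rmorphM; apply: subalg_mul.
Qed.

Section PolynomialEvaluation.
Variables (K : fieldType) (A : kalgebra K).
Implicit Types (x y : A) (p : {poly K}).

Fact peval_key : unit. Proof. by []. Qed.
(** Locked so that unification does not unfold the sum. *)
Definition peval x p : A :=
  locked_with peval_key (\sum_(i < size p) kconst A p`_i * x ^+ i).

Lemma peval_widen x p n : (size p <= n)%N ->
  peval x p = \sum_(i < n) kconst A p`_i * x ^+ i.
Proof.
move=> le_pn; rewrite /peval unlock (big_ord_widen n (fun i => kconst A p`_i * x ^+ i)) //.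
rewrite [RHS](bigID (fun i : 'I_n => (i < size p)%N)) /= [X in _ + X]big1 ?addr0 //.
by move=> i; rewrite -leqNgt => /(nth_default 0) ->; rewrite rmorph0 mul0r.
Qed.

Fact peval_zmod x : zmod_morphism (peval x).
Proof.
move=> p p'; pose n := maxn (size p) (size p').
rewrite !(@peval_widen x _ n) ?leq_maxl ?leq_maxr //; last first.
  by rewrite (leq_trans (size_polyD _ _)) // size_polyN.
rewrite -sumrB; apply: eq_bigr => i _.
by rewrite coefB rmorphB mulrBl.
Qed.
HB.instance Definition _ x :=
  GRing.isZmodMorphism.Build {poly K} A (peval x) (peval_zmod x).

Lemma pevalC x c : peval x c%:P = kconst A c.
Proof.
by rewrite (peval_widen x (size_polyC_leq1 c)) big_ord1 coefC mulr1.
Qed.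

Lemma pevalCM x c p : peval x (c%:P * p) = kconst A c * peval x p.
Proof.
rewrite (@peval_widen x (c%:P * p) (size p)) ?mul_polyC ?size_scale_leq //.
rewrite (@peval_widen x p (size p)) // mulr_sumr.
by apply: eq_bigr => i _; rewrite coefZ rmorphM mulrA.
Qed.

Lemma pevalMX x p : peval x (p * 'X) = peval x p * x.
Proof.
rewrite (@peval_widen x _ (size p).+1); last first.
  by rewrite (leq_trans (size_polyMleq _ _)) // size_polyX addn2.
rewrite big_ord_recl coefMX rmorph0 mul0r add0r (@peval_widen x p (size p)) // mulr_suml.
by apply: eq_bigr => i _; rewrite coefMX /= exprSr mulrA.
Qed.

Fact peval_monoid x : monoid_morphism (peval x).
Proof.
split=> [|p p']; first by rewrite -polyC1 pevalC rmorph1.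
elim/poly_ind: p => [|p c IHp]; first by rewrite mul0r raddf0 mul0r.
rewrite mulrDl -mulrA (mulrC 'X) mulrA !raddfD /= !pevalMX pevalCM pevalC IHp.
rewrite mulrDl -!mulrA; congr (_ * _ + _).
elim/poly_ind: p' {IHp} => [|p' d IHp']; first by rewrite raddf0 mul0r mulr0.
by rewrite !raddfD /= pevalMX pevalC mulrDl mulrDr -!mulrA -kconstC !mulrA IHp'.
Qed.
HB.instance Definition _ x :=
  GRing.isMonoidMorphism.Build {poly K} A (peval x) (peval_monoid x).

Lemma pevalX x : peval x 'X = x.
Proof. by rewrite -['X]mul1r pevalMX rmorph1 mul1r. Qed.

Lemma peval_comp x p p' : peval x (p \Po p') = peval (peval x p') p.
Proof.
elim/poly_ind: p => [|p c IHp]; first by rewrite comp_poly0 !raddf0.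
by rewrite comp_polyD comp_polyM comp_polyX comp_polyC !rmorphD !rmorphM /= IHp
  !pevalC pevalX.
Qed.

Lemma peval_intertwine a b y p : y * a = b * y -> y * peval a p = peval b p * y.
Proof.
move=> yab; elim/poly_ind: p => [|p c IHp]; first by rewrite !raddf0 mulr0 mul0r.
rewrite !raddfD /= !pevalMX !pevalC mulrDr mulrDl kconstC.
by rewrite mulrA IHp -!mulrA yab.
Qed.

Lemma peval_comm x y p : y * x = x * y -> y * peval x p = peval x p * y.
Proof. exact: peval_intertwine. Qed.

Lemma peval_subalg S x p : in_subalg S x -> in_subalg S (peval x p).
Proof.
move=> Sx; elim/poly_ind: p => [|p c IHp]; first by rewrite raddf0; apply: subalg0.
rewrite raddfD /= pevalMX pevalC; apply: subalgD; last exact: subalg_const.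
exact: subalg_mul.
Qed.

End PolynomialEvaluation.

Lemma peval_hom (K : fieldType) (A B : kalgebra K) (f : kalg_hom A B) x p :
  f (peval x p) = peval (f x) p.
Proof.
elim/poly_ind: p => [|p c IHp]; first by rewrite !raddf0.
by rewrite !raddfD /= !pevalMX !pevalC rmorphM kalg_hom_const IHp.
Qed.

(** * Jucys-Murphy elements *)

(* Tuples satisfying the relations of H_{ps,m}(X) other than the one of       *)
(* degree ps for T_0; the values T_m, T_{m+1}, ... are irrelevant.            *)
Record hecke_system (K : fieldType) (q : K) (A : kalgebra K) (m : nat)
    (T : nat -> A) : Prop := HeckeSystem {
  hs_quad : forall i, (0 < i < m)%N -> (T i + 1) * (T i - kconst A q) = 0;
  hs_braid4 : (1 < m)%N -> T 0%N * T 1%N * T 0%N * T 1%N = T 1%N * T 0%N * T 1%N * T 0%N;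
  hs_braid3 : forall i, (0 < i)%N -> (i.+1 < m)%N ->
    T i * T i.+1 * T i = T i.+1 * T i * T i.+1;
  hs_comm : forall i j, (i.+1 < j)%N -> (j < m)%N -> T i * T j = T j * T i }.

Section HeckeUniversal.
Variables (K : fieldType) (p : nat) (q : K) (X : seq K).

(** Generators are indexed by natural numbers, with value 0 from m on, so that [T k.+1] can be
    written without a proof of its bound. *)
Definition hT m (k : nat) : hecke p q X m :=
  if insub k is Some i then heckeT p q X i else 0.

Lemma hTE m (i : 'I_m) : hT m i = heckeT p q X i.
Proof. by rewrite /hT valK. Qed.

Section Relations.
Variables (A B : kalgebra K) (f : kalg_hom A B) (m : nat).
Variables (t : 'I_m.+1 -> A) (T : nat -> B) (fE : forall i, f (t i) = T i).

Lemma hecke_system_rel z :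
  hecke_system q m.+1 T -> \prod_(x <- X) (T 0%N ^+ p - kconst B (x ^+ p)) = 0 ->
  hecke_rel p q X t z -> f z = 0.
Proof.
move=> [quad br4 br3 cmm] cyc; case=> [|i i1|i i0|i j i0 ij|i j ij].
- rewrite kalg_hom_prod -[RHS]cyc //; apply: eq_bigr => x _.
  by rewrite kalg_homB kalg_homX fE kalg_hom_const.
- rewrite kalg_homB !kalg_homM !fE i1 br4 ?subrr //.
  by have := ltn_ord i; rewrite i1.
- by rewrite kalg_homM kalg_homB kalg_homD kalg_hom_const kalg_hom1 !fE quad // i0 /=.
- rewrite kalg_homB !kalg_homM !fE ij br3 ?subrr // -?ij //.
- by rewrite kalg_homB !kalg_homM !fE cmm ?subrr.
Qed.

Lemma rel_hecke_system :
  (forall z, hecke_rel p q X t z -> f z = 0) -> hecke_system q m.+1 T.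
Proof.
move=> f0; have TE i (im : (i < m.+1)%N) : T i = f (t (Ordinal im)) by rewrite fE.
split=> [i /andP[i0 im]|im|i i0 im|i j ij jm].
- rewrite (TE _ im) -(kalg_hom_const f) -[1](kalg_hom1 f).
  by rewrite -kalg_homD -kalg_homB -kalg_homM f0 //; apply: hecke_quadratic.
- apply/eqP; rewrite -subr_eq0 (TE _ im) (TE _ (ltn0Sn m)) -!kalg_homM -kalg_homB.
  have -> : Ordinal (ltn0Sn m) = ord0 by apply: val_inj.
  by rewrite f0 //; apply: hecke_braid4.
- apply/eqP; rewrite -subr_eq0 (TE _ im) (TE _ (ltnW im)) -!kalg_homM -kalg_homB.
  by rewrite f0 //; apply: hecke_braid3.
- have im : (i < m.+1)%N by lia.
  apply/eqP; rewrite -subr_eq0 (TE _ im) (TE _ jm) -!kalg_homM -kalg_homB.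
  by rewrite f0 //; apply: hecke_comm.
Qed.
End Relations.

(** The cyclotomic premise is guarded because for m = 0 the algebra is K and has no T_0; the lift is
    then the structure map. *)
Lemma hecke_lift (B : kalgebra K) m (T : nat -> B) :
  hecke_system q m T ->
  ((0 < m)%N -> \prod_(x <- X) (T 0%N ^+ p - kconst B (x ^+ p)) = 0) ->
  exists f : kalg_hom (hecke p q X m) B, forall i, (i < m)%N -> f (hT m i) = T i.
Proof.
case: m => [|m] sT cyc.
  by exists (@KalgHom K (base_kalg K) B (kconst B) (fun c => erefl)).
have gE (i : 'I_m.+1) : free_lift (fun i : 'I_m.+1 => T i) (free_gen K i) = T i.
  exact: free_liftE.
exists (quot_lift (fun z => hecke_system_rel gE sT (cyc isT)) : kalg_hom (hecke p q X m.+1) B).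
by move=> i im; rewrite (hTE (Ordinal im)) quot_liftE gE.
Qed.

Lemma hecke_systemT m : hecke_system q m (hT m).
Proof.
case: m => [|m]; first by split=> //= i; rewrite ltn0 ?andbF.
apply: (@rel_hecke_system _ _ (quot_hom (hecke_rel p q X (@free_gen K 'I_m.+1))) _
  (@free_gen K 'I_m.+1)) => [i|z]; first by rewrite hTE.
exact: quot_hom_rel.
Qed.

Lemma hecke_cyclotomicT m : (0 < m)%N ->
  \prod_(x <- X) (hT m 0%N ^+ p - kconst _ (x ^+ p)) = 0.
Proof.
case: m => // m _; rewrite (hTE (@ord0 m)).
rewrite -[RHS](quot_hom_rel (hecke_cyclotomic p q X (@free_gen K 'I_m.+1))).
rewrite kalg_hom_prod; apply: eq_bigr => x _.
by rewrite kalg_homB kalg_homX kalg_hom_const.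
Qed.

Lemma hecke_generated m (z : hecke p q X m) :
  in_subalg (fun y => exists2 k, (k < m)%N & y = hT m k) z.
Proof.
case: m z => [|m] z; first by rewrite -[z]/(kconst (hecke p q X 0) z); apply: subalg_const.
set S := fun y => _.
have Sgen (i : 'I_m.+1) : subalg_pred S (hT m.+1 i).
  by apply/asboolP/subalg_gen; exists i.
(* The free algebra is mapped into the subalgebra itself. Followed by the inclusion, this is the
   quotient map, whose image is therefore in the subalgebra. *)
pose f := free_lift (fun i : 'I_m.+1 => exist (fun x => subalg_pred S x) _ (Sgen i) : subalg S).
pose rel z := hecke_rel p q X (@free_gen K 'I_m.+1) z.
have vf : kalg_comp (subalg_val S) f =1 quot_hom rel.
  by apply: free_hom_ext => i /=; rewrite free_liftE /= hTE.
elim/quot_projW: z => z; rewrite -[quot_proj _ _]vf /=.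
exact/asboolP/(valP (f z)).
Qed.

End HeckeUniversal.

Section JucysMurphy.
Variables (K : fieldType) (q : K) (A : kalgebra K).

Fixpoint jm (T : nat -> A) (k : nat) : A :=
  if k is k'.+1 then kscale q^-1 (T k * jm T k' * T k) else T 0%N.

Variables (m : nat) (T : nat -> A).
Hypotheses (q0 : q != 0) (sT : hecke_system q m T).
Local Notation L := (jm T).
Local Notation h := (kconst A (q - 1)).

Lemma hecke_hC (x : A) : x * h = h * x. Proof. by rewrite kconstC. Qed.

Lemma hecke_h1 : h + 1 = kconst A q.
Proof. by rewrite rmorphB rmorph1 subrK. Qed.

Lemma hecke_hV : kconst A q^-1 * (h + 1) = 1.
Proof. by rewrite hecke_h1 -rmorphM mulVf ?rmorph1. Qed.

Lemma hecke_sq i : (0 < i < m)%N -> T i * T i = h * T i + h + 1.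
Proof.
move=> im; rewrite -addrA hecke_h1; apply/eqP; rewrite -subr_eq0; apply/eqP.
rewrite -[RHS](hs_quad sT im) rmorphB rmorph1 (mulrBr (T i + 1)) -(kconstC q).
by ncring.
Qed.

Lemma jm_T k : T k.+1 * L k * T k.+1 = (h + 1) * L k.+1.
Proof. by rewrite hecke_h1 /= /kscale mulrA -rmorphM divff // rmorph1 mul1r. Qed.

Lemma jmS k : L k.+1 = kscale q^-1 (T k.+1 * L k * T k.+1). Proof. by []. Qed.

Lemma kscale_comm c (x y : A) : x * y = y * x -> x * kscale c y = kscale c y * x.
Proof. by move=> xy; rewrite kscaleAr kscaleAl xy. Qed.

Lemma comm_conj (x t l : A) : x * t = t * x -> x * l = l * x ->
  x * (t * l * t) = t * l * t * x.
Proof. by move=> xt xl; rewrite !mulrA xt -(mulrA t) xl -!mulrA xt. Qed.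

Lemma hecke_far i j : (i < m)%N -> (j < m)%N -> (i.+1 < j)%N || (j.+1 < i)%N ->
  T i * T j = T j * T i.
Proof. by move=> im jm /orP[] ij; [|symmetry]; apply: (hs_comm sT). Qed.

Lemma jm_comm_gt k i : (k.+1 < i)%N -> (i < m)%N -> T i * L k = L k * T i.
Proof.
move=> ki im; elim: k ki => [|k IHk] ki; first by apply: hecke_far; lia.
rewrite jmS; apply/kscale_comm/comm_conj; last by apply: IHk; lia.
by apply: hecke_far; lia.
Qed.

(** The essential case is i = k - 1. There L_k is T_k T_{k-1} L_{k-2} T_{k-1} T_k up to a scalar,
    and the braid relation, used on both sides of L_{k-2}, moves T_{k-1} across, since T_k commutes
    with L_{k-2}. *)
Lemma jm_comm_lt k i : (0 < i < k)%N -> (k < m)%N -> T i * L k = L k * T i.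
Proof.
elim: k => [|k IHk] /andP[i0 ik] km; first by [].
have [ik'|ki] := ltnP i k.
  rewrite jmS; apply/kscale_comm/comm_conj; last by apply: IHk; lia.
  by apply: hecke_far; lia.
have {ki IHk} {}ik : i = k by lia.
case: k km ik => [|k] km ik; first by rewrite ik in i0.
rewrite {i i0}ik; have br : T k.+1 * T k.+2 * T k.+1 = T k.+2 * T k.+1 * T k.+2.
  by rewrite (hs_braid3 sT).
have cm : T k.+2 * L k = L k * T k.+2 by rewrite jm_comm_gt.
rewrite 2!jmS; apply: kscale_comm; rewrite kscaleAr kscaleAl; apply: kscale_comm.
transitivity (T k.+1 * T k.+2 * T k.+1 * L k * T k.+1 * T k.+2); first by ncring.
rewrite br; transitivity (T k.+2 * T k.+1 * (T k.+2 * L k) * T k.+1 * T k.+2).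
  by ncring.
rewrite cm; transitivity (T k.+2 * T k.+1 * L k * (T k.+2 * T k.+1 * T k.+2)).
  by ncring.
by rewrite -br; ncring.
Qed.

(** For k = 1 this is the relation of length four; for larger k, T_0 commutes with both T_k and
    L_{k-1}. *)
Lemma jm_comm0 k : (k < m)%N -> T 0%N * L k = L k * T 0%N.
Proof.
elim: k => [|[|k] IHk] km //; rewrite jmS; apply: kscale_comm.
  by rewrite !mulrA (hs_braid4 sT).
apply: comm_conj; last by apply: IHk; lia.
by apply: hecke_far; lia.
Qed.

Lemma jm_comm j k : (j < m)%N -> (k < m)%N -> L j * L k = L k * L j.
Proof.
wlog jk : j k / (j <= k)%N.
  by move=> H jm km; have [jk|/ltnW kj] := leqP j k; [|symmetry]; exact: H.
move=> jm km; elim: j jk jm => [|j IHj] jk jm; first by rewrite jm_comm0.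
have [->//|jk'] := eqVneq j.+1 k.
have TL : T j.+1 * L k = L k * T j.+1 by apply: jm_comm_lt => //; lia.
rewrite jmS; symmetry; apply/kscale_comm/comm_conj; first by rewrite TL.
by rewrite IHj //; lia.
Qed.

(** Places are counted from 0: [psi i] exchanges [L i] and [L i.+1], and therefore involves
    [T i.+1]. *)
Definition psi i := intertwiner (T i.+1) (L i).

Section Pair.
Variables (i : nat) (im : (i.+1 < m)%N).

Lemma jm_comm_pair : L i.+1 * L i = L i * L i.+1.
Proof. by rewrite jm_comm // ltnW. Qed.

Let im' : (0 < i.+1 < m)%N. Proof. by []. Qed.

Lemma T_jm : T i.+1 * L i = L i.+1 * T i.+1 - h * L i.+1.
Proof. exact: bernstein_TX hecke_hC hecke_hV (hecke_sq im') (jm_T i). Qed.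
Lemma psi_L : psi i * L i = L i.+1 * psi i.
Proof. exact: intertwiner_X hecke_hC hecke_hV (hecke_sq im') (jm_T i) jm_comm_pair. Qed.
Lemma psi_LS : psi i * L i.+1 = L i * psi i.
Proof. exact: intertwiner_Y hecke_hC hecke_hV (hecke_sq im') (jm_T i) jm_comm_pair. Qed.
Lemma psi_sq : psi i * psi i = ((h + 1) * L i - L i.+1) * ((h + 1) * L i.+1 - L i).
Proof. exact: intertwiner_sq hecke_hC hecke_hV (hecke_sq im') (jm_T i) jm_comm_pair. Qed.
Lemma psi_diff : T i.+1 * (L i - L i.+1) = psi i - h * L i.+1.
Proof. exact: intertwiner_diff hecke_hC hecke_hV (hecke_sq im') (jm_T i). Qed.
Lemma T_jm_sum : T i.+1 * (L i + L i.+1) = (L i + L i.+1) * T i.+1.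
Proof. exact: commT_sum hecke_hC hecke_hV (hecke_sq im') (jm_T i). Qed.
Lemma T_jm_prod : T i.+1 * (L i * L i.+1) = L i * L i.+1 * T i.+1.
Proof. exact: commT_prod hecke_hC hecke_hV (hecke_sq im') (jm_T i) jm_comm_pair. Qed.
End Pair.

Lemma T_comm_jm i k : (i.+1 < m)%N -> (k < m)%N -> k != i -> k != i.+1 ->
  T i.+1 * L k = L k * T i.+1.
Proof.
move=> im km ki kiS; have [ik|ik] := ltnP i k; first by apply: jm_comm_lt => //; lia.
by apply: jm_comm_gt => //; lia.
Qed.

Lemma intertwiner_comm (x t l : A) : x * t = t * x -> x * l = l * x ->
  x * intertwiner t l = intertwiner t l * x.
Proof.
move=> xt xl; rewrite /intertwiner (mulrBr x) mulrBl !mulrA xt xl -!mulrA.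
by rewrite xt xl.
Qed.

Lemma psi_comm_jm i k : (i.+1 < m)%N -> (k < m)%N -> k != i -> k != i.+1 ->
  psi i * L k = L k * psi i.
Proof.
move=> im km ki kiS; symmetry; apply: intertwiner_comm; first by rewrite T_comm_jm.
by rewrite jm_comm // ltnW.
Qed.

Lemma psi_comm_T i j : (i.+1 < m)%N -> (j.+1 < m)%N -> (i.+1 < j)%N || (j.+1 < i)%N ->
  psi i * T j.+1 = T j.+1 * psi i.
Proof.
move=> im jm ij; symmetry; apply: intertwiner_comm; last by apply: T_comm_jm => //; lia.
by apply: hecke_far; lia.
Qed.

Lemma psi_comm i j : (i.+1 < m)%N -> (j.+1 < m)%N -> (i.+1 < j)%N || (j.+1 < i)%N ->
  psi i * psi j = psi j * psi i.
Proof.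
move=> im jm ij; apply: intertwiner_comm; first exact: psi_comm_T.
by apply: psi_comm_jm => //; lia.
Qed.

Section Triple.
Variables (i : nat) (im : (i.+2 < m)%N).
Let im1 : (0 < i.+1 < m)%N. Proof. exact: ltnW. Qed.
Let im2 : (0 < i.+2 < m)%N. Proof. by []. Qed.
Let L02 : L i.+2 * L i = L i * L i.+2.
Proof. by apply: jm_comm; lia. Qed.
Let T1L2 : T i.+1 * L i.+2 = L i.+2 * T i.+1.
Proof. by apply: T_comm_jm; lia. Qed.
Let T2L0 : T i.+2 * L i = L i * T i.+2.
Proof. by apply: T_comm_jm; lia. Qed.
Let TTT : T i.+1 * T i.+2 * T i.+1 = T i.+2 * T i.+1 * T i.+2.
Proof. exact: (hs_braid3 sT). Qed.

Lemma psi_braid1 : T i.+1 * (psi i.+1 * psi i) = psi i.+1 * psi i * T i.+2.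
Proof.
exact: intertwiner_braid1 hecke_hC hecke_hV (hecke_sq im1) (jm_T i)
  (hecke_sq im2) (jm_T i.+1) (jm_comm_pair (ltnW im)) L02 (jm_comm_pair im) T1L2 T2L0 TTT.
Qed.
Lemma psi_braid2 : T i.+2 * (psi i * psi i.+1) = psi i * psi i.+1 * T i.+1.
Proof.
exact: intertwiner_braid2 hecke_hC hecke_hV (hecke_sq im1) (jm_T i)
  (hecke_sq im2) (jm_T i.+1) (jm_comm_pair (ltnW im)) L02 (jm_comm_pair im) T1L2 T2L0 TTT.
Qed.
Lemma psi_braid : psi i * psi i.+1 * psi i = psi i.+1 * psi i * psi i.+1.
Proof.
exact: intertwiner_braid hecke_hC hecke_hV (hecke_sq im1) (jm_T i)
  (hecke_sq im2) (jm_T i.+1) (jm_comm_pair (ltnW im)) L02 (jm_comm_pair im) T1L2 T2L0 TTT.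
Qed.
End Triple.

End JucysMurphy.

(** * Spectra of the Jucys-Murphy elements *)

Section Spread.
Variable K : fieldType.
Implicit Types (c : K) (P Q : {poly K}).

(* If the roots of P contain the spectrum of X_i^p, those of spread (q^p) P   *)
(* contain that of X_{i+1}^p.                                                 *)
Definition spread c P := P * (P \Po (c *: 'X)) * (P \Po (c^-1 *: 'X)).

Lemma spreadM c P Q : spread c (P * Q) = spread c P * spread c Q.
Proof. by rewrite /spread !comp_polyM [X in X * _ = _]mulrACA [LHS]mulrACA. Qed.

Lemma spread1 c : spread c 1 = 1.
Proof. by rewrite /spread -polyC1 !comp_polyC polyC1 !mulr1. Qed.

Lemma iter_spread_prod c n I (r : seq I) (F : I -> {poly K}) :
  iter n (spread c) (\prod_(i <- r) F i) = \prod_(i <- r) iter n (spread c) (F i).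
Proof.
elim: n => //= n ->; elim: r => [|i r IHr]; first by rewrite !big_nil spread1.
by rewrite !big_cons spreadM IHr.
Qed.

Lemma root_spread c P z : c != 0 -> root (spread c P) z ->
  exists i : int, root P (c ^ i * z).
Proof.
move=> c0; rewrite !rootM !root_comp !hornerE => /orP[/orP[]|] Pz.
- by exists 0; rewrite expr0z mul1r.
- by exists 1; rewrite expr1z.
- by exists (-1).
Qed.

Lemma root_iter_spread c P n z : c != 0 -> root (iter n (spread c) P) z ->
  exists i : int, root P (c ^ i * z).
Proof.
move=> c0; elim: n z => [|n IHn] z /=; first by exists 0; rewrite expr0z mul1r.
case/(root_spread c0) => i /IHn[j]; rewrite mulrA -expfzDr //.
by exists (j + i).
Qed.

Lemma iter_spread_dvd c P m n : (m <= n)%N ->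
  exists R, iter n (spread c) P = R * iter m (spread c) P.
Proof.
move=> /subnK <-; elim: (n - m)%N => [|k [R IH]]; first by exists 1; rewrite mul1r.
set B := iter m _ _ in IH *; rewrite addSn iterS /spread.
set U := iter (k + m) _ _ \Po _; set V := iter (k + m) _ _ \Po _.
by exists (R * U * V); rewrite IH -!mulrA [B * _]mulrC -mulrA.
Qed.

End Spread.

Section EvaluationLemmas.
Variables (K : fieldType) (A : kalgebra K).
Implicit Types (a b e x y z : A) (P Q : {poly K}).

Lemma peval_scale x c P : peval x (P \Po (c *: 'X)) = peval (kconst A c * x) P.
Proof. by rewrite peval_comp -mul_polyC pevalCM pevalX. Qed.

(** Here z acts as a row vector on which a and b agree. *)
Lemma eq_peval_mull z a b P : a * b = b * a -> z * a = z * b ->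
  z * peval a P = z * peval b P.
Proof.
move=> ab zab; elim/poly_ind: P => [|P c IHP]; first by rewrite !raddf0.
rewrite !raddfD /= !pevalMX !pevalC !mulrDr; congr (_ + _).
by rewrite mulrA IHP -mulrA -(peval_comm _ ab) mulrA zab -mulrA peval_comm.
Qed.

Definition pairS x y : A -> Prop := fun z => z = x \/ z = y.

(** The cofactor is kept in the algebra generated by a and b, so that it commutes with whatever
    commutes with both. *)
Lemma peval_diff a b P : a * b = b * a ->
  exists2 h, in_subalg (pairS a b) h & peval a P - peval b P = h * (a - b).
Proof.
move=> ab; have aS : in_subalg (pairS a b) a by apply: subalg_gen; left.
have bS : in_subalg (pairS a b) b by apply: subalg_gen; right.
elim/poly_ind: P => [|P c [h hS IHP]].
  by exists 0; [apply: subalg0 | rewrite !rmorph0 subr0 mul0r].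
exists (h * a + peval b P).
  by apply: subalgD; [apply: subalg_mul | apply: peval_subalg].
rewrite !rmorphD /= !pevalMX !pevalC opprD addrACA subrr addr0.
transitivity ((peval a P - peval b P) * a + peval b P * (a - b)).
  by rewrite mulrBl mulrBr addrA subrK.
rewrite IHP mulrDl -!mulrA; congr (_ * _ + _).
by rewrite mulrBl mulrBr ab.
Qed.

End EvaluationLemmas.

Section Separation.
Variables (K : closedFieldType) (A : kalgebra K).
Implicit Types (x y e : A) (P Q : {poly K}).

Lemma bezout P Q : (forall z, root P z -> ~ root Q z) ->
  exists u v, u * P + v * Q = 1.
Proof.
move=> PQ; have : coprimep P Q.
  by apply: Pdiv.ClosedField.root_coprimep => z /PQ /negP.
case/Bezout_coprimepP => -[u v] /=; rewrite eqp_sym.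
case/eqpP => -[c d] /= /andP[c0 d0].
rewrite alg_polyC => E; exists ((d / c) *: u), ((d / c) *: v).
rewrite -!scalerAl -scalerDr; apply: (scalerI c0).
by rewrite scalerA mulrCA divff // mulr1 -E alg_polyC.
Qed.

(** From u P + v Q = 1 and P(x) e = 0 it follows that v(x) inverts Q(x) on e. *)
Lemma peval_unit_on x e P Q : (forall z, root P z -> ~ root Q z) ->
  peval x P * e = 0 -> exists u, peval x u * peval x Q * e = e.
Proof.
move=> /bezout[u [v uv]] Pe; exists v.
rewrite -[RHS]mul1r -(rmorph1 (peval x)) -uv raddfD /= !rmorphM /=.
by rewrite mulrDl -[X in _ = X + _]mulrA Pe mulr0 add0r.
Qed.

(** Put y' = y / lam. On e, P(x^p) vanishes, while P(y'^p) is invertible because lam^-p times a root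
    of Q is never a root of P. So P(y'^p) - P(x^p) is invertible on e; it is a multiple of y'^p -
    x^p, hence of y' - x. *)
Lemma sub_unit_on p x y e lam P Q : lam != 0 -> x * y = y * x ->
  (forall z, root P z -> ~ root Q (lam ^+ p * z)) ->
  peval (x ^+ p) P * e = 0 -> peval (y ^+ p) Q * e = 0 ->
  exists2 h, in_subalg (pairS x y) h & h * (y - kconst A lam * x) * e = e.
Proof.
move=> lam0 xy PQ Px Qy; have lamp0 : lam ^+ p != 0 by rewrite expf_neq0.
have xS : in_subalg (pairS x y) x by apply: subalg_gen; left.
have yS : in_subalg (pairS x y) y by apply: subalg_gen; right.
pose l := kconst A lam^-1; have lc z : l * z = z * l by rewrite kconstC.
pose y' := l * y.
have y'S : in_subalg (pairS x y) y' by apply: subalg_mul => //; apply: subalg_const.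
pose P' := P \Po ((lam ^- p) *: 'X).
have [|u uE] := @peval_unit_on (y ^+ p) e Q P' _ Qy.
  move=> z; rewrite root_comp !hornerE => Qz /PQ; case.
  by rewrite mulrA divff // mul1r.
have y'p : kconst A (lam ^- p) * y ^+ p = y' ^+ p.
  by rewrite exprMn_comm ?/l -?rmorphXn ?exprVn.
have y'x : y' * x = x * y' by rewrite /y' -mulrA -xy !mulrA lc.
have y'xp : y' ^+ p * x ^+ p = x ^+ p * y' ^+ p.
  by apply: commrX; apply/commr_sym/commrX/commr_sym.
have [h1 h1S h1E] := peval_diff P y'xp.
have [h2 h2S h2E] := peval_diff 'X^p y'x.
have powS z : in_subalg (pairS (y' ^+ p) (x ^+ p)) z -> in_subalg (pairS x y) z.
  by apply: subalg_trans => _ [] ->; apply: subalgX.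
have S' z : in_subalg (pairS y' x) z -> in_subalg (pairS x y) z.
  by apply: subalg_trans => _ [] ->.
exists (peval (y ^+ p) u * h1 * h2 * l).
  apply: subalg_mul; last exact: subalg_const.
  by do 2?apply: subalg_mul; [apply/peval_subalg/subalgX|apply: powS|apply: S'].
have -> : peval (y ^+ p) u * h1 * h2 * l * (y - kconst A lam * x) =
    peval (y ^+ p) u * (h1 * (h2 * (y' - x))).
  rewrite -!mulrA; do 3!congr (_ * _); rewrite mulrBr mulrA -rmorphM mulVf //.
  by rewrite rmorph1 mul1r.
rewrite -h2E !rmorphXn /= !pevalX -h1E mulrBr mulrBl -[X in _ - X]mulrA Px mulr0 subr0.
by rewrite -[RHS]uE peval_scale y'p.
Qed.

End Separation.

Section JucysMurphySpectrum.
Variables (K : closedFieldType) (q : K) (A : kalgebra K) (m : nat) (T : nat -> A).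
Hypotheses (q0 : q != 0) (sT : hecke_system q m T).
Variable p : nat.
Local Notation L := (jm q T).

Lemma jm_spectrum_step P i : (i.+1 < m)%N -> peval (L i ^+ p) P = 0 ->
  peval (L i.+1 ^+ p) (spread (q ^+ p) P) = 0.
Proof.
move=> im PX; set X := L i in PX *; set Y := L i.+1.
have XY : X * Y = Y * X by rewrite (jm_comm q0 sT) // ltnW.
pose C := kconst A q; have Cc z : C * z = z * C by rewrite kconstC.
have h1 : kconst A (q - 1) + 1 = C := hecke_h1 _ _.
have PYpsi : peval (Y ^+ p) P * psi q T i = 0.
  have := @peval_intertwine _ _ (X ^+ p) (Y ^+ p) (psi q T i) P.
  rewrite PX mulr0 => <- //.
  elim: (p) => [|k IHk]; first by rewrite !expr0 mulr1 mul1r.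
  by rewrite !exprS mulrA (psi_L q0 sT im) -mulrA IHk mulrA.
have powE (z a b : A) : a * b = b * a -> z * a = z * b -> z * a ^+ p = z * b ^+ p.
  move=> ab zab; have := eq_peval_mull 'X^p ab zab.
  by rewrite !rmorphXn /= !pevalX.
have killL (z a b : A) : a * b = b * a -> z * a = z * b ->
    z * peval (a ^+ p) P = z * peval (b ^+ p) P.
  move=> ab zab; apply: eq_peval_mull; last exact: powE.
  by apply: commrX; apply/commr_sym/commrX/commr_sym.
pose R1 := peval (Y ^+ p) P.
have R1E : R1 * (C * X - Y) * (C * Y - X) = 0.
  by rewrite -!h1 -mulrA -(psi_sq q0 sT im) mulrA PYpsi mul0r.
have commCY : C * Y * X = X * (C * Y) by rewrite -mulrA -XY !mulrA Cc.
have E2 : R1 * (C * X - Y) * peval ((C * Y) ^+ p) P = 0.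
  rewrite (@killL _ (C * Y) X) ?PX ?mulr0 //.
  by apply/eqP; rewrite -subr_eq0 -mulrBr R1E.
have CYp (c : K) : (kconst A c * Y) ^+ p = kconst A (c ^+ p) * Y ^+ p.
  by rewrite exprMn_comm ?rmorphXn //; apply: kconstC.
pose R2 := R1 * peval ((C * Y) ^+ p) P.
have R2E : R2 * (C * X - Y) = 0.
  rewrite -[RHS]E2 /R2 -!mulrA; congr (_ * _); symmetry; apply: peval_comm.
  have comm : (C * X - Y) * (C * Y) = C * Y * (C * X - Y).
    apply: commrM; first exact/esym/Cc.
    apply/commr_sym/commrB; last exact: commr_refl.
    by apply: commrM; [exact/esym/Cc | exact/esym].
  by apply: commrX.
pose D := kconst A q^-1; have Dc z : D * z = z * D by rewrite kconstC.
have E3 : R2 * peval ((D * Y) ^+ p) P = 0.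
  rewrite (@killL _ (D * Y) X) ?PX ?mulr0 //.
    by rewrite -mulrA -XY !mulrA kconstC.
  move/eqP: R2E; rewrite mulrBr subr_eq0 => /eqP E.
  rewrite mulrA -Dc -mulrA -E (mulrA R2) -Cc -mulrA mulrA -rmorphM mulVf //.
  by rewrite rmorph1 mul1r.
by rewrite /spread !rmorphM /= !peval_scale -exprVn -!CYp.
Qed.

(** One polynomial serves all i <= n, because an iterated [spread] is a multiple of the earlier
    ones. *)
Lemma jm_spectrum P n i : (0 < m)%N -> peval (T 0%N ^+ p) P = 0 -> (i < m)%N -> (i <= n)%N ->
  peval (L i ^+ p) (iter n (spread (q ^+ p)) P) = 0.
Proof.
move=> m0 P0 im /(@iter_spread_dvd _ (q ^+ p) P)[R ->].
rewrite rmorphM /=; suff -> : peval (L i ^+ p) (iter i (spread (q ^+ p)) P) = 0 by rewrite mulr0.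
elim: i im => // i IHi im; rewrite iterS; apply: jm_spectrum_step => //.
by rewrite IHi // ltnW.
Qed.

End JucysMurphySpectrum.

(** * Words and their idempotents *)

Section Words.
Variables (n kappa : nat).

(** The length is n + 1 so that [inord] makes [letter] total on natural numbers; an index out of
    range reads the letter at 0. *)
Definition word := {ffun 'I_n.+1 -> 'I_kappa}.
Implicit Type a : word.

Definition letter a (i : nat) : 'I_kappa := a (inord i).

Definition swn (i k : nat) : nat :=
  if k == i then i.+1 else if k == i.+1 then i else k.

Definition sw (i : nat) a : word := [ffun k : 'I_n.+1 => letter a (swn i k)].

Lemma letter_ord a (i : 'I_n.+1) : letter a i = a i.
Proof. by rewrite /letter inord_val. Qed.

Lemma word_ext a b : (forall k, (k < n.+1)%N -> letter a k = letter b k) -> a = b.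
Proof. by move=> ab; apply/ffunP => k; rewrite -!letter_ord ab. Qed.

Lemma word_neq a b : a != b -> exists2 k, (k < n.+1)%N & letter a k != letter b k.
Proof.
move=> ab; suff /existsP[k kP] : [exists k : 'I_n.+1, letter a k != letter b k] by exists k.
rewrite -negb_forall; apply: contra ab => /forallP E; apply/eqP/word_ext => k kn.
exact/eqP/(E (Ordinal kn)).
Qed.

Lemma letter_sw i a k : (k < n.+1)%N -> letter (sw i a) k = letter a (swn i k).
Proof. by move=> kn; rewrite /letter ffunE inordK. Qed.

Lemma swn_lt i k : (i.+1 < n.+1)%N -> (k < n.+1)%N -> (swn i k < n.+1)%N.
Proof. by rewrite /swn; case: eqP => //; case: eqP => //; lia. Qed.

Lemma swnK i : involutive (swn i).
Proof. by rewrite /swn => k; do !case: eqP => //; lia. Qed.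

Lemma swn_l i : swn i i = i.+1. Proof. by rewrite /swn eqxx. Qed.
Lemma swn_r i : swn i i.+1 = i. Proof. by rewrite /swn eqxx gtn_eqF. Qed.
Lemma swn_out i k : k != i -> k != i.+1 -> swn i k = k.
Proof. by rewrite /swn => /negPf-> /negPf->. Qed.

Lemma letter_sw_l i a : (i.+1 < n.+1)%N -> letter (sw i a) i = letter a i.+1.
Proof. by move=> im; rewrite letter_sw ?swn_l //; lia. Qed.
Lemma letter_sw_r i a : (i.+1 < n.+1)%N -> letter (sw i a) i.+1 = letter a i.
Proof. by move=> im; rewrite letter_sw ?swn_r //; lia. Qed.
Lemma letter_sw_out i a k : (k < n.+1)%N -> k != i -> k != i.+1 ->
  letter (sw i a) k = letter a k.
Proof. by move=> kn ki ki1; rewrite letter_sw // swn_out. Qed.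

Lemma swK i a : (i.+1 < n.+1)%N -> sw i (sw i a) = a.
Proof.
by move=> im; apply: word_ext => k kn; rewrite !letter_sw ?swn_lt // swnK.
Qed.

Lemma sw_comm i j a : (i.+1 < n.+1)%N -> (j.+1 < n.+1)%N ->
  (i.+1 < j)%N || (j.+1 < i)%N -> sw i (sw j a) = sw j (sw i a).
Proof.
move=> im jm ij; apply: word_ext => k kn; rewrite !letter_sw ?swn_lt //.
by congr letter; rewrite /swn; do !case: eqP => //; lia.
Qed.

Lemma sw_braid i a : (i.+2 < n.+1)%N ->
  sw i (sw i.+1 (sw i a)) = sw i.+1 (sw i (sw i.+1 a)).
Proof.
move=> im; apply: word_ext => k kn; rewrite !letter_sw ?swn_lt //; try lia.
by congr letter; rewrite /swn; do !case: eqP => //; lia.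
Qed.

Lemma sw_id i a : (i.+1 < n.+1)%N -> letter a i = letter a i.+1 -> sw i a = a.
Proof.
move=> im ai; apply: word_ext => k kn; rewrite letter_sw // /swn.
by case: eqP => [->|_] //; case: eqP => [->|].
Qed.

End Words.

(* The E c are the idempotents of K[X]/(prod_c P c) given by the Chinese        *)
(* remainder theorem.                                                         *)
Definition primary_family (K : fieldType) (kappa : nat) (P E : 'I_kappa -> {poly K}) :=
  forall (A : kalgebra K) (x : A), peval x (\prod_c P c) = 0 ->
  [/\ forall c, peval x (P c) * peval x (E c) = 0,
      forall c d, c != d -> peval x (E c) * peval x (E d) = 0
    & \sum_c peval x (E c) = 1].

Section PrimaryIdempotents.
Variables (K : closedFieldType) (kappa : nat) (P : 'I_kappa -> {poly K}).
Hypothesis P_sep : forall a b z, a != b -> root (P a) z -> ~ root (P b) z.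

Lemma primary_polys : exists E, primary_family P E.
Proof.
pose F c := \prod_(d | d != c) P d.
have uvE c : exists uv : {poly K} * {poly K}, uv.1 * P c + uv.2 * F c = 1.
  have [|u [v uv]] := @bezout _ (P c) (F c); last by exists (u, v).
  move=> z Pz; rewrite /F; elim/big_ind: _ => [|Q Q' HQ HQ'|d dc].
  - exact/negP/root1.
  - by rewrite rootM => /orP[].
  - by apply: P_sep Pz; rewrite eq_sym.
pose uv c := projT1 (cid (uvE c)).
have uvE' c : (uv c).1 * P c + (uv c).2 * F c = 1 := projT2 (cid (uvE c)).
have PF c : P c * F c = \prod_c P c by rewrite [RHS](bigD1 c).
pose E c := (uv c).2 * F c; exists E => A x x0.
have x0l Q : peval x (Q * \prod_c P c) = 0 by rewrite rmorphM /= x0 mulr0.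
have PE c : peval x (P c) * peval x (E c) = 0.
  by rewrite -rmorphM /= /E mulrCA PF x0l.
have EE c d : c != d -> peval x (E c) * peval x (E d) = 0.
  move=> cd; rewrite -rmorphM /= /E mulrACA {2}/F (bigD1 c) //= (mulrA (F c)).
  by rewrite (mulrC (F c)) PF (mulrC (\prod_c _)) mulrA x0l.
(* The defect z is fixed by each (u P_c)(x), because E_c(x) z = 0. So it is fixed by their product,
   which contains the product of all P_c and vanishes at x. *)
split=> //; pose z := 1 - \sum_c peval x (E c).
have zE c : z = peval x ((uv c).1 * P c) * z.
  have Ez : peval x (E c) * z = 0.
    have ES : peval x (E c) * (\sum_d peval x (E d)) = peval x (E c) * peval x (E c).
      rewrite mulr_sumr (bigD1 c) //= [X in _ + X]big1 ?addr0 // => d dc.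
      by apply: EE; rewrite eq_sym.
    rewrite /z mulrBr ES mulr1.
    rewrite -[X in X - _]mulr1 -mulrBr -(rmorph1 (peval x)) -rmorphB /=.
    have -> : 1 - E c = P c * (uv c).1 by rewrite -(uvE' c) addrK mulrC.
    rewrite (rmorphM (peval x) (P c)) /= mulrA -(rmorphM (peval x) (E c)) /=.
    by rewrite (mulrC (E c)) (rmorphM (peval x) (P c)) /= PE mul0r.
  rewrite -{1}[z]mul1r -(rmorph1 (peval x)) -(uvE' c) rmorphD /= mulrDl.
  by rewrite -/(E c) Ez addr0.
have : z = peval x (\prod_c ((uv c).1 * P c)) * z.
  elim/big_rec: _ => [|c Q _ zQ]; first by rewrite rmorph1 mul1r.
  by rewrite rmorphM /= -mulrA -zQ -zE.
rewrite big_split /= x0l mul0r => /eqP; rewrite subr_eq0 => /eqP <-.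
by [].
Qed.

End PrimaryIdempotents.

Section CommutingProducts.
Variables (R : pzRingType) (I : eqType) (F : I -> R) (a : R).

Lemma absorb_prod (r : seq I) i : (forall j, a * F j = F j * a) -> i \in r ->
  a * F i = F i -> a * \prod_(j <- r) F j = \prod_(j <- r) F j.
Proof.
move=> aF ir aFi; elim: r ir => // j r IHr; rewrite inE big_cons => /orP[/eqP <-|ir].
  by rewrite mulrA aFi.
by rewrite mulrA aF -mulrA IHr.
Qed.

Lemma kill_prod (r : seq I) i : (forall j, a * F j = F j * a) -> i \in r ->
  a * F i = 0 -> a * \prod_(j <- r) F j = 0.
Proof.
move=> aF ir aFi; elim: r ir => // j r IHr; rewrite inE big_cons => /orP[/eqP <-|ir].
  by rewrite mulrA aFi mul0r.
by rewrite mulrA aF -mulrA IHr // mulr0.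
Qed.

Lemma comm_prod (r : seq I) : (forall j, a * F j = F j * a) ->
  a * \prod_(j <- r) F j = \prod_(j <- r) F j * a.
Proof.
move=> aF; elim: r => [|j r IHr]; first by rewrite big_nil mulr1 mul1r.
by rewrite big_cons mulrA aF -!mulrA IHr.
Qed.
End CommutingProducts.

(** Stronger than pairwise coprimality: with c = q^p it also excludes roots that differ by a power
    of q^p, which is what makes L_{i+1} - q^j L_i invertible between different letters. *)
Definition separated (K : fieldType) (c : K) (I : Type) (P : I -> {poly K}) :=
  forall a b z (i : int), a <> b -> root (P a) z -> ~ root (P b) (c ^ i * z).

Lemma separated_neq (K : fieldType) (c : K) (I : eqType) (P : I -> {poly K}) :
  separated c P -> forall a b z, a != b -> root (P a) z -> ~ root (P b) z.
Proof. by move=> sep a b z /eqP ab /(sep _ _ _ 0 ab); rewrite expr0z mul1r. Qed.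

Section SymmetricProducts.
Variables (K : closedFieldType) (A : kalgebra K) (t x y : A) (p : nat).
Hypotheses (xy : x * y = y * x) (ts : t * (x + y) = (x + y) * t)
  (tp : t * (x * y) = x * y * t).

(** Newton's recursion s_{k+2} = (x + y) s_{k+1} - x y s_k, hence an induction on two consecutive
    values. *)
Lemma comm_power_sum k : t * (x ^+ k + y ^+ k) = (x ^+ k + y ^+ k) * t.
Proof.
suff [] : t * (x ^+ k + y ^+ k) = (x ^+ k + y ^+ k) * t /\
  t * (x ^+ k.+1 + y ^+ k.+1) = (x ^+ k.+1 + y ^+ k.+1) * t by [].
elim: k => [|k [IH1 IH2]]; first by split=> //; rewrite mulrDl mulrDr mulr1 mul1r.
split=> //.
have -> : x ^+ k.+2 + y ^+ k.+2 =
    (x + y) * (x ^+ k.+1 + y ^+ k.+1) - x * y * (x ^+ k + y ^+ k).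
  rewrite !exprS; set u := x ^+ k; set v := y ^+ k.
  transitivity (x * (x * u) + y * (y * v) + (y * x - x * y) * u); last by ncring.
  by rewrite xy subrr mul0r addr0.
set u := _ ^+ k + _ in IH1 *; set v := _ ^+ k.+1 + _ in IH2 *.
transitivity (t * (x + y) * v - t * (x * y) * u); first by ncring.
rewrite ts tp; transitivity ((x + y) * (t * v) - x * y * (t * u)); first by ncring.
by rewrite IH1 IH2; ncring.
Qed.

(** Q splits over K, and for each root z the product (x^p - z)(y^p - z) is a polynomial in (x y)^p
    and x^p + y^p. *)
Lemma comm_sym_prod Q :
  t * (peval (x ^+ p) Q * peval (y ^+ p) Q) = peval (x ^+ p) Q * peval (y ^+ p) Q * t.
Proof.
have xyp : x ^+ p * y ^+ p = y ^+ p * x ^+ p.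
  by apply: commrX; apply/commr_sym/commrX/commr_sym.
have xQ Q1 Q2 : peval (x ^+ p) Q1 * peval (y ^+ p) Q2 =
    peval (y ^+ p) Q2 * peval (x ^+ p) Q1.
  by apply: peval_comm; symmetry; apply: peval_comm.
have [r ->] := closed_field_poly_normal Q.
rewrite -mul_polyC !rmorphM /= !pevalC.
set c := kconst A _; have cc z : c * z = z * c by rewrite kconstC.
suff H : t * (peval (x ^+ p) (\prod_(z <- r) ('X - z%:P)) *
      peval (y ^+ p) (\prod_(z <- r) ('X - z%:P))) =
    peval (x ^+ p) (\prod_(z <- r) ('X - z%:P)) *
      peval (y ^+ p) (\prod_(z <- r) ('X - z%:P)) * t.
  set U := peval _ _ in H *; set V := peval _ _ in H *.
  have -> : c * U * (c * V) = c * c * (U * V).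
    by rewrite !mulrA; congr (_ * _); rewrite -mulrA -cc !mulrA.
  have tcc : t * (c * c) = c * c * t by rewrite mulrA -cc -mulrA -cc mulrA.
  by rewrite mulrA tcc -!mulrA H -!mulrA.
elim: r => [|z r IHr]; first by rewrite !big_nil !rmorph1 !mulr1 mul1r.
rewrite !big_cons !rmorphM /= !rmorphB /= !pevalX !pevalC.
set U := peval _ _ in IHr *; set V := peval _ _ in IHr *.
set d := kconst A z.
have dc w : w * d = d * w by rewrite kconstC.
have yU : (y ^+ p - d) * U = U * (y ^+ p - d).
  have := xQ (\prod_(j <- r) ('X - j%:P)) ('X - z%:P).
  by rewrite (rmorphB (peval (y ^+ p)) 'X) /= pevalX pevalC => E; exact: esym E.
have E1 : (x ^+ p - d) * (y ^+ p - d) = (x * y) ^+ p - d * (x ^+ p + y ^+ p) + d * d.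
  rewrite exprMn_comm //.
  transitivity (x ^+ p * y ^+ p - x ^+ p * d - d * y ^+ p + d * d); first by ncring.
  by rewrite dc; ncring.
have tS : t * (x * y) ^+ p = (x * y) ^+ p * t by apply: commrX.
have E2 : t * ((x ^+ p - d) * (y ^+ p - d)) = (x ^+ p - d) * (y ^+ p - d) * t.
  rewrite E1; set s := x ^+ p + _.
  transitivity (t * (x * y) ^+ p - t * d * s + t * d * d); first by ncring.
  rewrite (dc t); transitivity (t * (x * y) ^+ p - d * (t * s) + d * (t * d)); first by ncring.
  have st : t * s = s * t := comm_power_sum p.
  by rewrite st (dc t) tS; ncring.
have E3 : (x ^+ p - d) * U * ((y ^+ p - d) * V) =
    (x ^+ p - d) * (y ^+ p - d) * (U * V).
  by rewrite -!mulrA; congr (_ * _); rewrite !mulrA yU.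
by rewrite E3 mulrA E2 -!mulrA IHr !mulrA.
Qed.

End SymmetricProducts.

Section WordIdempotents.
Variables (K : closedFieldType) (q : K) (p n kappa : nat).
Variables (P E : 'I_kappa -> {poly K}).
Hypotheses (q0 : q != 0) (P_sep : separated (q ^+ p) P).
Hypothesis E_prim : primary_family P E.
Variables (A : kalgebra K) (T : nat -> A).
Hypothesis sT : hecke_system q n.+1 T.
Local Notation L := (jm q T).
Hypothesis P_spec : forall i, (i < n.+1)%N -> peval (L i ^+ p) (\prod_c P c) = 0.
Local Notation word := (word n kappa).
Implicit Types (a b : word) (x y : A).

Definition Lp (i : nat) : A := L i ^+ p.
Definition eps_at (c : 'I_kappa) (i : nat) : A := peval (Lp i) (E c).
Definition ew a : A := \prod_(i < n.+1) eps_at (a i) i.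

Lemma Lp_comm i k : (i < n.+1)%N -> (k < n.+1)%N -> L k * Lp i = Lp i * L k.
Proof. by move=> im km; apply: commrX; apply: (jm_comm q0 sT). Qed.

Lemma comm_Lp x i : x * L i = L i * x -> x * Lp i = Lp i * x.
Proof. exact: commrX. Qed.

Lemma comm_eps x c i : x * L i = L i * x -> x * eps_at c i = eps_at c i * x.
Proof. by move=> xL; apply/peval_comm/comm_Lp. Qed.

Lemma comm_ew x a : (forall i, (i < n.+1)%N -> x * L i = L i * x) -> x * ew a = ew a * x.
Proof.
by move=> xL; apply: comm_prod => i; apply/comm_eps/xL.
Qed.

Lemma L_ew k a : (k < n.+1)%N -> L k * ew a = ew a * L k.
Proof. by move=> km; apply: comm_ew => i im; apply: (jm_comm q0 sT). Qed.

Lemma peval_ew k a Q : (k < n.+1)%N -> peval (Lp k) Q * ew a = ew a * peval (Lp k) Q.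
Proof.
by move=> km; symmetry; apply: peval_comm; symmetry; apply: comm_ew => i im;
  symmetry; apply: Lp_comm.
Qed.

Lemma eps_ew c k a : (k < n.+1)%N ->
  eps_at c k * ew a = if c == letter a k then ew a else 0.
Proof.
move=> km; have [EP Eort Esum] := E_prim (P_spec km).
have cm (j : 'I_n.+1) : eps_at c k * eps_at (a j) j = eps_at (a j) j * eps_at c k.
  by apply: comm_eps; symmetry; apply: comm_eps; apply: (jm_comm q0 sT).
have ak : a (Ordinal km) = letter a k by rewrite -letter_ord.
case: eqP => [ca|/eqP ca].
  apply: (@absorb_prod _ _ _ _ _ (Ordinal km)) => //; rewrite ?mem_index_enum //= ak ca.
  rewrite -[RHS]mul1r -Esum mulr_suml (bigD1 (letter a k)) //= [X in _ + X]big1 ?addr0 //.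
  by move=> d dc; exact: Eort.
apply: (@kill_prod _ _ _ _ _ (Ordinal km)) => //; rewrite ?mem_index_enum //= ak.
exact: Eort.
Qed.

Lemma ewM a b : ew a * ew b = if a == b then ew b else 0.
Proof.
have [->|ab] := eqVneq a b.
  rewrite {1}/ew; elim: (index_enum _) => [|i r IHr]; first by rewrite big_nil mul1r.
  by rewrite big_cons -mulrA IHr eps_ew // letter_ord eqxx.
have [k km akb] := word_neq ab.
have bk : eps_at (letter a k) k * ew b = 0 by rewrite eps_ew // (negPf akb).
have ak : eps_at (letter a k) k * ew a = ew a by rewrite eps_ew // eqxx.
by rewrite -ak peval_ew // -mulrA bk mulr0.
Qed.

Lemma ew_idem a : ew a * ew a = ew a. Proof. by rewrite ewM eqxx. Qed.

Lemma ew_sum : \sum_a ew a = 1.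
Proof.
rewrite /ew -(bigA_distr_bigA (fun i c => eps_at c (i : 'I_n.+1))) /=.
rewrite big1_seq // => i _; by have [_ _ ->] := E_prim (P_spec (ltn_ord i)).
Qed.

Lemma P_ew k a : (k < n.+1)%N -> peval (Lp k) (P (letter a k)) * ew a = 0.
Proof.
move=> km; have [EP _ _] := E_prim (P_spec km).
have <- : eps_at (letter a k) k * ew a = ew a by rewrite eps_ew // eqxx.
by rewrite mulrA EP mul0r.
Qed.

Lemma P_unit_ew k a c : (k < n.+1)%N -> c != letter a k ->
  exists u, peval (Lp k) u * peval (Lp k) (P c) * ew a = ew a.
Proof.
move=> km ca; apply: peval_unit_on (P_ew a km) => z.
by apply: (separated_neq P_sep); rewrite eq_sym.
Qed.

(** P_c(L_k^p) is invertible on e(b) unless c is the letter of b at k. This is how matrix entries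
    between different words are shown to vanish. *)
Lemma ew_kill k b x c : (k < n.+1)%N -> c != letter b k ->
  ew b * x = x -> peval (Lp k) (P c) * x = 0 -> x = 0.
Proof.
move=> km cb bx xc; have [u uE] := P_unit_ew km cb.
by rewrite -bx -uE -!mulrA bx xc mulr0.
Qed.

Lemma ew_intertwine x a b :
  (forall c, c != b -> ew c * x * ew a = 0) ->
  (forall c, c != a -> ew b * x * ew c = 0) -> x * ew a = ew b * x.
Proof.
move=> H1 H2; transitivity (ew b * x * ew a).
  rewrite -[LHS]mul1r -ew_sum mulr_suml (bigD1 b) //= big1 ?addr0 ?mulrA // => c cb.
  by rewrite mulrA H1.
by rewrite -[RHS]mulr1 -ew_sum mulr_sumr (bigD1 a) //= [X in _ + X]big1 ?addr0.
Qed.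

Lemma psi_swn i k : (i.+1 < n.+1)%N -> (k < n.+1)%N ->
  psi q T i * L k = L (swn i k) * psi q T i.
Proof.
move=> im km; rewrite /swn; case: eqP => [->|/eqP ki]; first exact: (psi_L q0 sT).
case: eqP => [->|/eqP ki']; first exact: (psi_LS q0 sT).
exact: (psi_comm_jm q0 sT).
Qed.

Lemma psi_swnp i k : (i.+1 < n.+1)%N -> (k < n.+1)%N ->
  psi q T i * Lp k = Lp (swn i k) * psi q T i.
Proof.
move=> im km; rewrite /Lp; elim: (p) => [|d IHd]; first by rewrite !expr0 mulr1 mul1r.
by rewrite !exprS mulrA psi_swn // -mulrA IHd mulrA.
Qed.

(** If c differs from s_i b at place k, take P for the letter of s_i b at k. At L_k^p it is
    invertible on e(c), but moved through psi it becomes a polynomial in the L^p at place s_i k that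
    kills e(b). *)
Lemma psi_ew i a : (i.+1 < n.+1)%N -> psi q T i * ew a = ew (sw i a) * psi q T i.
Proof.
move=> im; have H b c : c != sw i b -> ew c * psi q T i * ew b = 0.
  case/word_neq => k km; rewrite letter_sw // => cb.
  apply: (@ew_kill k c _ (letter b (swn i k))) => //; first by rewrite eq_sym.
    by rewrite !mulrA ew_idem.
  have k'm := swn_lt im km.
  rewrite !mulrA peval_ew // -(mulrA (ew c)).
  have -> : peval (Lp k) (P (letter b (swn i k))) * psi q T i =
      psi q T i * peval (Lp (swn i k)) (P (letter b (swn i k))).
    by symmetry; apply: peval_intertwine; rewrite psi_swnp // swnK.
  by rewrite -!mulrA P_ew // !mulr0.
apply: ew_intertwine => c ca; first exact: H.
by apply: H; apply: contraNneq ca => /(congr1 (sw i)); rewrite !swK // => ->.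
Qed.

Lemma peval_Lp_comm i j Q Q' : (i < n.+1)%N -> (j < n.+1)%N ->
  peval (Lp i) Q * peval (Lp j) Q' = peval (Lp j) Q' * peval (Lp i) Q.
Proof.
move=> im jm; apply: peval_comm; symmetry; apply: peval_comm.
by apply: commrX; apply/commr_sym/commrX/(jm_comm q0 sT).
Qed.

Lemma ew_T_kill i k a b : (i.+1 < n.+1)%N -> (k < n.+1)%N -> k != i -> k != i.+1 ->
  letter a k != letter b k -> ew b * T i.+1 * ew a = 0.
Proof.
move=> im km ki ki1 ab; apply: (@ew_kill k b _ (letter a k)) => //.
  by rewrite !mulrA ew_idem.
rewrite !mulrA peval_ew // -(mulrA (ew b)) -(@peval_comm _ _ _ (T i.+1)); last first.
  exact/comm_Lp/(T_comm_jm q0 sT).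
by rewrite -!mulrA P_ew // !mulr0.
Qed.

(** T_{i+1} commutes with G_c = P_c(L_i^p) P_c(L_{i+1}^p), which is symmetric in the two places. If
    b differs from a at one of them, let c be its letter there: G_c kills e(b) and, as both letters
    of a differ from c, is invertible on e(a). So T_{i+1} has no entry between a and b. Differences
    at other places are handled by [ew_T_kill]. *)
Lemma T_ew i a : (i.+1 < n.+1)%N -> letter a i = letter a i.+1 ->
  T i.+1 * ew a = ew a * T i.+1.
Proof.
move=> im ai; have i0m : (i < n.+1)%N by lia.
pose G c := peval (Lp i) (P c) * peval (Lp i.+1) (P c).
have TG c : T i.+1 * G c = G c * T i.+1.
  apply: comm_sym_prod; first by apply: (jm_comm q0 sT).
    exact: (T_jm_sum q0 sT).
  exact: (T_jm_prod q0 sT).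
have Gew c b : G c * ew b = ew b * G c.
  by rewrite /G -mulrA peval_ew // mulrA peval_ew // mulrA.
have G0 b c : c = letter b i \/ c = letter b i.+1 -> G c * ew b = 0.
  case=> ->; rewrite /G; last by rewrite -mulrA P_ew ?mulr0.
  by rewrite peval_Lp_comm // -mulrA P_ew ?mulr0.
have GU c : c != letter a i -> exists u, u * G c = ew a /\ G c * u = ew a.
  move=> ca; have [u uE] := P_unit_ew i0m ca.
  have [|v vE] := @P_unit_ew i.+1 a c im; first by rewrite -ai.
  pose w := peval (Lp i) u * peval (Lp i.+1) v.
  have wG : w * G c = G c * w.
    rewrite /w /G !mulrA -(mulrA (peval (Lp i) u)) (peval_Lp_comm _ _ im i0m).
    rewrite mulrA (peval_Lp_comm u _ i0m i0m) -!mulrA; congr (_ * _).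
    by rewrite (peval_Lp_comm v _ im im) !mulrA (peval_Lp_comm u _ i0m im).
  have wGE : w * G c * ew a = ew a.
    rewrite /w /G !mulrA -(mulrA (peval (Lp i) u)) (peval_Lp_comm _ _ im i0m).
    by rewrite -!mulrA (mulrA (peval _ v)) vE mulrA uE.
  exists (w * ew a); split; first by rewrite -mulrA -Gew mulrA.
  by rewrite mulrA -wG.
clearbody G; have H b : b != a -> ew b * T i.+1 * ew a = 0 /\ ew a * T i.+1 * ew b = 0.
  case/word_neq => k km ba.
  have [/orP ki|/norP[ki ki1]] := boolP ((k == i) || (k == i.+1)); last first.
    by split; apply: (@ew_T_kill _ k) => //; rewrite eq_sym.
  have kb : letter b k = letter b i \/ letter b k = letter b i.+1.
    by case: ki => /eqP ->; [left|right].
  have ak : letter a k = letter a i by case: ki => /eqP ->.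
  rewrite ak in ba; have [u [uG Gu]] := GU _ ba.
  have Gb := G0 _ _ kb; split.
    by rewrite -Gu -!mulrA (mulrA (T _)) TG -!mulrA (mulrA (ew b)) -Gew Gb mul0r.
  by rewrite -uG -!mulrA (mulrA (G _)) -TG -!mulrA Gb !mulr0.
by apply: ew_intertwine => c /H[].
Qed.

Lemma diff_unit_ew i a (lam : K) (j : int) : (i.+1 < n.+1)%N ->
  letter a i != letter a i.+1 -> lam = q ^ j ->
  exists2 h, in_subalg (pairS (L i) (L i.+1)) h &
    h * (L i.+1 - kconst A lam * L i) * ew a = ew a.
Proof.
move=> im ai lamE; have i0m : (i < n.+1)%N by lia.
apply: (@sub_unit_on _ _ p _ _ _ _ (P (letter a i)) (P (letter a i.+1))).
- by rewrite lamE expfz_neq0.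
- by apply: (jm_comm q0 sT).
- move=> z; have -> : lam ^+ p = (q ^+ p) ^ j by rewrite lamE !exprnP !exprz_exp mulrC.
  by apply: P_sep; apply/eqP.
- exact: P_ew.
- exact: P_ew.
Qed.

(** Up to scalars the two factors of the square are L_{i+1} - q^j L_i for j = 1 and j = -1, which
    [diff_unit_ew] inverts. *)
Lemma psi_sq_unit i a : (i.+1 < n.+1)%N -> letter a i != letter a i.+1 ->
  exists2 h, in_subalg (pairS (L i) (L i.+1)) h & h * (psi q T i * psi q T i) * ew a = ew a.
Proof.
move=> im ai.
have [h hS hE] := @diff_unit_ew i a q 1 im ai erefl.
have [h' h'S h'E] := @diff_unit_ew i a q^-1 (-1) im ai (esym (invr_expz _ 1)).
set X := L i in hS hE h'S h'E *; set Y := L i.+1 in hS hE h'S h'E *.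
set d1 := Y - _ in hE; set d2 := Y - _ in h'E.
have XY : X * Y = Y * X by apply: (jm_comm q0 sT) => //; lia.
have XS : in_subalg (pairS X Y) X by apply: subalg_gen; left.
have YS : in_subalg (pairS X Y) Y by apply: subalg_gen; right.
have dS c : in_subalg (pairS X Y) (Y - kconst A c * X).
  by apply: subalg_sub => //; apply: subalgZ.
have d2c z : in_subalg (pairS X Y) z -> z * d2 = d2 * z.
  apply: subalg_comm => _ [] ->.
    by apply: (commrB XY); apply: kscale_comm.
  by apply: (commrB (commr_refl Y)); apply: kscale_comm.
have -> : psi q T i * psi q T i = kconst A (- q) * (d1 * d2).
  rewrite (psi_sq q0 sT im) hecke_h1 -/X -/Y.
  have -> : kconst A q * X - Y = - d1 by rewrite opprB.
  have -> : kconst A q * Y - X = kconst A q * d2.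
    by rewrite mulrBr mulrA -rmorphM divff // rmorph1 mul1r.
  by rewrite rmorphN mulrA !mulNr -(kconstC q) mulrA.
exists (kconst A (- q)^-1 * (h' * h)); first exact/subalgZ/subalg_mul.
set r := kconst A (- q)^-1; set s := kconst A (- q).
have rs : r * s = 1 by rewrite -rmorphM mulVf ?rmorph1 ?oppr_eq0.
have -> : r * (h' * h) * (s * (d1 * d2)) = h' * (d2 * (h * d1)).
  have hd : h * d1 * d2 = d2 * (h * d1) by exact/d2c/(subalg_mul hS (dS q)).
  transitivity (r * (h' * h * s) * (d1 * d2)); first by ncring.
  have -> : h' * h * s = s * (h' * h) by rewrite kconstC.
  transitivity (r * s * h' * (h * d1 * d2)); first by ncring.
  by rewrite rs mul1r hd.
transitivity (h' * d2 * (h * d1 * ew a)); first by ncring.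
by rewrite hE.
Qed.

End WordIdempotents.

(** * Corner algebras and the universal property of tensor products *)

Section CornerAlgebra.
Variables (K : fieldType) (A : kalgebra K) (e : A).

Definition peirce_pred : {pred A} := fun x => e * x * e == x.
Fact peirce_zmod_closed : zmod_closed peirce_pred.
Proof.
split=> [|x y /eqP ex /eqP ey]; apply/eqP; first by rewrite mulr0 mul0r.
by rewrite mulrBr mulrBl ex ey.
Qed.
HB.instance Definition _ := GRing.isZmodClosed.Build A peirce_pred peirce_zmod_closed.

(** The proof of idempotence is an argument of the type, so that a ring structure with unit e can be
    attached to it. *)
Definition peirce_type (_ : e * e = e) := {x : A | peirce_pred x}.
Variable ee : e * e = e.
Local Notation P := (peirce_type ee).
HB.instance Definition _ := SubChoice.on P.
HB.instance Definition _ :=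
  GRing.SubChoice_isSubZmodule.Build A peirce_pred P peirce_zmod_closed.

Definition peirce (x : A) (ex : e * x * e = x) : P :=
  exist (fun x => is_true (peirce_pred x)) x (introT eqP ex).

Lemma peirceP (x : P) : e * val x * e = val x.
Proof. exact/eqP/(valP x). Qed.
Lemma peirce_l (x : P) : e * val x = val x.
Proof. by rewrite -[in RHS]peirceP -[in LHS]peirceP !mulrA ee. Qed.
Lemma peirce_r (x : P) : val x * e = val x.
Proof. by rewrite -[in RHS]peirceP -[in LHS]peirceP -!mulrA ee. Qed.

Fact peirce_one_subproof : e * e * e = e. Proof. by rewrite !ee. Qed.
Definition peirce_one : P := peirce peirce_one_subproof.
Fact peirce_mul_subproof (x y : P) : e * (val x * val y) * e = val x * val y.
Proof. by rewrite !mulrA peirce_l -mulrA peirce_r. Qed.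
Definition peirce_mul (x y : P) : P := peirce (peirce_mul_subproof x y).

Fact peirce_mulA : associative peirce_mul.
Proof. by move=> x y z; apply: val_inj; apply: mulrA. Qed.
Fact peirce_mul1 : left_id peirce_one peirce_mul.
Proof. by move=> x; apply: val_inj; apply: peirce_l. Qed.
Fact peirce_mulr1 : right_id peirce_one peirce_mul.
Proof. by move=> x; apply: val_inj; apply: peirce_r. Qed.
Fact peirce_mulDl : left_distributive peirce_mul +%R.
Proof. by move=> x y z; apply: val_inj; apply: mulrDl. Qed.
Fact peirce_mulDr : right_distributive peirce_mul +%R.
Proof. by move=> x y z; apply: val_inj; apply: mulrDr. Qed.
HB.instance Definition _ := GRing.Zmodule_isPzRing.Build P
  peirce_mulA peirce_mul1 peirce_mulr1 peirce_mulDl peirce_mulDr.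

Fact peirce_const_subproof c : e * (kconst A c * e) * e = kconst A c * e.
Proof. by rewrite mulrA -(kconstC c) -!mulrA !ee. Qed.
Definition peirce_const c : P := peirce (peirce_const_subproof c).
Fact peirce_const_zmod : zmod_morphism peirce_const.
Proof. by move=> c d; apply: val_inj; rewrite /= rmorphB mulrBl. Qed.
Fact peirce_const_monoid : monoid_morphism peirce_const.
Proof.
split=> [|c d]; apply: val_inj; first by rewrite /= rmorph1 mul1r.
rewrite -[RHS]/(kconst A c * e * (kconst A d * e)) /= rmorphM -[RHS]mulrA.
by rewrite (mulrA e) -(kconstC d e) -(mulrA _ e e) ee mulrA.
Qed.
HB.instance Definition _ :=
  GRing.isZmodMorphism.Build K P peirce_const peirce_const_zmod.
HB.instance Definition _ :=
  GRing.isMonoidMorphism.Build K P peirce_const peirce_const_monoid.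

Fact peirce_constC c x : peirce_const c * x = x * peirce_const c.
Proof.
apply: val_inj; rewrite -[LHS]/(kconst A c * e * val x) -[RHS]/(val x * (kconst A c * e)).
by rewrite -mulrA peirce_l mulrA -kconstC -mulrA peirce_r.
Qed.
Definition peirce_kalg : kalgebra K := KAlgebra peirce_constC.

Lemma peirce_valM (x y : peirce_kalg) : val (x * y) = val x * val y. Proof. by []. Qed.
Lemma peirce_valB (x y : peirce_kalg) : val (x - y) = val x - val y. Proof. by []. Qed.
Lemma peirce_valD (x y : peirce_kalg) : val (x + y) = val x + val y. Proof. by []. Qed.
Lemma peirce_val1 : val (1 : peirce_kalg) = e. Proof. by []. Qed.
Lemma peirce_val_const c : val (kconst peirce_kalg c) = kconst A c * e. Proof. by []. Qed.
End CornerAlgebra.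

Section TensorUniversal.
Variables (K : fieldType) (I : finType) (A : I -> kalgebra K).
Local Notation P := (prod_kalg A).

Lemma prod_mulE (x y : P) i : (x * y) i = x i * y i. Proof. by []. Qed.

Definition tensor_single i (x : A i) : P := dfwith (1 : P) x.

Lemma tensor_single_in i (x : A i) : tensor_single x i = x.
Proof. exact: dfwith_in. Qed.
Lemma tensor_single_out i (x : A i) j : i != j -> tensor_single x j = 1.
Proof. by move=> ij; rewrite /tensor_single dfwith_out. Qed.

Lemma tensor_singleM i (x y : A i) : tensor_single (x * y) = tensor_single x * tensor_single y.
Proof.
apply: functional_extensionality_dep => j; rewrite prod_mulE.
have [<-|ij] := eqVneq i j; first by rewrite !tensor_single_in.
by rewrite !(tensor_single_out _ ij) mulr1.
Qed.

Lemma tensor_single1 i : tensor_single (1 : A i) = 1.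
Proof.
apply: functional_extensionality_dep => j.
have [<-|ij] := eqVneq i j; first by rewrite tensor_single_in.
by rewrite tensor_single_out.
Qed.

Definition tensor_in_fun i (x : A i) : tensor A := pure_tensor (tensor_single x).

Fact tensor_in_zmod i : zmod_morphism (@tensor_in_fun i).
Proof.
move=> x y; apply/eqP; rewrite eq_sym subr_eq; apply/eqP.
transitivity (tensor_in_fun (x - y + y)); first by rewrite subrK.
exact: pure_tensorD.
Qed.
Fact tensor_in_monoid i : monoid_morphism (@tensor_in_fun i).
Proof.
split; first by rewrite /tensor_in_fun tensor_single1 pure_tensor1.
by move=> x y; rewrite /tensor_in_fun tensor_singleM pure_tensorM.
Qed.
HB.instance Definition _ i :=
  GRing.isZmodMorphism.Build (A i) (tensor A) (@tensor_in_fun i) (@tensor_in_zmod i).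
HB.instance Definition _ i :=
  GRing.isMonoidMorphism.Build (A i) (tensor A) (@tensor_in_fun i) (@tensor_in_monoid i).
Fact tensor_in_const i c : @tensor_in_fun i (kconst (A i) c) = kconst (tensor A) c.
Proof.
rewrite -[kconst (A i) c]mulr1 -[RHS]mulr1 -(rmorph1 (@tensor_in_fun i)).
exact: pure_tensorZ.
Qed.
Definition tensor_in i : kalg_hom (A i) (tensor A) :=
  @KalgHom K (A i) (tensor A) (@tensor_in_fun i) (@tensor_in_const i).

Lemma tensor_in_comm i j (x : A i) (y : A j) : i != j ->
  tensor_in i x * tensor_in j y = tensor_in j y * tensor_in i x.
Proof.
move=> ij; rewrite -[LHS]pure_tensorM -[RHS]pure_tensorM; congr pure_tensor.
apply: functional_extensionality_dep => k.
rewrite !prod_mulE.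
have [jk|jk] := eqVneq j k; last by rewrite (tensor_single_out y) // mulr1 mul1r.
by rewrite (tensor_single_out x) ?mulr1 ?mul1r // -jk.
Qed.

Lemma pure_tensor_prod (x : P) :
  pure_tensor x = \prod_(i <- index_enum I) tensor_in i (x i).
Proof.
transitivity (pure_tensor (\prod_(i <- index_enum I) tensor_single (x i))).
  congr pure_tensor; apply: functional_extensionality_dep => j.
  have prodE (r : seq I) : (\prod_(i <- r) tensor_single (x i)) j =
      \prod_(i <- r) (tensor_single (x i) j).
    elim: r => [|i r IHr]; first by rewrite !big_nil.
    by rewrite !big_cons -IHr.
  rewrite prodE; have := mem_index_enum j; have := index_enum_uniq I.
  elim: (index_enum I) => // i r IHr /andP[ir ur]; rewrite inE big_cons => /orP[/eqP ji|jr].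
    rewrite -ji in ir *; rewrite tensor_single_in big1_seq ?mulr1 // => k /andP[_ kr].
    by rewrite tensor_single_out //; apply: contraNneq ir => <-.
  rewrite tensor_single_out ?mul1r -?IHr //.
  by apply: contraNneq ir => ->.
elim: (index_enum I) => [|i r IHr]; first by rewrite !big_nil pure_tensor1.
by rewrite !big_cons pure_tensorM IHr.
Qed.

Lemma tensor_generated z :
  in_subalg (fun y => exists i x, y = tensor_in i x) z.
Proof.
elim/tensor_ind: z => [|y z Sy Sz|c x].
- exact: subalg0.
- exact: subalgD.
apply: subalgZ; rewrite pure_tensor_prod; elim: (index_enum I) => [|i r IHr].
  by rewrite big_nil; apply: subalg1.
by rewrite big_cons; apply: subalg_mul => //; apply: subalg_gen; exists i, (x i).
Qed.

Section Lift.
Variables (B : kalgebra K) (f : forall i, kalg_hom (A i) B).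
Hypothesis f_comm : forall i j x y, i != j -> f i x * f j y = f j y * f i x.

Definition tensor_lift_pure (x : P) : B := \prod_(i <- index_enum I) f i (x i).

Fact tensor_lift_monoid : monoid_morphism tensor_lift_pure.
Proof.
split=> [|x y]; first by rewrite /tensor_lift_pure big1_seq // => i _; apply: rmorph1.
rewrite /tensor_lift_pure; have := index_enum_uniq I.
elim: (index_enum I) => [|i r IHr] /=; first by rewrite !big_nil mulr1.
case/andP=> ir ur; rewrite !big_cons IHr //.
have -> : f i ((x * y : P) i) = f i (x i) * f i (y i) by rewrite -rmorphM.
rewrite -!mulrA; congr (_ * _); rewrite !mulrA; congr (_ * _).
elim: {IHr ur} r ir => [|j r IHr]; first by rewrite big_nil mulr1 mul1r.
rewrite inE big_cons negb_or => /andP[ij ir].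
by rewrite mulrA f_comm // -mulrA IHr // mulrA.
Qed.

(** The source of multilinearity: all factors but one are frozen in C and D. *)
Lemma tensor_lift_split (x : P) i : exists C D, forall u : A i,
  tensor_lift_pure (dfwith x u) = C * f i u * D.
Proof.
rewrite /tensor_lift_pure; have := index_enum_uniq I.
have /splitPr[r1 r2] := mem_index_enum i.
rewrite cat_uniq /= negb_or => /and3P[_ /andP[ir1 _] /andP[ir2 _]].
exists (\prod_(j <- r1) f j (x j)), (\prod_(j <- r2) f j (x j)) => u.
rewrite big_cat big_cons /= dfwith_in mulrA; congr (_ * _ * _).
  apply: eq_big_seq => j jr; rewrite dfwith_out //.
  by apply: contraNneq ir1 => ->.
apply: eq_big_seq => j jr; rewrite dfwith_out //.
by apply: contraNneq ir2 => ->.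
Qed.

Fact tensor_lift_rel g : multilinear_rel g -> monalg_lift tensor_lift_monoid g = 0.
Proof.
case=> [x i u v|x i c u]; rewrite !rmorphB ?kalg_hom_scale !monalg_liftE /=.
  have [C [D H]] := tensor_lift_split x i.
  by rewrite !H rmorphD mulrDr mulrDl addrAC addrK subrr.
have [C [D H]] := tensor_lift_split x i.
by rewrite !H kalg_hom_scale kscaleAr kscaleAl subrr.
Qed.

Definition tensor_lift : kalg_hom (tensor A) B := quot_lift tensor_lift_rel.

Lemma tensor_liftE i x : tensor_lift (tensor_in i x) = f i x.
Proof.
transitivity (tensor_lift_pure (tensor_single x)).
  by rewrite [LHS]quot_liftE monalg_liftE.
rewrite /tensor_lift_pure; have := mem_index_enum i; have := index_enum_uniq I.
elim: (index_enum I) => // j r IHr /andP[jr ur]; rewrite inE big_cons => /orP[/eqP ij|ir].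
  rewrite -ij in jr *; rewrite tensor_single_in big1_seq ?mulr1 // => k /andP[_ kr].
  by rewrite tensor_single_out ?rmorph1 //; apply: contraNneq jr => ->.
rewrite tensor_single_out ?rmorph1 ?mul1r ?IHr //.
by apply: contraNneq jr => <-.
Qed.

End Lift.

End TensorUniversal.

Lemma tensor_map_in (K : fieldType) (I : finType) (A B : I -> kalgebra K)
    (f : forall i, kalg_hom (A i) (B i)) i x :
  tensor_map f (tensor_in A i x) = tensor_in B i (f i x).
Proof.
rewrite [LHS]tensor_map_pure; congr pure_tensor.
apply: functional_extensionality_dep => j.
have [ij|ij] := eqVneq i j; first by case: j / ij; rewrite !tensor_single_in.
by rewrite !tensor_single_out ?rmorph1.
Qed.

(** * Block words *)

Section BlockWords.
Local Open Scope nat_scope.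
Variables (n kappa : nat).
Local Notation word := (word n kappa).
Implicit Types (a : word) (b : 'I_kappa -> nat) (c d : 'I_kappa).

Definition off b c : nat := \sum_(d < kappa | d < c) b d.

Definition block b c i := off b c <= i < off b c + b c.

Lemma off_lt b c d : c < d -> off b c + b c <= off b d.
Proof.
move=> cd; rewrite /off [X in _ <= X](bigD1 c) //= addnC leq_add2l.
rewrite [X in _ <= X](bigID (fun e : 'I_kappa => e < c)) /=.
rewrite (eq_bigl (fun e : 'I_kappa => (e < d) && (e != c) && (e < c))) ?leq_addr // => e.
apply/idP/andP => [ec|[]//]; split=> //.
by rewrite (ltn_trans ec cd) -val_eqE /= ltn_eqF.
Qed.

Lemma off_total b c : off b c + b c <= \sum_d b d.
Proof.
rewrite /off [X in _ <= X](bigD1 c) //= addnC leq_add2l.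
rewrite [X in _ <= X](bigID (fun e : 'I_kappa => e < c)) /=.
rewrite (eq_bigl (fun e : 'I_kappa => (e != c) && (e < c))) ?leq_addr // => e.
apply/idP/andP => [ec|[]//]; split=> //.
by rewrite -val_eqE /= ltn_eqF.
Qed.

Lemma block_uniq b c d i : block b c i -> block b d i -> c = d.
Proof.
move=> /andP[ci ic] /andP[di id]; apply/val_inj => /=.
have [cd|dc|//] := ltngtP (c : nat) d; [have := off_lt b cd|have := off_lt b dc]; lia.
Qed.

Lemma block_ex b i : i < \sum_d b d -> exists c, block b c i.
Proof.
move=> ib; pose S k := \sum_(d < kappa | d < k) b d.
have Sk : S kappa = \sum_d b d by apply: eq_bigl => d; rewrite ltn_ord.
have S0 : S 0 = 0 by rewrite /S big_pred0.
have : exists k, i < S k by exists kappa; rewrite Sk.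
(* The block of i is read off from the least k whose partial sum exceeds i. *)
case/ex_minnP => -[|k]; first by rewrite S0.
move=> iSk kmin; have kk : k < kappa.
  by have := kmin kappa; rewrite Sk => /(_ ib).
exists (Ordinal kk); rewrite /block /off -/(S k); apply/andP; split.
  by rewrite leqNgt; apply/negP => /kmin; rewrite ltnn.
move: iSk; rewrite {1}/S (bigD1 (Ordinal kk)) //= addnC.
rewrite (eq_bigl (fun d : 'I_kappa => d < k)) // => d.
by rewrite -val_eqE /= ltnS [d < k]ltn_neqAle andbC.
Qed.

Definition content a c : nat := \sum_(i < n.+1) (letter a i == c).

Definition is_block_word b a := forall i, i < n.+1 -> block b (letter a i) i.

Lemma block_word_ex b : \sum_d b d = n.+1 -> exists a, is_block_word b a.
Proof.
move=> bn; have H (i : 'I_n.+1) : exists c, block b c i.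
  by apply: block_ex; rewrite bn ltn_ord.
have [f fP] := fin_all_exists H.
exists [ffun i => f i] => i im.
by rewrite /letter ffunE; have := fP (inord i); rewrite inordK.
Qed.

Lemma block_word_letter b a c i : is_block_word b a -> i < n.+1 -> block b c i ->
  letter a i = c.
Proof. by move=> ab im; apply: block_uniq (ab i im). Qed.

Lemma block_word_uniq b a a' : is_block_word b a -> is_block_word b a' -> a = a'.
Proof.
by move=> ab ab'; apply: word_ext => k km; apply: block_uniq (ab k km) (ab' k km).
Qed.

Lemma sum_interval m n' N : n' <= N ->
  \sum_(i < N) (m <= i < n')%N = n' - m.
Proof.
move=> nN; rewrite -[RHS](size_iota m) -sum1_size.
rewrite [LHS](eq_bigr (fun i : 'I_N => if (m <= i < n') then 1 else 0)); last by move=> i _; case: ifP.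
rewrite -big_mkcond -(big_mkord (fun i => m <= i < n') (fun=> 1)) /=.
rewrite -big_filter; apply: perm_big; apply: uniq_perm; rewrite ?filter_uniq ?iota_uniq //.
by move=> i; rewrite mem_filter !mem_iota; lia.
Qed.

Lemma content_block b a : \sum_d b d = n.+1 -> is_block_word b a -> content a =1 b.
Proof.
move=> bn ab c; rewrite /content.
transitivity (\sum_(i < n.+1) (off b c <= i < off b c + b c)%N); last first.
  by rewrite sum_interval ?addKn // -bn off_total.
apply: eq_bigr => i _; congr nat_of_bool; apply/eqP/idP => [<-|ic]; first exact: ab.
exact: block_word_letter ab (ltn_ord i) ic.
Qed.

Lemma content_sum a : \sum_c content a c = n.+1.
Proof.
rewrite /content exchange_big /= -[RHS]card_ord -sum1_card; apply: eq_bigr => i _.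
by rewrite (bigD1 (letter a i)) //= eqxx big1 // => c /negPf; rewrite eq_sym => ->.
Qed.

Lemma content_sw i a : i.+1 < n.+1 -> content (sw i a) =1 content a.
Proof.
move=> im c; rewrite /content.
pose s (k : 'I_n.+1) : 'I_n.+1 := inord (swn i k).
have sE k : s k = swn i k :> nat by rewrite inordK // swn_lt.
have sK : involutive s by move=> k; apply/val_inj; rewrite /= !sE swnK.
rewrite [RHS](reindex_inj (inv_inj sK)) /=; apply: eq_bigr => k _.
by rewrite letter_sw // sE.
Qed.

Definition descent a i := letter a i.+1 < letter a i.

Lemma nondecreasing_le a i j : (forall k, k.+1 < n.+1 -> ~~ descent a k) ->
  i <= j -> j < n.+1 -> letter a i <= letter a j.
Proof.
move=> nd ij; rewrite -(subnKC ij); elim: (j - i) => [|k IHk]; first by rewrite addn0.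
rewrite addnS => km; apply: (leq_trans (IHk (ltnW km))).
by have := nd _ km; rewrite /descent -leqNgt.
Qed.

Lemma off_content a c : off (content a) c = \sum_(i < n.+1) (letter a i < c).
Proof.
rewrite /off /content exchange_big /=; apply: eq_bigr => i _.
case: (boolP (letter a i < c)) => lc.
  rewrite (bigD1 (letter a i)) //= eqxx big1 // => d /andP[_ /negPf].
  by rewrite eq_sym => ->.
by rewrite big1 // => d dc; case: eqP => // E; rewrite E dc in lc.
Qed.

(** Let c be the letter at i. In a sorted word all letters smaller than c stand before i, and all
    letters up to place i are at most c; the two counts are the ends of block c. *)
Lemma sorted_block_word a : (forall k, k.+1 < n.+1 -> ~~ descent a k) ->
  is_block_word (content a) a.
Proof.
move=> nd i im; rewrite /block off_content; set c := letter a i.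
have le1 : \sum_(k < n.+1) (letter a k < c) <= i.
  rewrite -[X in _ <= X]subn0 -(@sum_interval 0 i n.+1 (ltnW im)).
  apply: leq_sum => k _ /=; case: (ltnP k i) => [|ik]; first by rewrite leq_b1.
  by have := nondecreasing_le nd ik (ltn_ord k); rewrite leqNgt => /negPf ->.
rewrite le1 /=; have: \sum_(k < n.+1) (letter a k <= c) >= i.+1.
  rewrite -[X in X <= _]subn0 -(@sum_interval 0 i.+1 n.+1 im).
  apply: leq_sum => k _ /=; case: (ltnP k i.+1) => [ki|//].
  by rewrite ltnS in ki; rewrite (nondecreasing_le nd ki).
rewrite /content -big_split /=; congr (_ <= _); apply: eq_bigr => k _.
by rewrite leq_eqVlt val_eqE addnC; case: eqP => [->|]; rewrite ?ltnn ?addn0.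
Qed.

Lemma block_word_sorted b a k : is_block_word b a -> k.+1 < n.+1 -> ~~ descent a k.
Proof.
move=> ab km; rewrite /descent -leqNgt leqNgt; apply/negP => lt.
have := off_lt b lt; have := ab _ km; have := ab _ (ltnW km); rewrite /block; lia.
Qed.

Lemma eq_is_block_word b b' a : b =1 b' -> is_block_word b a -> is_block_word b' a.
Proof.
move=> bb' ab i im; have := ab i im; rewrite /block /off bb'.
by rewrite (eq_bigr b').
Qed.

(** Grows when a descent is exchanged and is bounded, so sorting terminates ([word_sort_ind]). *)
Definition weight a : nat := \sum_(i < n.+1) i * letter a i.

Lemma weight_bound a : weight a <= n.+1 * (n.+1 * kappa).
Proof.
rewrite /weight -[X in X * _]card_ord -sum_nat_const; apply: leq_sum => i _.
by rewrite leq_mul // ltnW.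
Qed.

Lemma weight_sw a i : i.+1 < n.+1 -> descent a i -> weight a < weight (sw i a).
Proof.
move=> im d; have im' := ltnW im; rewrite /weight.
rewrite (bigD1 (Ordinal im)) // (bigD1 (Ordinal im')) /=; last first.
  by rewrite -val_eqE /= ltn_eqF.
rewrite [X in _ < X](bigD1 (Ordinal im)) // [X in _ < _ + X](bigD1 (Ordinal im')) /=; last first.
  by rewrite -val_eqE /= ltn_eqF.
rewrite letter_sw_l // letter_sw_r //.
rewrite (eq_bigr (fun k : 'I_n.+1 => k * letter (sw i a) k)); last first.
  move=> k; rewrite -!val_eqE /= => /andP[k1 k2].
  by rewrite letter_sw_out.
rewrite !addnA ltn_add2r; rewrite /descent in d; nia.
Qed.

Lemma word_sort_ind (Q : word -> Prop) :
  (forall a, (forall k, k.+1 < n.+1 -> ~~ descent a k) -> Q a) ->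
  (forall a i, i.+1 < n.+1 -> descent a i -> (forall a', weight a < weight a' -> Q a') -> Q a) ->
  forall a, Q a.
Proof.
move=> Q0 Q1 a; have [N] := ubnP (n.+1 * (n.+1 * kappa) - weight a).
elim: N a => // N IHN a aN.
have [d|nd] := boolP [exists k : 'I_n, descent a k]; last first.
  apply: Q0 => k km; move: nd; rewrite negb_exists => /forallP/(_ (Ordinal (km : k < n))).
  by [].
case/existsP: d => k dk; apply: (Q1 a k) => //.
  by rewrite ltnS.
move=> a' aa'; apply: IHN; have := weight_bound a'; lia.
Qed.

(** The k-th occurrence of c, counted from 0, is matched with the k-th Jucys-Murphy element of the
    factor c. *)
Definition rank a i : nat := \sum_(j < i) (letter a j == letter a i).

Lemma rank_lt a i : i < n.+1 -> rank a i < content a (letter a i).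
Proof.
move=> im; rewrite /content -(big_mkord predT (fun k => nat_of_bool (letter a k == letter a i))).
rewrite (@big_cat_nat _ _ _ i.+1) //= big_nat_recr //= eqxx /rank big_mkord.
by rewrite addn1 leq_addr.
Qed.

Lemma rankS a i c : letter a i = c -> rank a i = \sum_(j < i) (letter a j == c).
Proof. by move=> <-. Qed.

Lemma rank_sw_lt i a k : i.+1 < n.+1 -> k < i -> rank (sw i a) k = rank a k.
Proof.
move=> im ki; rewrite /rank letter_sw_out //; try lia.
by apply: eq_bigr => j _; rewrite letter_sw_out //; have := ltn_ord j; lia.
Qed.

Lemma rank_sw_l i a : i.+1 < n.+1 -> letter a i != letter a i.+1 ->
  rank (sw i a) i = rank a i.+1.
Proof.
move=> im ai; rewrite /rank letter_sw_l // big_ord_recr /= (negPf ai) addn0.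
by apply: eq_bigr => j _; rewrite letter_sw_out //; have := ltn_ord j; lia.
Qed.

Lemma rank_sw_r i a : i.+1 < n.+1 -> letter a i != letter a i.+1 ->
  rank (sw i a) i.+1 = rank a i.
Proof.
move=> im ai; rewrite /rank letter_sw_r // big_ord_recr /= letter_sw_l //.
rewrite [_ == letter a i]eq_sym (negPf ai) addn0.
by apply: eq_bigr => j _; rewrite letter_sw_out //; have := ltn_ord j; lia.
Qed.

Lemma rank_sw_gt i a k : i.+1 < k -> k < n.+1 -> rank (sw i a) k = rank a k.
Proof.
move=> ik km; have im : i.+1 < n.+1 by lia.
rewrite /rank letter_sw_out //; try lia.
have sik (j : 'I_k) : swn i j < k by rewrite /swn; have := ltn_ord j; do !case: eqP; lia.
pose s (j : 'I_k) : 'I_k := Ordinal (sik j).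
have sK : involutive s by move=> j; apply/val_inj; rewrite /= swnK.
rewrite [RHS](reindex_inj (inv_inj sK)) /=; apply: eq_bigr => j _.
by rewrite letter_sw //; have := ltn_ord j; lia.
Qed.

Lemma rank_succ a i : letter a i = letter a i.+1 -> rank a i.+1 = (rank a i).+1.
Proof. by move=> ai; rewrite /rank big_ord_recr /= ai eqxx addn1. Qed.

Lemma rank_mono a i j : i < j -> letter a i = letter a j -> rank a i < rank a j.
Proof.
move=> ij aij; rewrite /rank -!(big_mkord predT (fun k => nat_of_bool (letter a k == _))).
rewrite [X in _ < X](@big_cat_nat _ _ _ i.+1) //= big_nat_recr //= aij eqxx addn1.
exact: leq_addr.
Qed.

Lemma rank_block b a c k : \sum_d b d = n.+1 -> is_block_word b a -> k < b c ->
  rank a (off b c + k) = k.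
Proof.
move=> bn ab kc; have := off_total b c; rewrite bn => ocn.
have bc j : j < b c -> block b c (off b c + j) by rewrite /block => jc; lia.
rewrite (rankS (block_word_letter ab _ (bc k kc))); last by lia.
rewrite -[RHS](addKn (off b c)) -(@sum_interval (off b c) (off b c + k) _ (leqnn _)).
apply: eq_bigr => j _; have jk := ltn_ord j; congr nat_of_bool; rewrite jk andbT.
apply/eqP/idP => [jc|cj].
  by have := ab j (leq_trans jk (ltnW _)); rewrite jc /block => /(_ ltac:(lia))/andP[].
by apply: (block_word_letter ab); [lia | rewrite /block; lia].
Qed.

End BlockWords.

(** * The block subalgebra *)

Section PeirceCut.
Variables (K : fieldType) (A : kalgebra K) (e : A) (ee : e * e = e).
Implicit Types x y : A.

Fact cut_subproof x : e * (e * x * e) * e = e * x * e.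
Proof. by rewrite !mulrA ee -mulrA ee. Qed.
Definition cut x : peirce_kalg ee := peirce ee (cut_subproof x).

Lemma cut_val x : e * x = x * e -> val (cut x) = x * e.
Proof. by move=> ex; rewrite /= ex -mulrA ee. Qed.

Lemma cutM x y : e * y = y * e -> cut x * cut y = cut (x * y).
Proof.
move=> ey; apply: val_inj; rewrite peirce_valM /= ey -!mulrA ee.
by rewrite -ey (mulrA e e) ee.
Qed.
Lemma cutD x y : cut x + cut y = cut (x + y).
Proof. by apply: val_inj; rewrite peirce_valD /= mulrDr mulrDl. Qed.
Lemma cutB x y : cut x - cut y = cut (x - y).
Proof. by apply: val_inj; rewrite peirce_valB /= mulrBr mulrBl. Qed.
Lemma cut_const c : cut (kconst A c) = kconst (peirce_kalg ee) c.
Proof. by apply: val_inj; rewrite peirce_val_const /= -kconstC -mulrA ee. Qed.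
Lemma cut1 : cut 1 = 1.
Proof. by apply: val_inj; rewrite peirce_val1 /= mulr1 ee. Qed.
Lemma cut_kscale c x : kscale c (cut x) = cut (kscale c x).
Proof.
rewrite /kscale; apply: val_inj.
rewrite peirce_valM peirce_val_const /= (mulrA e (kconst A c)) -(kconstC c e).
by rewrite !mulrA -(mulrA (kconst A c) e e) ee.
Qed.
End PeirceCut.

Section BlockMap.
Variables (K : closedFieldType) (q : K) (p n kappa : nat).
Variables (Qs : 'I_kappa -> seq K) (E : 'I_kappa -> {poly K}).
(** [C c] is the relation wanted for T_0^p in the factor c; [P c] is a multiple of it chosen large
    enough for all L_i^p. *)
Let C c : {poly K} := \prod_(x <- Qs c) ('X - (x ^+ p)%:P).
Variable P : 'I_kappa -> {poly K}.
Hypotheses (q0 : q != 0) (P_sep : separated (q ^+ p) P).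
Hypothesis C_dvd : forall c, exists R, P c = R * C c.
Hypothesis E_prim : primary_family P E.
Variables (A : kalgebra K) (T : nat -> A).
Hypothesis sT : hecke_system q n.+1 T.
Local Notation L := (jm q T).
Hypothesis P_spec : forall i, (i < n.+1)%N -> peval (L i ^+ p) (\prod_c P c) = 0.
Hypothesis T_cyc : peval (T 0%N ^+ p) (\prod_c C c) = 0.
Local Notation word := (word n kappa).
Local Notation ew := (ew q p E T).
Local Notation Lp := (Lp q p T).
Implicit Type a : word.

Let ewL := L_ew p E q0 sT.
Let ewid := ew_idem q0 E_prim sT P_spec.

(** In general only P kills L_i^p on e(a). At a first occurrence the preceding letter is different,
    so an invertible intertwiner moves the letter one place to the left. At place 0 the product of
    all C_d vanishes, and the C_d for other letters d are invertible since they divide P_d. *)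
Lemma first_occurrence i a : (i < n.+1)%N ->
  (forall j, (j < i)%N -> letter a j != letter a i) -> peval (Lp i) (C (letter a i)) * ew a = 0.
Proof.
elim: i a => [|i IHi] a im ai.
  set c := letter a 0.
  have CG : \prod_d C d = C c * \prod_(d | d != c) C d by rewrite (bigD1 c).
  pose G := \prod_(d | d != c) C d.
  have [z Pz|u uE] := @peval_unit_on _ _ (Lp 0) (ew a) (P c) G _
    (P_ew q0 E_prim sT P_spec a im).
    rewrite /G; elim/big_ind: _ => [|Q Q' HQ HQ'|d dc].
    - exact/negP/root1.
    - by rewrite rootM => /orP[].
    - have [R PR] := C_dvd d; have : ~ root (P d) z.
        by apply: (separated_neq P_sep) Pz; rewrite eq_sym.
      by rewrite PR rootM => /negP; rewrite negb_or => /andP[_ /negP].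
  have CGc : peval (Lp 0) (C c) * peval (Lp 0) G = 0 by rewrite -rmorphM /= -CG.
  have Cu : peval (Lp 0) (C c) * peval (Lp 0) u = peval (Lp 0) u * peval (Lp 0) (C c).
    by rewrite -!rmorphM mulrC.
  by rewrite -uE !mulrA Cu -(mulrA (peval _ u)) CGc mulr0 mul0r.
have im' := ltnW im; have aii : letter a i != letter a i.+1 by apply: ai.
have [h hS hE] := psi_sq_unit q0 P_sep E_prim sT P_spec im aii.
set b := sw i a; have bi : letter b i = letter a i.+1 by rewrite letter_sw_l.
have IH : peval (Lp i) (C (letter a i.+1)) * ew b = 0.
  rewrite -bi; apply: IHi => // j ji; rewrite bi letter_sw_out; try lia.
  by apply: ai; lia.
have hc : h * Lp i.+1 = Lp i.+1 * h.
  by apply: subalg_comm hS => _ [] ->; apply: (Lp_comm p q0 sT).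
have psiC : psi q T i * peval (Lp i) (C (letter a i.+1)) =
    peval (Lp i.+1) (C (letter a i.+1)) * psi q T i.
  apply: peval_intertwine; rewrite (psi_swnp p q0 sT) // swn_l //.
rewrite -hE -!mulrA (mulrA _ h) -(@peval_comm _ _ _ h) // -mulrA.
rewrite (mulrA _ (psi q T i) (psi q T i * ew a)) -psiC.
rewrite (psi_ew q0 P_sep E_prim sT P_spec) // -/b -!mulrA (mulrA _ (ew b)) IH.
by rewrite mul0r !mulr0.
Qed.

Section OneBlockWord.
Variables (b : 'I_kappa -> nat) (a : word).
Hypotheses (b_sum : \sum_c b c = n.+1) (ab : is_block_word b a).
Local Notation e := (ew a).
Local Notation eAe := (peirce_kalg (ewid a)).

Lemma block_lt c k : (k < b c)%N -> (off b c + k < n.+1)%N.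
Proof. by move=> kc; have := off_total b c; rewrite b_sum; lia. Qed.

Lemma block_letter c k : (k < b c)%N -> letter a (off b c + k) = c.
Proof.
move=> kc; apply: (block_word_letter ab (block_lt kc)).
by rewrite /block leq_addr ltn_add2l.
Qed.

Lemma block_T_ew c k : (k.+1 < b c)%N ->
  e * T (off b c + k.+1) = T (off b c + k.+1) * e.
Proof.
move=> kc; rewrite addnS; symmetry; apply: (T_ew q0 P_sep E_prim sT P_spec).
  by rewrite -addnS block_lt.
by rewrite block_letter ?(ltnW kc) // -addnS block_letter.
Qed.

Definition blockT0 c (k : nat) : A :=
  if k is 0 then L (off b c) else T (off b c + k).
Lemma blockT0S c k : blockT0 c k.+1 = T (off b c + k.+1). Proof. by []. Qed.
Definition blockT c k : eAe := cut (ewid a) (blockT0 c k).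

Lemma blockT0_ew c k : (k < b c)%N -> e * blockT0 c k = blockT0 c k * e.
Proof.
case: k => [|k] kc; last exact: block_T_ew.
by rewrite /= -ewL //; have := block_lt kc; rewrite addn0.
Qed.

Lemma blockT_system c : hecke_system q (b c) (blockT c).
Proof.
have H k : (k < b c)%N -> e * blockT0 c k = blockT0 c k * e by apply: blockT0_ew.
have lt k : (k < b c)%N -> (off b c + k < n.+1)%N by apply: block_lt.
split=> [i /andP[i0 ib]|b1|i i0 ib|i j ij jb].
- rewrite -(cut1 (ewid a)) -cut_const cutD cutB cutM; last first.
    by rewrite mulrBr mulrBl H // kconstC.
  case: i i0 ib => // i _ ib; rewrite /= (hs_quad sT); last first.
    by rewrite addnS /= -addnS lt.
  by apply: val_inj; rewrite /= mulr0 mul0r.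
- have H0 := H _ (ltnW b1); have H1 := H _ b1.
  rewrite !cutM //; congr cut => /=.
  (* With T L_o T = q L_{o+1}, the relation of length four says that L_o and L_{o+1} commute. *)
  set o := off b c; rewrite addn1; have om : (o.+1 < n.+1)%N by have := lt _ b1; rewrite addn1.
  have E1 := jm_T T q0 o; rewrite hecke_h1 in E1.
  have E2 := jm_comm_pair q0 sT om.
  rewrite -!mulrA (mulrA (T _)) E1 mulrA -(kconstC q) -mulrA -E2 mulrA -E1 -!mulrA.
  by [].
- have H0 := H _ ib; have H1 := H _ (ltnW ib).
  rewrite !cutM //; congr cut; case: i i0 ib {H0 H1} => // i _ ib /=.
  by rewrite !addnS (hs_braid3 sT) //; have := lt _ ib; rewrite !addnS.
- have ib : (i < b c)%N by lia.
  have H0 := H _ ib; have H1 := H _ jb.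
  rewrite !cutM //; congr cut; case: j ij jb {H1} => // j ij jb /=.
  case: i ij ib {H0} => [|i] ij ib /=; last first.
    by rewrite (hs_comm sT) ?lt //; lia.
  by rewrite -(jm_comm_gt q0 sT) ?lt //; lia.
Qed.

Lemma blockT_cyc c : (0 < b c)%N ->
  \prod_(x <- Qs c) (blockT c 0%N ^+ p - kconst eAe (x ^+ p)) = 0.
Proof.
move=> bc; have om : (off b c < n.+1)%N by have := block_lt bc; rewrite addn0.
have oc : letter a (off b c) = c by have := block_letter bc; rewrite addn0.
have oe : e * L (off b c) = L (off b c) * e by rewrite -ewL.
have cutX k : cut (ewid a) (L (off b c)) ^+ k = cut (ewid a) (L (off b c) ^+ k).
  elim: k => [|k IHk]; first by rewrite !expr0 cut1.
  by rewrite !exprS IHk cutM //; apply: commrX.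
have key (r : seq K) : \prod_(x <- r) (blockT c 0%N ^+ p - kconst eAe (x ^+ p)) =
    cut (ewid a) (peval (Lp (off b c)) (\prod_(x <- r) ('X - (x ^+ p)%:P))).
  elim: r => [|x r IHr]; first by rewrite !big_nil rmorph1 cut1.
  rewrite !big_cons IHr rmorphM /= rmorphB /= pevalX pevalC /blockT /blockT0 cutX.
  rewrite -cut_const cutB cutM //.
  by apply: peval_comm; apply: commrX.
rewrite key; apply: val_inj; rewrite /= -mulrA -{2}oc first_occurrence ?mulr0 //.
move=> j jo; rewrite oc; apply/eqP => jc.
have := ab (ltn_trans jo om); rewrite jc /block; lia.
Qed.

Lemma block_hom_ex c : exists f : kalg_hom (hecke p q (Qs c) (b c)) eAe,
  forall i, (i < b c)%N -> f (hT p q (Qs c) (b c) i) = blockT c i.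
Proof. apply: hecke_lift; [exact: blockT_system | exact: blockT_cyc]. Qed.

Definition block_hom c := projT1 (cid (block_hom_ex c)).
Lemma block_homE c i : (i < b c)%N -> block_hom c (hT p q (Qs c) (b c) i) = blockT c i.
Proof. exact: (projT2 (cid (block_hom_ex c))). Qed.

Lemma block_hom_comm c d x y : c != d ->
  block_hom c x * block_hom d y = block_hom d y * block_hom c x.
Proof.
move=> cd; pose S c := fun y => exists2 k, (k < b c)%N & y = blockT c k.
have Sc c' z : in_subalg (S c') (block_hom c' z).
  apply: subalg_hom (hecke_generated z) => _ [k kc ->]; rewrite block_homE //.
  by apply: subalg_gen; exists k.
apply: subalg_comm (Sc c x) => _ [k kc ->]; symmetry.
apply: subalg_comm (Sc d y) => _ [l ld ->].
rewrite !cutM ?blockT0_ew //; congr cut.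
have [lk ll] := (block_lt kc, block_lt ld).
have : (off b c + b c <= off b d)%N \/ (off b d + b d <= off b c)%N.
  have [lt|lt|/val_inj E'] := ltngtP (c : nat) d; [left|right|by rewrite E' eqxx in cd];
    exact: off_lt.
case: k kc lk => [|k] kc lk; case: l ld ll => [|l] ld ll /= H.
- by apply: (jm_comm q0 sT); lia.
- rewrite addnS; apply: (T_comm_jm q0 sT); try lia.
- by rewrite addnS; symmetry; apply: (T_comm_jm q0 sT); try lia.
- by apply: (hecke_far sT); lia.
Qed.

Definition block_map : kalg_hom (hecke_tensor p q Qs b) eAe :=
  tensor_lift block_hom_comm.

Lemma block_mapE c x : block_map (tensor_in (fun c => hecke p q (Qs c) (b c)) c x) =
  block_hom c x.
Proof. exact: tensor_liftE. Qed.

Definition in_block (x : A) := exists z, x = val (block_map z).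

Lemma in_block_ew x : in_block x -> e * x = x /\ x * e = x.
Proof. by case=> z ->; rewrite peirce_l peirce_r. Qed.
Lemma in_blockD x y : in_block x -> in_block y -> in_block (x + y).
Proof. by move=> [z ->] [z' ->]; exists (z + z'); rewrite rmorphD. Qed.
Lemma in_blockN x : in_block x -> in_block (- x).
Proof. by move=> [z ->]; exists (- z); rewrite rmorphN. Qed.
Lemma in_blockM x y : in_block x -> in_block y -> in_block (x * y).
Proof. by move=> [z ->] [z' ->]; exists (z * z'); rewrite rmorphM. Qed.
Lemma in_block_const c : in_block (kconst A c * e).
Proof. by exists (kconst _ c); rewrite kalg_hom_const. Qed.
Lemma in_block1 : in_block e.
Proof. by exists 1; rewrite rmorph1. Qed.
Lemma in_block0 : in_block 0.
Proof. by exists 0; rewrite rmorph0. Qed.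

Lemma in_block_blockT c k : (k < b c)%N -> in_block (blockT0 c k * e).
Proof.
move=> kc; exists (tensor_in (fun c => hecke p q (Qs c) (b c)) c (hT p q (Qs c) (b c) k)).
by rewrite block_mapE block_homE // cut_val // blockT0_ew.
Qed.

(** L_i arises from the first L of its block by a recursion that uses only the T of that block, all
    of which commute with e. *)
Lemma in_block_L i : (i < n.+1)%N -> in_block (L i * e).
Proof.
move=> im; have := ab im; set c := letter a i => /andP[ci ic].
suff H k : (k < b c)%N -> in_block (L (off b c + k) * e).
  by rewrite -(subnKC ci); apply: H; lia.
elim: k => [|k IHk] kc; first by rewrite addn0; apply: (in_block_blockT kc).
have Tb := in_block_blockT kc; have Lb := IHk (ltnW kc).
rewrite addnS jmS -addnS kscaleAl.
have -> : kscale q^-1 (T (off b c + k.+1) * L (off b c + k) * T (off b c + k.+1) * e) =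
    kconst A q^-1 * e * (T (off b c + k.+1) * e) * (L (off b c + k) * e) * (T (off b c + k.+1) * e).
  set t := T _; set l := L _.
  have te : e * t = t * e by apply: block_T_ew.
  have le : e * l = l * e by rewrite -ewL // block_lt // ltnW.
  rewrite /kscale -!mulrA; congr (_ * _).
  rewrite !mulrA te -(mulrA t e e) ewid -(mulrA t e l) le !mulrA.
  by rewrite -(mulrA _ e e) ewid -(mulrA _ e t) te -!mulrA ewid.
by do 3?apply: in_blockM => //; apply: in_block_const.
Qed.

Lemma in_block_T i : (i.+1 < n.+1)%N -> letter a i = letter a i.+1 -> in_block (T i.+1 * e).
Proof.
move=> im ai; have := ab im; have := ab (ltnW im); rewrite -ai.
set c := letter a i => /andP[ci ic] /andP[ci' ic'].
have kc : ((i - off b c).+1 < b c)%N by lia.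
have := in_block_blockT kc; rewrite /= addnS subnKC //.
Qed.

Section Twist.
Variables (zeta : K) (zeta_p : zeta ^+ p = 1) (s : kalg_hom A A).
Hypotheses (s0 : s (T 0%N) = kscale zeta (T 0%N)) (sS : forall i, (i.+1 < n.+1)%N -> s (T i.+1) = T i.+1).

Lemma twist_jm i : (i < n.+1)%N -> s (L i) = kscale zeta (L i).
Proof.
elim: i => [|i IHi] im //; rewrite jmS kalg_hom_scale !rmorphM sS // IHi ?(ltnW im) //.
rewrite kscaleAr kscaleAl /kscale !mulrA; congr (_ * _ * _ * _).
by rewrite -!rmorphM mulrC.
Qed.

Lemma twist_Lp i : (i < n.+1)%N -> s (Lp i) = Lp i.
Proof. by move=> im; rewrite rmorphXn /= twist_jm // kscaleX zeta_p kscale1. Qed.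

Lemma twist_ew a' : s (ew a') = ew a'.
Proof.
by rewrite kalg_hom_prod; apply: eq_bigr => i _; rewrite peval_hom twist_Lp.
Qed.

(** It is enough to compare on generators. The T_0 of a factor goes to a Jucys-Murphy element, and s
    scales every L_i by zeta. *)
Lemma twist_block_map z : s (val (block_map z)) = val (block_map (tensor_sigma q Qs b zeta_p z)).
Proof.
pose tau := tensor_sigma q Qs b zeta_p.
have step (B : kalgebra K) (f : kalg_hom B eAe) (u : kalg_hom B B) (S : B -> Prop) :
    (forall y, S y -> s (val (f y)) = val (f (u y))) ->
    forall y, in_subalg S y -> s (val (f y)) = val (f (u y)).
  move=> Sf y; elim=> {y} [y /Sf //|c|x y _ IHx _ IHy|x y _ IHx _ IHy].
  - by rewrite !kalg_hom_const !peirce_val_const rmorphM kalg_hom_const twist_ew.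
  - by rewrite !(kalg_homB f, kalg_homB u) !peirce_valB kalg_homB IHx IHy.
  - by rewrite !(kalg_homM f, kalg_homM u) !peirce_valM kalg_homM IHx IHy.
apply: (step _ block_map tau _ _ _ (tensor_generated z)) => _ [c [x ->]].
rewrite [tau _]tensor_map_in !block_mapE.
apply: (step _ _ _ _ _ _ (hecke_generated x)) => _ [k kc ->].
have -> : sigma q (Qs c) zeta_p (b c) (hT p q (Qs c) (b c) k) =
    if k == 0%N then kscale zeta (hT p q (Qs c) (b c) k) else hT p q (Qs c) (b c) k.
  by rewrite (hTE _ _ _ (Ordinal kc)) sigmaE.
have kn := block_lt kc.
rewrite block_homE //; case: k kc kn => [|k] kc kn; cbn [eq_op].
  have oe : e * L (off b c) = L (off b c) * e := blockT0_ew kc.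
  have on : (off b c < n.+1)%N by move: kn; rewrite addn0.
  rewrite kalg_hom_scale block_homE // -[blockT c 0]/(cut (ewid a) (L (off b c))).
  rewrite cut_val // kalg_homM twist_ew twist_jm // cut_kscale cut_val ?kscaleAl //.
  by rewrite kscaleAr oe.
rewrite block_homE // cut_val; last exact: blockT0_ew.
by rewrite rmorphM twist_ew /= addnS sS // -addnS.
Qed.

End Twist.
End OneBlockWord.
End BlockMap.

(** * The corner of a block word *)

Section Paths.
Variables (K : closedFieldType) (q : K) (p n kappa : nat).
Variables (Qs : 'I_kappa -> seq K) (E : 'I_kappa -> {poly K}).
Let C c : {poly K} := \prod_(x <- Qs c) ('X - (x ^+ p)%:P).
Variable P : 'I_kappa -> {poly K}.
Hypotheses (q0 : q != 0) (P_sep : separated (q ^+ p) P).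
Hypothesis C_dvd : forall c, exists R, P c = R * C c.
Hypothesis E_prim : primary_family P E.
Variables (A : kalgebra K) (T : nat -> A).
Hypothesis sT : hecke_system q n.+1 T.
Local Notation L := (jm q T).
Hypothesis P_spec : forall i, (i < n.+1)%N -> peval (L i ^+ p) (\prod_c P c) = 0.
Hypothesis T_cyc : peval (T 0%N ^+ p) (\prod_c C c) = 0.
Hypothesis A_gen : forall x : A, in_subalg (fun y => exists2 k, (k < n.+1)%N & y = T k) x.
Local Notation word := (word n kappa).
Local Notation ew := (ew q p E T).
Local Notation psi := (psi q T).
Implicit Types a : word.

Let ewL := L_ew p E q0 sT.
Let ewid := ew_idem q0 E_prim sT P_spec.
Let psi_e := psi_ew q0 P_sep E_prim sT P_spec.

(** At a descent e(a) = h psi e(s_i a) psi, and s_i a has larger weight. *)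
Lemma ew_ideal (S : A -> Prop) :
  (forall b a, is_block_word b a -> b =1 content a -> S (ew a)) ->
  forall a, in_ideal S (ew a).
Proof.
move=> Sb; elim/word_sort_ind => [a nd|a i im d IH].
  by apply/ideal_gen/(Sb (content a)) => //; apply: sorted_block_word.
have ai : letter a i != letter a i.+1.
  by apply: contraTneq d => ai; rewrite /descent ai ltnn.
have [h _ <-] := psi_sq_unit q0 P_sep E_prim sT P_spec im ai.
rewrite -!mulrA psi_e // (mulrA (psi i)) mulrA; apply: ideal_mulr.
by apply: ideal_mull; apply: ideal_mull; apply: IH; apply: weight_sw.
Qed.

Section OneBlock.
Variables (b : 'I_kappa -> nat) (a0 : word).
Hypotheses (b_sum : \sum_c b c = n.+1) (ab : is_block_word b a0).
Local Notation e := (ew a0).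
Local Notation in_block := (in_block q0 P_sep C_dvd E_prim sT P_spec T_cyc b_sum ab).

(* Products of intertwiners sorting a into a0, one descent at a time.  The    *)
(* braid relations make the product independent of the order (upath_uniq);    *)
(* then A e is spanned by the products u * y with y in the block subalgebra.  *)
Inductive upath : word -> A -> Prop :=
| upath0 : upath a0 e
| upath_step a i u of (i.+1 < n.+1)%N & descent a i & upath (sw i a) u : upath a (psi i * u).

Lemma upath_ew a u : upath a u -> ew a * u = u /\ u * e = u.
Proof.
elim=> {a u} [|a i u im _ _ [IH1 IH2]]; first by rewrite ewid.
split; last by rewrite -mulrA IH2.
by rewrite -{2}IH1 [RHS]mulrA psi_e // swK // mulrA.
Qed.

Lemma upath_content a u : upath a u -> content a =1 b.
Proof.
elim=> {a u} [|a i u im _ _ IH] c; first exact: content_block.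
by rewrite -(content_sw a im) IH.
Qed.

Lemma content_sorted a : content a =1 b -> (forall k, (k.+1 < n.+1)%N -> ~~ descent a k) -> a = a0.
Proof.
move=> cb nd; apply: (@block_word_uniq _ _ b) => //.
exact: eq_is_block_word cb (sorted_block_word nd).
Qed.

Lemma upath_ex a : content a =1 b -> exists u, upath a u.
Proof.
elim/word_sort_ind: a => [a nd|a i im d IH] cb.
  by rewrite (content_sorted cb nd); exists e; apply: upath0.
have [|u up] := IH (sw i a) (weight_sw im d); first by move=> c; rewrite content_sw.
by exists (psi i * u); apply: upath_step.
Qed.

Lemma upath_inv a u : upath a u ->
  (a = a0 /\ u = e) \/
  exists i v, [/\ (i.+1 < n.+1)%N, descent a i, upath (sw i a) v & u = psi i * v].
Proof. by case=> [|{}a i v im d up]; [left|right; exists i, v]. Qed.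

Lemma descent_sw i j a : (i.+1 < n.+1)%N -> (j.+1 < n.+1)%N ->
  (i.+1 < j)%N || (j.+1 < i)%N -> descent (sw i a) j = descent a j.
Proof. by move=> im jm ij; rewrite /descent !letter_sw_out //; lia. Qed.

(** A diamond argument. Two different first descents are either far apart, and their intertwiners
    commute, or adjacent; then three letters strictly decrease and both routes meet after three
    exchanges, by the braid relation of intertwiners. *)
Lemma upath_uniq a u u' : upath a u -> upath a u' -> u = u'.
Proof.
elim/word_sort_ind: a u u' => [a nd|a i0 i0m d0 IH] u u'.
  case/upath_inv=> [[_ ->]|[i [v [im d _ _]]]]; last by have := nd _ im; rewrite d.
  case/upath_inv=> [[_ ->] //|[i [v [im d _ _]]]]; last by have := nd _ im; rewrite d.
have na0 : a != a0.
  by apply: contraTneq d0 => ->; apply: block_word_sorted ab i0m.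
case/upath_inv=> [[/eqP]|[k [x [km dk upx ->]]]]; first by rewrite (negPf na0).
case/upath_inv=> [[/eqP]|[l [y [lm dl upy ->]]]]; first by rewrite (negPf na0).
have ca : content a =1 b by move=> c; rewrite -(content_sw a km) (upath_content upx).
suff W i j v v' : (i.+1 < n.+1)%N -> descent a i -> upath (sw i a) v ->
    (j.+1 < n.+1)%N -> descent a j -> upath (sw j a) v' -> (i <= j)%N ->
    psi i * v = psi j * v'.
  by have [kl|/ltnW lk] := leqP k l; [|symmetry]; apply: W.
move=> {k l x y km dk upx lm dl upy} im d up jm d' up' ij.
have wi := weight_sw im d; have wj := weight_sw jm d'.
have [ij'|ij'] := eqVneq i j.
  by rewrite -ij' in up' *; rewrite (IH _ wi _ _ up up').
have [ji|ji] := eqVneq j i.+1; last first.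
  have far : (i.+1 < j)%N || (j.+1 < i)%N by lia.
  have far' : (j.+1 < i)%N || (i.+1 < j)%N by lia.
  have [w wP] : exists w, upath (sw j (sw i a)) w.
    by apply: upath_ex => c; rewrite !content_sw.
  have p1 : upath (sw i a) (psi j * w).
    by apply: upath_step => //; rewrite descent_sw.
  have p2 : upath (sw j a) (psi i * w).
    by apply: upath_step; rewrite ?descent_sw // sw_comm.
  rewrite (IH _ wi _ _ up p1) (IH _ wj _ _ up' p2) !mulrA.
  by rewrite (psi_comm q0 sT).
rewrite {}ji {j ij ij'} in jm d' up' wj *.
have im2 : (i.+2 < n.+1)%N by [].
have l1 : letter (sw i a) i = letter a i.+1 by rewrite letter_sw_l.
have l2 : letter (sw i a) i.+1 = letter a i by rewrite letter_sw_r.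
have l3 : letter (sw i a) i.+2 = letter a i.+2 by rewrite letter_sw_out //; lia.
have l4 : letter (sw i.+1 a) i = letter a i by rewrite letter_sw_out //; lia.
have l5 : letter (sw i.+1 a) i.+1 = letter a i.+2 by rewrite letter_sw_l.
have l6 : letter (sw i.+1 a) i.+2 = letter a i.+1 by rewrite letter_sw_r.
have [w wP] : exists w, upath (sw i (sw i.+1 (sw i a))) w.
  by apply: upath_ex => c; rewrite !content_sw.
rewrite /descent in d d'.
have p1 : upath (sw i a) (psi i.+1 * (psi i * w)).
  apply: upath_step => //; first by rewrite /descent l2 l3; lia.
  have m0 : letter (sw i.+1 (sw i a)) i = letter a i.+1.
    by rewrite letter_sw_out ?l1 //; lia.
  have m1 : letter (sw i.+1 (sw i a)) i.+1 = letter a i.+2 by rewrite letter_sw_l ?l3.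
  by apply: upath_step => //; rewrite /descent m0 m1.
have p2 : upath (sw i.+1 a) (psi i * (psi i.+1 * w)).
  apply: upath_step => //; first by rewrite /descent l4 l5; lia.
  have m1 : letter (sw i (sw i.+1 a)) i.+1 = letter a i by rewrite letter_sw_r ?l4.
  have m2 : letter (sw i (sw i.+1 a)) i.+2 = letter a i.+1.
    by rewrite letter_sw_out ?l6 //; lia.
  by apply: upath_step; [|rewrite /descent m1 m2|rewrite -sw_braid].
rewrite (IH _ wi _ _ up p1) (IH _ wj _ _ up' p2) !mulrA.
by rewrite (psi_braid q0 sT).
Qed.

Lemma upath_L a u k : upath a u -> (k < n.+1)%N -> exists2 y, in_block y & L k * u = u * y.
Proof.
move=> up; elim: up k => {a u} [|a i u im _ _ IH] k km.
  by exists (L k * e); [apply: in_block_L | rewrite mulrA -ewL // -mulrA ewid].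
have [y yb yE] := IH _ (swn_lt im km); exists y => //.
have -> : L k * (psi i * u) = psi i * (L (swn i k) * u).
  by rewrite !mulrA (psi_swn q0 sT) ?swnK // swn_lt.
by rewrite yE mulrA.
Qed.

Lemma upath_subalg a u i x : upath a u -> (i.+1 < n.+1)%N ->
  in_subalg (pairS (L i) (L i.+1)) x -> exists2 y, in_block y & x * u = u * y.
Proof.
move=> up im; have ue := (upath_ew up).2.
elim=> {x} [_ [] ->|c|x y _ [x' xb xE] _ [y' yb yE]|x y _ [x' xb xE] _ [y' yb yE]].
- by apply: upath_L up _; lia.
- exact: upath_L up im.
- exists (kconst A c * e); first exact: in_block_const.
  by rewrite mulrA -(kconstC c u) -mulrA ue.
- exists (x' - y'); last by rewrite mulrBl mulrBr xE yE.
  by apply: in_blockD => //; apply: in_blockN.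
- by exists (x' * y'); [apply: in_blockM | rewrite -mulrA yE mulrA xE mulrA].
Qed.

(** Split off a descent. Its intertwiner commutes with T_{i+1} when far away. When adjacent, the
    third letter must cross both equal letters, so two intertwiners split off and carry T_{i+1} to a
    neighbouring generator ([psi_braid1], [psi_braid2]), again at two equal letters. *)
Lemma upath_T a u i : upath a u -> (i.+1 < n.+1)%N -> letter a i = letter a i.+1 ->
  exists2 y, in_block y & T i.+1 * u = u * y.
Proof.
elim/word_sort_ind: a u i => [a nd|a k km d IH] u i up im ai.
  have aa0 := content_sorted (upath_content up) nd.
  have -> : u = e by apply: upath_uniq upath0; rewrite -aa0.
  rewrite aa0 in ai; exists (T i.+1 * e); first exact: in_block_T.
  by rewrite mulrA -(T_ew q0 P_sep E_prim sT P_spec im ai) -mulrA ewid.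
have ca := upath_content up.
have [v vP] : exists v, upath (sw k a) v by apply: upath_ex => c; rewrite content_sw.
have -> : u = psi k * v by apply: upath_uniq up _; apply: upath_step.
have wk := weight_sw km d; rewrite /descent in d.
have ki : k != i by apply: contraTneq d => ->; rewrite ai ltnn.
have [far|near] := boolP ((k.+1 < i)%N || (i.+1 < k)%N).
  have [|y yb yE] := IH _ wk v i vP im; first by rewrite !letter_sw_out //; lia.
  by exists y => //; rewrite mulrA -(psi_comm_T q0 sT) // -!mulrA yE.
have [ik|ik] := eqVneq k i.+1.
  rewrite {k ki near}ik in km d vP wk *.
  have l0 : letter (sw i.+1 a) i = letter a i by rewrite letter_sw_out //; lia.
  have l1 : letter (sw i.+1 a) i.+1 = letter a i.+2 by rewrite letter_sw_l.
  have l2 : letter (sw i.+1 a) i.+2 = letter a i.+1 by rewrite letter_sw_r.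
  have d' : descent (sw i.+1 a) i by rewrite /descent l0 l1 ai.
  have [w wP] : exists w, upath (sw i (sw i.+1 a)) w.
    by apply: upath_ex => c; rewrite !content_sw.
  have -> : v = psi i * w by apply: upath_uniq vP _; apply: upath_step.
  have [|y yb yE] := IH _ (ltn_trans wk (weight_sw im d')) w i.+1 wP km.
    by rewrite letter_sw_r // l0 (@letter_sw_out _ _ i) ?l2 //; lia.
  exists y => //; rewrite (mulrA (psi i.+1)) mulrA (psi_braid1 q0 sT km) -!mulrA.
  by rewrite yE.
have {ki near ik} ik : i = k.+1 by lia.
rewrite {i}ik in im ai *.
have l0 : letter (sw k a) k = letter a k.+1 by rewrite letter_sw_l.
have l1 : letter (sw k a) k.+1 = letter a k by rewrite letter_sw_r.
have l2 : letter (sw k a) k.+2 = letter a k.+2 by rewrite letter_sw_out //; lia.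
have d' : descent (sw k a) k.+1 by rewrite /descent l1 l2 -ai.
have [w wP] : exists w, upath (sw k.+1 (sw k a)) w.
  by apply: upath_ex => c; rewrite !content_sw.
have -> : v = psi k.+1 * w by apply: upath_uniq vP _; apply: upath_step.
have [|y yb yE] := IH _ (ltn_trans wk (weight_sw im d')) w k wP km.
  by rewrite letter_sw_l // l2 (@letter_sw_out _ _ k.+1) ?l0 ?ai //; lia.
exists y => //; rewrite (mulrA (psi k)) mulrA (psi_braid2 q0 sT im) -!mulrA.
by rewrite yE.
Qed.

Inductive in_span : A -> Prop :=
| span0 : in_span 0
| spanD x y of in_span x & in_span y : in_span (x + y)
| span_u a u y of upath a u & in_block y : in_span (u * y).

Lemma in_block_scale c y : in_block y -> in_block (kconst A c * y).
Proof.
move=> yb; rewrite -[y](in_block_ew yb).1 mulrA.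
by apply: in_blockM => //; apply: in_block_const.
Qed.

Lemma span_scale c x : in_span x -> in_span (kconst A c * x).
Proof.
elim=> {x} [|x y _ IHx _ IHy|a u y up yb].
- by rewrite mulr0; apply: span0.
- by rewrite mulrDr; apply: spanD.
- by rewrite mulrA kconstC -mulrA; apply: span_u up _; apply: in_block_scale.
Qed.

Lemma spanN x : in_span x -> in_span (- x).
Proof. by move=> /(span_scale (-1)); rewrite rmorphN1 mulN1r. Qed.

(** Off a descent psi u is again a sorting path. At a descent the path itself begins with psi, and
    psi^2 is a polynomial in L_i and L_{i+1}, which passes through the rest into the block
    subalgebra. *)
Lemma span_psi a u y i : upath a u -> in_block y -> (i.+1 < n.+1)%N ->
  letter a i != letter a i.+1 -> in_span (psi i * (u * y)).
Proof.
move=> up yb im ai.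
have [d|d] := boolP (descent a i); last first.
  have d' : descent (sw i a) i.
    by move: d ai; rewrite /descent letter_sw_l // letter_sw_r // -val_eqE /=; lia.
  by rewrite mulrA; apply: (@span_u (sw i a)) => //; apply: upath_step; rewrite ?swK.
have ca := upath_content up.
have [v vP] : exists v, upath (sw i a) v by apply: upath_ex => c; rewrite content_sw.
have -> : u = psi i * v by apply: upath_uniq up _; apply: upath_step.
rewrite !mulrA (psi_sq q0 sT im).
have [|y' yb' yE] := @upath_subalg _ _ i (((kconst A (q - 1) + 1) * L i - L i.+1) *
   ((kconst A (q - 1) + 1) * L i.+1 - L i)) vP im.
  have S0 : in_subalg (pairS (L i) (L i.+1)) (L i) by apply: subalg_gen; left.
  have S1 : in_subalg (pairS (L i) (L i.+1)) (L i.+1) by apply: subalg_gen; right.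
  have SC : in_subalg (pairS (L i) (L i.+1)) (kconst A (q - 1) + 1).
    by apply: subalgD; [apply: subalg_const | apply: subalg1].
  by apply: subalg_mul; apply: subalg_sub => //; apply: subalg_mul.
by rewrite yE -mulrA; apply: span_u vP _; apply: in_blockM.
Qed.

(** Between different letters T_{i+1} (Y - X) = h Y - psi with Y - X invertible on e(a), which
    reduces T_{i+1} to psi and Jucys-Murphy elements. *)
Lemma span_T k x : (k < n.+1)%N -> in_span x -> in_span (T k * x).
Proof.
move=> km; elim=> {x} [|x y _ IHx _ IHy|a u y up yb].
- by rewrite mulr0; apply: span0.
- by rewrite mulrDr; apply: spanD.
case: k km => [|i] im.
  have [y' yb' yE] := upath_L up im.
  by rewrite mulrA -[T 0]/(L 0) yE -mulrA; apply: span_u up _; apply: in_blockM.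
have [ai|ai] := eqVneq (letter a i) (letter a i.+1).
  have [y' yb' yE] := upath_T up im ai.
  by rewrite mulrA yE -mulrA; apply: span_u up _; apply: in_blockM.
have [h hS hE] := diff_unit_ew q0 P_sep E_prim sT P_spec im ai (esym (expr0z q)).
rewrite rmorph1 mul1r in hE.
have hc : h * (L i.+1 - L i) = (L i.+1 - L i) * h.
  apply: subalg_comm hS => _ [] ->; rewrite mulrBr mulrBl.
    by rewrite (jm_comm_pair q0 sT im).
  by rewrite (jm_comm_pair q0 sT im).
have hu : u = (L i.+1 - L i) * h * u.
  by rewrite -hc -{2}(upath_ew up).1 mulrA hE (upath_ew up).1.
have [h' hb' h'E] := upath_subalg up im hS.
have [|h2 h2b h2E] := @upath_subalg _ _ i (L i.+1 * h) up im.
  by apply: subalg_mul => //; apply: subalg_gen; right.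
have -> : T i.+1 * (u * y) =
    kconst A (q - 1) * (u * (h2 * y)) - psi i * (u * (h' * y)).
  have TE : T i.+1 * (L i.+1 - L i) = kconst A (q - 1) * L i.+1 - psi i.
    by rewrite -opprB mulrN (psi_diff q0 sT im) opprB.
  transitivity (T i.+1 * (L i.+1 - L i) * (h * u) * y).
    by rewrite {1}hu !mulrA.
  rewrite TE (mulrBl (h * u)) mulrBl; congr (_ - _).
    by rewrite -(mulrA (kconst A (q - 1))) (mulrA (L i.+1) h u) h2E -!mulrA.
  by rewrite h'E !mulrA.
apply: spanD; last by apply: spanN; apply: (span_psi up _ im ai); apply: in_blockM.
by apply: span_scale; apply: span_u up _; apply: in_blockM.
Qed.

Lemma span_all x : in_span (x * e).
Proof.
have : forall z, in_span z -> in_span (x * z).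
  elim: (A_gen x) => {x} [_ [k km ->]|c|x y _ IHx _ IHy|x y _ IHx _ IHy] z zs.
  - exact: span_T.
  - exact: span_scale.
  - by rewrite mulrBl; apply: spanD; [apply: IHx | apply/spanN/IHy].
  - by rewrite -mulrA; apply/IHx/IHy.
apply; rewrite -[e]ewid; apply: span_u upath0 _; exact: in_block1.
Qed.

(** Left multiplication by e keeps, among the spanning products u y, those starting at a0, and there
    u = e. *)
Lemma block_onto x : in_block (e * x * e).
Proof.
rewrite -mulrA; elim: (span_all x) => [|y z _ IHy _ IHz|a u y up yb].
- by rewrite mulr0; apply: in_block0.
- by rewrite mulrDr; apply: in_blockD.
rewrite mulrA -(upath_ew up).1 mulrA (ewM q0 E_prim sT P_spec).
case: eqP => [aa|_]; last by rewrite !mul0r; apply: in_block0.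
have -> : u = e by apply: upath_uniq upath0; rewrite aa.
by rewrite -aa ewid (in_block_ew yb).1.
Qed.

Lemma block_orth x a : (exists c, content a c != b c) -> ew a * x * e = 0.
Proof.
case=> c ac; rewrite -mulrA; elim: (span_all x) => [|y z _ IHy _ IHz|a' u y up yb].
- by rewrite mulr0.
- by rewrite mulrDr IHy IHz addr0.
rewrite mulrA -(upath_ew up).1 mulrA (ewM q0 E_prim sT P_spec).
case: eqP => [aa|_]; last by rewrite !mul0r.
by rewrite aa (upath_content up) eqxx in ac.
Qed.

End OneBlock.
End Paths.

(** * Injectivity of the block map *)

Section Endomorphisms.
Variables (K : fieldType) (V : kalgebra K).

(** V is an algebra rather than a vector space so that left multiplications are available as
    operators ([lmul]). *)
Record endo_type := Endo {
  endo_fun :> V -> V;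
  endo_funD : {morph endo_fun : x y / x + y};
  endo_funZ : forall c x, endo_fun (kconst V c * x) = kconst V c * endo_fun x }.

Lemma endo_ext (f g : endo_type) : f =1 g -> f = g.
Proof.
case: f => f fD fZ; case: g => g gD gZ /= /funext fg.
case: g / fg in gD gZ *.
by congr Endo; apply: Prop_irrelevance.
Qed.

HB.instance Definition _ := gen_eqMixin endo_type.
HB.instance Definition _ := gen_choiceMixin endo_type.

Definition endo_zero : endo_type.
Proof. by exists (fun=> 0) => [x y|c x]; rewrite ?addr0 ?mulr0. Defined.
Definition endo_opp (f : endo_type) : endo_type.
Proof.
exists (fun x => - f x) => [x y|c x]; first by rewrite endo_funD opprD.
by rewrite endo_funZ mulrN.
Defined.
Definition endo_add (f g : endo_type) : endo_type.
Proof.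
exists (fun x => f x + g x) => [x y|c x]; first by rewrite !endo_funD addrACA.
by rewrite !endo_funZ mulrDr.
Defined.
Definition endo_one : endo_type.
Proof. by exists id. Defined.
Definition endo_mul (f g : endo_type) : endo_type.
Proof.
exists (fun x => f (g x)) => [x y|c x]; first by rewrite !endo_funD.
by rewrite !endo_funZ.
Defined.

Fact endo_addA : associative endo_add.
Proof. by move=> x y z; apply: endo_ext => i; apply: addrA. Qed.
Fact endo_addC : commutative endo_add.
Proof. by move=> x y; apply: endo_ext => i; apply: addrC. Qed.
Fact endo_add0 : left_id endo_zero endo_add.
Proof. by move=> x; apply: endo_ext => i; apply: add0r. Qed.
Fact endo_addN : left_inverse endo_zero endo_opp endo_add.
Proof. by move=> x; apply: endo_ext => i; apply: addNr. Qed.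
HB.instance Definition _ :=
  GRing.isZmodule.Build endo_type endo_addA endo_addC endo_add0 endo_addN.

Fact endo_mulA : associative endo_mul.
Proof. by move=> x y z; apply: endo_ext. Qed.
Fact endo_mul1 : left_id endo_one endo_mul.
Proof. by move=> x; apply: endo_ext. Qed.
Fact endo_mulr1 : right_id endo_one endo_mul.
Proof. by move=> x; apply: endo_ext. Qed.
Fact endo_mulDl : left_distributive endo_mul +%R.
Proof. by move=> x y z; apply: endo_ext. Qed.
Fact endo_mulDr : right_distributive endo_mul +%R.
Proof. by move=> x y z; apply: endo_ext => v; apply: endo_funD. Qed.
HB.instance Definition _ := GRing.Zmodule_isPzRing.Build endo_type
  endo_mulA endo_mul1 endo_mulr1 endo_mulDl endo_mulDr.

Definition lmul_fun (x : V) : endo_type.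
Proof.
exists (fun v => x * v) => [v w|c v]; first exact: mulrDr.
by rewrite !mulrA kconstC.
Defined.
Fact lmul_zmod : zmod_morphism lmul_fun.
Proof. by move=> x y; apply: endo_ext => v; apply: mulrBl. Qed.
Fact lmul_monoid : monoid_morphism lmul_fun.
Proof.
split; first by apply: endo_ext => v; apply: mul1r.
by move=> x y; apply: endo_ext => v; rewrite /= -mulrA.
Qed.
HB.instance Definition _ := GRing.isZmodMorphism.Build V endo_type lmul_fun lmul_zmod.
HB.instance Definition _ := GRing.isMonoidMorphism.Build V endo_type lmul_fun lmul_monoid.

Fact endo_constC c (f : endo_type) :
  (lmul_fun \o kconst V) c * f = f * (lmul_fun \o kconst V) c.
Proof. by apply: endo_ext => v /=; rewrite endo_funZ. Qed.
Definition endo_kalg : kalgebra K := KAlgebra endo_constC.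

Fact lmul_const c : lmul_fun (kconst V c) = kconst endo_kalg c. Proof. by []. Qed.
Definition lmul : kalg_hom V endo_kalg := @KalgHom K V endo_kalg lmul_fun lmul_const.

Lemma endo_mulE (f g : endo_kalg) v : (f * g) v = f (g v). Proof. by []. Qed.
Lemma endo_zeroE v : (0 : endo_kalg) v = 0. Proof. by []. Qed.
Lemma endo_fun0 (f : endo_kalg) : f 0 = 0.
Proof. by apply: (addIr (f 0)); rewrite -endo_funD !add0r. Qed.
Lemma endo_funN (f : endo_kalg) v : f (- v) = - f v.
Proof. by apply: (addIr (f v)); rewrite -endo_funD !addNr endo_fun0. Qed.
Lemma endo_funB (f : endo_kalg) v w : f (v - w) = f v - f w.
Proof. by rewrite endo_funD endo_funN. Qed.

End Endomorphisms.

Section Projection.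
Variables (K : fieldType) (I : finType) (A : I -> kalgebra K) (i : I).
Definition prod_proj_fun (x : prod_kalg A) : A i := x i.
Fact prod_proj_zmod : zmod_morphism prod_proj_fun. Proof. by []. Qed.
Fact prod_proj_monoid : monoid_morphism prod_proj_fun. Proof. by []. Qed.
HB.instance Definition _ :=
  GRing.isZmodMorphism.Build (prod_kalg A) (A i) prod_proj_fun prod_proj_zmod.
HB.instance Definition _ :=
  GRing.isMonoidMorphism.Build (prod_kalg A) (A i) prod_proj_fun prod_proj_monoid.
Fact prod_proj_const c : prod_proj_fun (kconst (prod_kalg A) c) = kconst (A i) c.
Proof. by []. Qed.
Definition prod_proj : kalg_hom (prod_kalg A) (A i) :=
  @KalgHom K (prod_kalg A) (A i) prod_proj_fun prod_proj_const.
Lemma prod_projE x : prod_proj x = x i. Proof. by []. Qed.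
End Projection.

Lemma exp_intertwine (R : pzRingType) (y a b : R) m : y * a = b * y -> y * a ^+ m = b ^+ m * y.
Proof.
move=> yab; elim: m => [|m IHm]; first by rewrite !expr0 mulr1 mul1r.
by rewrite !exprS mulrA yab -mulrA IHm mulrA.
Qed.

Lemma hecke_system_hom (K : fieldType) (q : K) (A B : kalgebra K) (f : kalg_hom A B)
    m (T : nat -> A) : hecke_system q m T -> hecke_system q m (fun i => f (T i)).
Proof.
move=> [quad br4 br3 cmm]; split=> [i im|m1|i i0 im|i j ij jm].
- by rewrite -(kalg_hom_const f) -(kalg_hom1 f) -kalg_homD -kalg_homB -kalg_homM quad // kalg_hom0.
- by rewrite -!kalg_homM br4.
- by rewrite -!kalg_homM br3.
- by rewrite -!kalg_homM cmm.
Qed.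

Lemma jm_hom (K : fieldType) (q : K) (A B : kalgebra K) (f : kalg_hom A B) (T : nat -> A) k :
  f (jm q T k) = jm q (fun i => f (T i)) k.
Proof. by elim: k => //= k IHk; rewrite kalg_hom_scale !kalg_homM IHk. Qed.

Lemma eq_jm (K : fieldType) (q : K) (A : kalgebra K) (T T' : nat -> A) k :
  (forall i, (i <= k)%N -> T i = T' i) -> jm q T k = jm q T' k.
Proof.
elim: k => [|k IHk] TT; first exact: TT.
by rewrite /= TT // IHk // => i ik; apply/TT/ltnW.
Qed.

Section DiagonalEntry.
Variables (K : fieldType) (q : K) (B : kalgebra K).

(* For T_{i+1} X_i = X_{i+1} T_{i+1} - h X_{i+1} to hold on a pair of distinct *)
(* letters the diagonal entry of T_{i+1} has to be h Y / (Y - X).             *)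
Definition diag_entry (x y : B) : B := kconst B (q - 1) * y * kinv (y - x).

Variables (x y : B).
Local Notation h := (kconst B (q - 1)).
Hypotheses (xy : x * y = y * x).
Hypothesis d_unit : exists z, z * (y - x) = 1 /\ (y - x) * z = 1.

Lemma kinv_comm (z d : B) : (exists u, u * d = 1 /\ d * u = 1) ->
  z * d = d * z -> z * kinv d = kinv d * z.
Proof.
move=> /kinvP[dl dr] zd.
by rewrite -[LHS]mul1r -dl -!mulrA (mulrA d) -zd -!mulrA dr mulr1.
Qed.

Lemma diag_entry_comm z : z * x = x * z -> z * y = y * z -> z * diag_entry x y = diag_entry x y * z.
Proof.
move=> zx zy; rewrite /diag_entry mulrA (mulrA z) -(kconstC _ z) -(mulrA h) zy !mulrA -!(mulrA (h * y)).
by rewrite kinv_comm // mulrBr mulrBl zx zy.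
Qed.

Lemma diag_entry_mulB : diag_entry x y * (y - x) = h * y.
Proof. by rewrite /diag_entry -mulrA (kinvP d_unit).1 mulr1. Qed.

Lemma d_unitN : exists z, z * (x - y) = 1 /\ (x - y) * z = 1.
Proof.
by case: d_unit => z [zl zr]; exists (- z); rewrite -(opprB y x) !mulrNN.
Qed.

Lemma kinvN : kinv (x - y) = - kinv (y - x).
Proof.
have [dl dr] := kinvP d_unit; have [el er] := kinvP d_unitN.
rewrite -[LHS]mulr1 -dr -(opprB x y) mulrA mulrN el mulN1r.
by rewrite -(opprB y x) opprK.
Qed.

Lemma diag_entry_add : diag_entry x y + diag_entry y x = h.
Proof.
have [dl dr] := kinvP d_unit.
by rewrite /diag_entry kinvN mulrN -mulrBl -mulrBr -mulrA dr mulr1.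
Qed.

End DiagonalEntry.

Lemma diag_entry_comm_gfun (K : fieldType) (q : K) (B : kalgebra K) (x y : B) :
  x * y = y * x -> (exists z, z * (y - x) = 1 /\ (y - x) * z = 1) ->
  diag_entry q x y * diag_entry q y x = diag_entry q y x * diag_entry q x y.
Proof.
move=> xy d_unit; apply: (diag_entry_comm _ (d_unitN d_unit)).
  by symmetry; apply: (diag_entry_comm _ d_unit).
by symmetry; apply: (diag_entry_comm _ d_unit).
Qed.


(** * The representation on functions of words *)

Section Representation.
Variables (K : closedFieldType) (q : K) (p n kappa : nat).
Variables (Qs : 'I_kappa -> seq K).
Let C c : {poly K} := \prod_(x <- Qs c) ('X - (x ^+ p)%:P).
Let P c : {poly K} := iter n.+1 (spread (q ^+ p)) (C c).
Hypotheses (q0 : q != 0) (P_sep : separated (q ^+ p) P).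
Variable b : 'I_kappa -> nat.
Hypothesis b_sum : \sum_c b c = n.+1.

Variables (B : kalgebra K) (ti : 'I_kappa -> nat -> B).
Hypothesis ti_system : forall c, hecke_system q (b c) (ti c).
Hypothesis ti_cyc : forall c, (0 < b c)%N -> peval (ti c 0 ^+ p) (C c) = 0.
Hypothesis ti_comm : forall c d k l, c != d -> ti c k * ti d l = ti d l * ti c k.

Local Notation h := (kconst B (q - 1)).

Definition yi c (k : nat) : B := jm q (ti c) k.

Lemma yi_spec c k : (k < b c)%N -> peval (yi c k ^+ p) (P c) = 0.
Proof.
move=> kc; have bc : (0 < b c)%N by lia.
apply: (jm_spectrum q0 (ti_system c) bc (ti_cyc bc) kc).
by have := off_total b c; rewrite b_sum; lia.
Qed.

Lemma ti_yi_comm c d k l : c != d -> ti c k * yi d l = yi d l * ti c k.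
Proof.
move=> cd; rewrite /yi; elim: l => [|l IHl]; first exact: ti_comm.
by apply: kscale_comm; apply: comm_conj => //; apply: ti_comm.
Qed.

Lemma yi_comm c d k l : (k < b c)%N -> (l < b d)%N -> yi c k * yi d l = yi d l * yi c k.
Proof.
have [<-|cd] := eqVneq c d => kc ld; first exact: (jm_comm q0 (ti_system c)).
symmetry; rewrite [yi c k]/yi; elim: k {kc} => [|k IHk]; first by rewrite ti_yi_comm.
by apply: kscale_comm; apply: comm_conj => //; rewrite ti_yi_comm.
Qed.

(** Provides the denominators of [diag_entry]: the p-th powers of elements of different factors have
    disjoint spectra. *)
Lemma yi_diff_unit c d k l : c != d -> (k < b c)%N -> (l < b d)%N ->
  exists z, z * (yi d l - yi c k) = 1 /\ (yi d l - yi c k) * z = 1.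
Proof.
move=> cd kc ld; have [|||||z zS zE] := @sub_unit_on K B p (yi c k) (yi d l) 1 1 (P c) (P d).
- exact: oner_neq0.
- exact: yi_comm.
- by move=> z; rewrite expr1n mul1r; apply: (separated_neq P_sep).
- by rewrite mulr1 yi_spec.
- by rewrite mulr1 yi_spec.
rewrite rmorph1 mul1r !mulr1 in zE; exists z; split=> //.
rewrite -[RHS]zE; symmetry; apply: subalg_comm zS => _ [] ->.
  by rewrite mulrBr mulrBl yi_comm.
by rewrite mulrBr mulrBl yi_comm.
Qed.

Definition wordb := {a : word n kappa | [forall c, content a c == b c]}.
Implicit Types (w : wordb).

Lemma content_wordb w : content (val w) =1 b.
Proof. by move=> c; apply/eqP; move: c; apply/forallP/(valP w). Qed.

(** [insubd] would return w if the exchange left the words of content b; by [val_swb] this never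
    happens for i in range. *)
Definition swb i w : wordb := insubd w (sw i (val w)).
Lemma val_swb i w : (i.+1 < n.+1)%N -> val (swb i w) = sw i (val w).
Proof.
move=> im; rewrite insubdK //; apply/forallP => c; apply/eqP.
by rewrite content_sw // (content_wordb w).
Qed.

Definition lw w i : 'I_kappa := letter (val w) i.
Definition rep_X i w : B := yi (lw w i) (rank (val w) i).

Lemma rank_b w i : (i < n.+1)%N -> (rank (val w) i < b (lw w i))%N.
Proof. by move=> im; rewrite -(content_wordb w) rank_lt. Qed.

Lemma lw_swb i w k : (i.+1 < n.+1)%N -> (k < n.+1)%N -> lw (swb i w) k = lw w (swn i k).
Proof. by move=> im km; rewrite /lw val_swb // letter_sw. Qed.

Lemma swbK i w : (i.+1 < n.+1)%N -> swb i (swb i w) = w.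
Proof. by move=> im; apply: val_inj; rewrite !val_swb // swK. Qed.

Lemma swb_comm i j w : (i.+1 < n.+1)%N -> (j.+1 < n.+1)%N ->
  (i.+1 < j)%N || (j.+1 < i)%N -> swb i (swb j w) = swb j (swb i w).
Proof. by move=> im jm ij; apply: val_inj; rewrite !val_swb // sw_comm. Qed.

Lemma swb_braid i w : (i.+2 < n.+1)%N ->
  swb i (swb i.+1 (swb i w)) = swb i.+1 (swb i (swb i.+1 w)).
Proof.
move=> im; have im' := ltnW im.
by apply: val_inj; rewrite !val_swb // sw_braid.
Qed.

Lemma swb_id i w : (i.+1 < n.+1)%N -> lw w i = lw w i.+1 -> swb i w = w.
Proof. by move=> im wi; apply: val_inj; rewrite val_swb // sw_id. Qed.

Lemma wordb_ext w u : (forall k, (k < n.+1)%N -> lw w k = lw u k) -> w = u.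
Proof. by move=> E; apply: val_inj; apply: word_ext. Qed.

Lemma rep_X_comm i j w : (i < n.+1)%N -> (j < n.+1)%N -> rep_X i w * rep_X j w = rep_X j w * rep_X i w.
Proof. by move=> im jm; apply: yi_comm; apply: rank_b. Qed.

Lemma rep_X_spec i w : (i < n.+1)%N -> peval (rep_X i w ^+ p) (P (lw w i)) = 0.
Proof. by move=> im; apply/yi_spec/rank_b. Qed.

Lemma rep_X_swb i k w : (i.+1 < n.+1)%N -> (k < n.+1)%N -> lw w i != lw w i.+1 ->
  rep_X k (swb i w) = rep_X (swn i k) w.
Proof.
move=> im km wi; rewrite /rep_X lw_swb // val_swb //; congr yi.
rewrite /swn; case: eqP => [->|/eqP ki]; first by rewrite rank_sw_l.
case: eqP => [->|/eqP ki1]; first by rewrite rank_sw_r.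
by have [k1|k1] := ltnP k i; [rewrite rank_sw_lt | rewrite rank_sw_gt //; lia].
Qed.

Lemma rank_eqb w i : lw w i = lw w i.+1 -> rank (val w) i.+1 = (rank (val w) i).+1.
Proof. exact: rank_succ. Qed.

Definition diag_coef i w : B :=
  if lw w i == lw w i.+1 then ti (lw w i) (rank (val w) i.+1)
  else diag_entry q (rep_X i w) (rep_X i.+1 w).
(** The quadratic relation fixes only the product of the two coefficients between w and s_i w: it is
    q + g g', with g and g' the diagonal entries. The coefficient at a descent is normalized to
    1. *)
Definition swap_coef i w : B :=
  if lw w i == lw w i.+1 then 0 else if (lw w i.+1 < lw w i)%N then 1
  else h + 1 + diag_entry q (rep_X i w) (rep_X i.+1 w) * diag_entry q (rep_X i.+1 w) (rep_X i w).


Lemma rep_X_unit i w : (i.+1 < n.+1)%N -> lw w i != lw w i.+1 ->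
  exists z, z * (rep_X i.+1 w - rep_X i w) = 1 /\ (rep_X i.+1 w - rep_X i w) * z = 1.
Proof. by move=> im wi; apply: yi_diff_unit => //; apply: rank_b => //; lia. Qed.

Local Notation V := (prod_kalg (fun _ : wordb => B)).
Implicit Types v : V.

Definition endo_swap (i : nat) : endo_kalg V.
Proof.
by exists (fun v w => v (swb i w)).
Defined.

Definition rep_T (k : nat) : endo_kalg V :=
  if k is i.+1 then lmul V (diag_coef i : V) + lmul V (swap_coef i : V) * endo_swap i
  else lmul V (rep_X 0 : V).

Lemma TbE i v w : rep_T i.+1 v w = diag_coef i w * v w + swap_coef i w * v (swb i w).
Proof. by []. Qed.

Lemma lmulbE (f : V) v w : lmul V f v w = f w * v w.
Proof. by []. Qed.

Lemma endoV_ext (f g : endo_kalg V) : (forall v w, f v w = g v w) -> f = g.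
Proof.
move=> fg; apply: endo_ext => v; apply: functional_extensionality_dep => w; exact: fg.
Qed.

Lemma endoVD (f g : endo_kalg V) v w : (f + g) v w = f v w + g v w. Proof. by []. Qed.
Lemma endoVN (f : endo_kalg V) v w : (- f) v w = - f v w. Proof. by []. Qed.
Lemma endoVM (f g : endo_kalg V) v w : (f * g) v w = f (g v) w. Proof. by []. Qed.
Lemma endoVc c v w : (kconst (endo_kalg V) c) v w = kconst B c * v w. Proof. by []. Qed.
Lemma endoV1 v w : (1 : endo_kalg V) v w = v w. Proof. by []. Qed.
Definition endoVE := (endoVD, endoVN, endoVM, endoVc, endoV1, TbE, lmulbE).

Lemma swap_coef_comm i w z : (i.+1 < n.+1)%N ->
  z * rep_X i w = rep_X i w * z -> z * rep_X i.+1 w = rep_X i.+1 w * z -> z * swap_coef i w = swap_coef i w * z.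
Proof.
move=> im z1 z2; rewrite /swap_coef; case: eqP => [_|/eqP wi]; first by rewrite mulr0 mul0r.
case: ifP => _; first by rewrite mulr1 mul1r.
have u := rep_X_unit im wi.
apply: commrD; first by apply: commrD; [apply/esym/kconstC | apply: commr1].
by apply: commrM; [apply: (diag_entry_comm _ u) | apply: (diag_entry_comm _ (d_unitN u))].
Qed.

Lemma diag_coef_neq_comm i w z : (i.+1 < n.+1)%N -> lw w i != lw w i.+1 ->
  z * rep_X i w = rep_X i w * z -> z * rep_X i.+1 w = rep_X i.+1 w * z -> z * diag_coef i w = diag_coef i w * z.
Proof.
move=> im wi z1 z2; rewrite /diag_coef (negPf wi).
exact: (diag_entry_comm _ (rep_X_unit im wi)).
Qed.

Lemma rank_inj w i k : k != i -> lw w k = lw w i -> rank (val w) k != rank (val w) i.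
Proof.
move=> ki wki; have [lt|lt|E] := ltngtP k i; last by rewrite E eqxx in ki.
  by have := rank_mono lt wki; lia.
by have := rank_mono lt (esym wki); lia.
Qed.

Lemma diag_coef_Z i k w : (i.+1 < n.+1)%N -> (k < n.+1)%N -> k != i -> k != i.+1 ->
  rep_X k w * diag_coef i w = diag_coef i w * rep_X k w.
Proof.
move=> im km ki ki1; have [wi|wi] := eqVneq (lw w i) (lw w i.+1); last first.
  by apply: diag_coef_neq_comm => //; apply: rep_X_comm => //; lia.
rewrite /diag_coef wi eqxx /rep_X; have [wk|wk] := eqVneq (lw w k) (lw w i.+1); last first.
  by rewrite ti_yi_comm // eq_sym.
rewrite wk rank_eqb //; symmetry; apply: (T_comm_jm q0 (ti_system _)).
- by rewrite -rank_eqb // rank_b.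
- by rewrite -wk rank_b.
- by apply: rank_inj => //; rewrite wk wi.
- by rewrite -rank_eqb //; apply: rank_inj.
Qed.

Lemma rep_T_Z i k : (i.+1 < n.+1)%N -> (k < n.+1)%N -> k != i -> k != i.+1 ->
  rep_T i.+1 * lmul V (rep_X k : V) = lmul V (rep_X k : V) * rep_T i.+1.
Proof.
move=> im km ki ki1; apply: endoV_ext => v w; rewrite !endoVE.
rewrite mulrDr !mulrA diag_coef_Z //; congr (_ + _).
have [wi|wi] := eqVneq (lw w i) (lw w i.+1).
  by rewrite /swap_coef wi eqxx mulr0 !mul0r.
rewrite rep_X_swb // swn_out // swap_coef_comm //; apply: rep_X_comm => //; lia.
Qed.

Lemma rep_T_X i : (i.+1 < n.+1)%N -> rep_T i.+1 * lmul V (rep_X i : V) =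
  lmul V (rep_X i.+1 : V) * rep_T i.+1 - kconst (endo_kalg V) (q - 1) * lmul V (rep_X i.+1 : V).
Proof.
move=> im; have i0m : (i < n.+1)%N by lia.
apply: endoV_ext => v w; rewrite !endoVE mulrDr !mulrA.
have [wi|wi] := eqVneq (lw w i) (lw w i.+1).
  rewrite /swap_coef /diag_coef wi eqxx mulr0 !mul0r !addr0 /rep_X wi rank_eqb // -mulrBl; congr (_ * _).
  have rm : ((rank (val w) i).+1 < b (lw w i.+1))%N by rewrite -rank_eqb // rank_b.
  exact: (T_jm q0 (ti_system _) rm).
have u := rep_X_unit im wi.
rewrite rep_X_swb // swn_l addrAC; congr (_ + _).
  rewrite -mulrBl; congr (_ * _); rewrite /diag_coef (negPf wi).
  set x := rep_X i w; set y := rep_X i.+1 w.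
  have xy : x * y = y * x by apply: rep_X_comm.
  have gy : y * diag_entry q x y = diag_entry q x y * y by apply: (diag_entry_comm _ u).
  by rewrite gy -(diag_entry_mulB q u) -mulrBr opprB addrC subrK.
by congr (_ * _); symmetry; apply: swap_coef_comm => //; apply: rep_X_comm.
Qed.

Lemma swap_coef_swb i w : (i.+1 < n.+1)%N -> lw w i != lw w i.+1 ->
  swap_coef i w * swap_coef i (swb i w) = h + 1 + diag_coef i w * diag_coef i (swb i w).
Proof.
move=> im wi; have i0m : (i < n.+1)%N by lia.
have u := rep_X_unit im wi.
rewrite /swap_coef /diag_coef !lw_swb // swn_l swn_r [lw w i.+1 == _]eq_sym (negPf wi).
rewrite !rep_X_swb // swn_l swn_r; case: ltngtP => [lt|lt|/val_inj E].
- by rewrite mul1r (diag_entry_comm_gfun _ (rep_X_comm _ _ _) u).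
- by rewrite mulr1.
- by rewrite E eqxx in wi.
Qed.

Lemma rep_T_sq i : (i.+1 < n.+1)%N ->
  rep_T i.+1 * rep_T i.+1 = kconst _ (q - 1) * rep_T i.+1 + kconst _ (q - 1) + 1.
Proof.
move=> im; have i0m : (i < n.+1)%N by lia.
apply: endoV_ext => v w; rewrite !endoVE swbK //.
have [wi|wi] := eqVneq (lw w i) (lw w i.+1).
  rewrite /swap_coef /diag_coef wi eqxx !mul0r !addr0.
  have rm : (0 < rank (val w) i.+1 < b (lw w i.+1))%N by rewrite rank_b // rank_eqb.
  by rewrite mulrA (hecke_sq (ti_system _) rm) !mulrDl mul1r !mulrA.
have u := rep_X_unit im wi.
have gg : diag_coef i w + diag_coef i (swb i w) = h.
  rewrite /diag_coef !lw_swb // swn_l swn_r [lw w i.+1 == _]eq_sym (negPf wi) !rep_X_swb // swn_l swn_r.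
  exact: diag_entry_add.
have gk : swap_coef i w * diag_coef i w = diag_coef i w * swap_coef i w.
  by apply: diag_coef_neq_comm => //; symmetry; apply: swap_coef_comm => //; apply: rep_X_comm.
transitivity ((diag_coef i w * diag_coef i w + swap_coef i w * swap_coef i (swb i w)) * v w +
   (diag_coef i w * swap_coef i w + swap_coef i w * diag_coef i (swb i w)) * v (swb i w)); first by ncring.
have -> : diag_coef i (swb i w) = h - diag_coef i w by rewrite -gg addrAC subrr add0r.
rewrite swap_coef_swb //; have -> : diag_coef i (swb i w) = h - diag_coef i w by rewrite -gg addrAC subrr add0r.
have hc (z : B) : z * h = h * z by rewrite kconstC.
rewrite (mulrBr (diag_coef i w)) (mulrBr (swap_coef i w)) gk !hc; ncring.
Qed.

Lemma rep_T_TXT i : (i.+1 < n.+1)%N -> rep_T i.+1 * lmul V (rep_X i : V) * rep_T i.+1 =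
  (kconst (endo_kalg V) (q - 1) + 1) * lmul V (rep_X i.+1 : V).
Proof.
move=> im; rewrite rep_T_X //; set hh := kconst _ _; set Y := lmul V _; set t := rep_T _.
have hc (z : endo_kalg V) : z * hh = hh * z by rewrite kconstC.
transitivity (Y * (t * t) - hh * (Y * t)); first by ncring.
rewrite /t rep_T_sq // -/t -/hh; transitivity (Y * hh * t + Y * hh + Y - hh * (Y * t)).
  by ncring.
by rewrite (hc Y); ncring.
Qed.

(** The relation T X T = q Y is the recursion that defines the Jucys-Murphy elements. *)
Lemma jm_Tb k : (k < n.+1)%N -> jm q rep_T k = lmul V (rep_X k : V).
Proof.
elim: k => // k IHk km; rewrite jmS (IHk (ltnW km)) rep_T_TXT // hecke_h1.
by rewrite /kscale mulrA -rmorphM mulVf // rmorph1 mul1r.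
Qed.

Lemma rep_T_far i j : (i.+1 < n.+1)%N -> (j.+1 < n.+1)%N -> (i.+1 < j)%N ->
  rep_T i.+1 * rep_T j.+1 = rep_T j.+1 * rep_T i.+1.
Proof.
move=> im jm ij.
have i0m : (i < n.+1)%N by lia.
have j0m : (j < n.+1)%N by lia.
have Zc k l w : (k < n.+1)%N -> (l < n.+1)%N -> rep_X k w * rep_X l w = rep_X l w * rep_X k w.
  exact: rep_X_comm.
have D k l w : (k.+1 < n.+1)%N -> (l.+1 < n.+1)%N -> (k.+1 < l)%N || (l.+1 < k)%N ->
    lw w k != lw w k.+1 -> diag_coef l (swb k w) = diag_coef l w /\ swap_coef l (swb k w) = swap_coef l w.
  move=> km lm kl wk.
  have l0 : (l < n.+1)%N by lia.
  rewrite /diag_coef /swap_coef !lw_swb // !rep_X_swb // !swn_out //; try lia.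
  have -> : rank (val (swb k w)) l.+1 = rank (val w) l.+1; last by [].
  rewrite val_swb //; case/orP: kl => kl; first by rewrite rank_sw_gt //; lia.
  by rewrite rank_sw_lt //; lia.
have GZ k l w : (k.+1 < n.+1)%N -> (l.+1 < n.+1)%N -> (k.+1 < l)%N || (l.+1 < k)%N ->
    diag_coef k w * rep_X l w = rep_X l w * diag_coef k w /\ diag_coef k w * rep_X l.+1 w = rep_X l.+1 w * diag_coef k w.
  by move=> km lm kl; split; rewrite diag_coef_Z //; lia.
have GoGd k l w : (k.+1 < n.+1)%N -> (l.+1 < n.+1)%N -> (k.+1 < l)%N || (l.+1 < k)%N ->
    diag_coef k w * swap_coef l w = swap_coef l w * diag_coef k w.
  by move=> km lm kl; have [g1 g2] := GZ k l w km lm kl; apply: swap_coef_comm.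
have GdGd w : diag_coef i w * diag_coef j w = diag_coef j w * diag_coef i w.
  have [wj|wj] := eqVneq (lw w j) (lw w j.+1); last first.
    by have [|g1 g2] := GZ i j w im jm; [lia|apply: diag_coef_neq_comm].
  have [wi|wi] := eqVneq (lw w i) (lw w i.+1); last first.
    by have [|g1 g2] := GZ j i w jm im; [lia|symmetry; apply: diag_coef_neq_comm].
  rewrite /diag_coef wi wj !eqxx.
  have [wij|wij] := eqVneq (lw w i.+1) (lw w j.+1); last exact: ti_comm.
  rewrite -wij; have r1 := @rank_mono _ _ (val w) i.+1 j ij.
  have r2 := @rank_mono _ _ (val w) j j.+1 (ltnSn j) wj.
  apply: (hecke_far (ti_system _)); rewrite ?rank_b // ?wij ?rank_b //.
  by have := r1 (etrans wij (esym wj)); lia.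
have GoGo w : swap_coef i w * swap_coef j w = swap_coef j w * swap_coef i w.
  by apply: swap_coef_comm => //; symmetry; apply: swap_coef_comm => //; apply: Zc => //; lia.
have ij1 : (i.+1 < j)%N || (j.+1 < i)%N by rewrite ij.
have ij2 : (j.+1 < i)%N || (i.+1 < j)%N by rewrite ij orbT.
apply: endoV_ext => v w; rewrite !endoVE.
have [wj|wj] := eqVneq (lw w j) (lw w j.+1).
  have Oj : swap_coef j w = 0 by rewrite /swap_coef wj eqxx.
  have [wi|wi] := eqVneq (lw w i) (lw w i.+1).
    have Oi : swap_coef i w = 0 by rewrite /swap_coef wi eqxx.
    by rewrite Oi Oj !mul0r !addr0 !mulrA GdGd.
  have [d1 d2] := D i j w im jm ij1 wi.
  rewrite d1 d2 Oj !mul0r !addr0 mulrDr !mulrA GdGd; congr (_ + _ * _).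
  by rewrite GoGd.
have [d3 d4] := D j i w jm im ij2 wj.
have [wi|wi] := eqVneq (lw w i) (lw w i.+1).
  have Oi : swap_coef i w = 0 by rewrite /swap_coef wi eqxx.
  by rewrite d3 d4 Oi !mul0r !addr0 mulrDr !mulrA GdGd GoGd.
have [d1 d2] := D i j w im jm ij1 wi.
rewrite d1 d2 d3 d4 swb_comm // !mulrDr !mulrA GdGd GoGd // GoGo (GoGd j i) //.
by rewrite addrACA -!addrA; congr (_ + _); rewrite addrCA.
Qed.

End Representation.

(** The arrangements of three letters form a hexagon of words, with w0 opposite to w. For f
    vanishing at w0 and its two neighbours only walks from w0 to w1, w2 and w contribute. Exchanging
    the indices 1 and 2 gives the other side of the braid relation. *)
Lemma expand_hexagon (W : Type) (R : pzRingType) (G1 O1 G2 O2 f : W -> R)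
    (S1 S2 : W -> W) (w w1 w2 w12 w21 w0 : W) :
  let t1 g u := G1 u * g u + O1 u * g (S1 u) in
  let t2 g u := G2 u * g u + O2 u * g (S2 u) in
  S1 w1 = w -> S2 w21 = w1 -> S1 w0 = w21 -> S2 w0 = w12 -> S1 w12 = w2 -> S1 w21 = w0 ->
  f w0 = 0 -> f w12 = 0 -> f w21 = 0 -> O1 w12 = 1 -> O2 w21 = 1 ->
  t1 (t2 (t1 f)) w0 = G1 w0 * (O2 w0 * f w2) + O1 w0 * (G1 w1 * f w1 + O1 w1 * f w).
Proof.
move=> t1 t2 s1 s2 s3 s4 s5 s6 f0 f12 f21 o12 o21.
rewrite /t1 /t2 s3 s2 s4 s1 s5 s6 f0 f12 f21 o12 o21.
by rewrite !(mulr0, addr0, add0r, mul1r).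
Qed.

Lemma braid4_of_comm (R : pzRingType) (t0 t1 x k : R) : t1 * t0 * t1 = k * x ->
  k * t0 = t0 * k -> x * t0 = t0 * x -> t0 * t1 * t0 * t1 = t1 * t0 * t1 * t0.
Proof.
move=> e kt xt; transitivity (t0 * (t1 * t0 * t1)); first by rewrite !mulrA.
by rewrite e mulrA -kt -mulrA -xt mulrA.
Qed.

(** * The braid relation in the representation *)

Section RepresentationBraid.
Variables (K : closedFieldType) (q : K) (p n kappa : nat).
Variables (Qs : 'I_kappa -> seq K).
Let C c : {poly K} := \prod_(x <- Qs c) ('X - (x ^+ p)%:P).
Let P c : {poly K} := iter n.+1 (spread (q ^+ p)) (C c).
Hypotheses (q0 : q != 0) (P_sep : separated (q ^+ p) P).
Variable b : 'I_kappa -> nat.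
Hypothesis b_sum : \sum_c b c = n.+1.
Variables (B : kalgebra K) (ti : 'I_kappa -> nat -> B).
Hypothesis ti_system : forall c, hecke_system q (b c) (ti c).
Hypothesis ti_cyc : forall c, (0 < b c)%N -> peval (ti c 0 ^+ p) (C c) = 0.
Hypothesis ti_comm : forall c d k l, c != d -> ti c k * ti d l = ti d l * ti c k.
Local Notation h := (kconst B (q - 1)).
Local Notation wordb := (@wordb n kappa b).
Local Notation V := (prod_kalg (fun _ : wordb => B)).
Local Notation rep_T := (@rep_T K q n kappa b B ti).
Local Notation rep_X := (@rep_X K q n kappa b B ti).
Local Notation diag_coef := (@diag_coef K q n kappa b B ti).
Local Notation swap_coef := (@swap_coef K q n kappa b B ti).
Local Notation Zh k := (lmul V (rep_X k : V)).
Implicit Types (w u : wordb) (v : V).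

Lemma swap_supp v w u k : (forall u', u' != w -> v u' = 0) -> lw u k != lw w k -> v u = 0.
Proof. by move=> vw uk; apply: vw; apply: contraNneq uk => ->. Qed.

Section Braid.
Variables (i : nat) (im2 : (i.+2 < n.+1)%N).
Let im : (i.+1 < n.+1)%N. Proof. exact: ltnW. Qed.
Let i0m : (i < n.+1)%N. Proof. exact: ltnW. Qed.
Let t1 := rep_T i.+1.
Let t2 := rep_T i.+2.
Let D := t1 * t2 * t1 - t2 * t1 * t2.
Let hV := hecke_hV (endo_kalg V) q0.
Let hC := @hecke_hC K q (endo_kalg V).
Let TT := rep_T_sq q0 P_sep b_sum ti_system ti_cyc ti_comm im.
Let UU := rep_T_sq q0 P_sep b_sum ti_system ti_cyc ti_comm im2.
Let TXT := rep_T_TXT q0 P_sep b_sum ti_system ti_cyc ti_comm im.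
Let UYU := rep_T_TXT q0 P_sep b_sum ti_system ti_cyc ti_comm im2.

Let TZ : t1 * Zh i.+2 = Zh i.+2 * t1.
Proof. by apply: (rep_T_Z q0 P_sep b_sum ti_system ti_cyc ti_comm); lia. Qed.
Let UX : t2 * Zh i = Zh i * t2.
Proof. by apply: (rep_T_Z q0 P_sep b_sum ti_system ti_cyc ti_comm); lia. Qed.

Let DX : D * Zh i = Zh i.+2 * D.
Proof. exact: (braid_defect_X hC hV TT TXT UU UYU TZ UX). Qed.
Let DY : D * Zh i.+1 = Zh i.+1 * D.
Proof. exact: (braid_defect_Y hC hV TT TXT UU UYU TZ UX). Qed.
Let DZ : D * Zh i.+2 = Zh i * D.
Proof. exact: (braid_defect_Z hC hV TT TXT UU UYU TZ UX). Qed.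
Let DT : D * t1 = (kconst _ (q - 1) - t2) * D.
Proof. exact: (braid_defect_T hC TT UU). Qed.
Let DU : D * t2 = (kconst _ (q - 1) - t1) * D.
Proof. exact: (braid_defect_U hC TT UU). Qed.

Let tau k := if k == i then i.+2 else if k == i.+2 then i else k.

Let D_Z k : (k < n.+1)%N -> D * Zh k = Zh (tau k) * D.
Proof.
move=> km; rewrite /tau; case: eqP => [->|/eqP k0]; first exact: DX.
case: eqP => [->|/eqP k2]; first exact: DZ.
have [->|k1] := eqVneq k i.+1; first exact: DY.
have c1 : Zh k * t1 = t1 * Zh k.
  by symmetry; apply: (rep_T_Z q0 P_sep b_sum ti_system ti_cyc ti_comm); lia.
have c2 : Zh k * t2 = t2 * Zh k.
  by symmetry; apply: (rep_T_Z q0 P_sep b_sum ti_system ti_cyc ti_comm); lia.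
symmetry; apply: commrB; apply: commrM => //; exact: commrM.
Qed.

(* D v = 0 is reduced to vectors v supported on one word w with its letters   *)
(* i, i+1, i+2 weakly increasing: D T_1 = (h - T_2) D allows one to sort w.   *)
(* Then D_Z forces D v to be supported on the word with these letters         *)
(* reversed, where it can be computed.                                        *)
Let good w := forall v, (forall u, u != w -> v u = 0) -> D v = 0.

Let wlift u (x : B) : V := fun u' => if u' == u then x else 0.

Lemma good_step j w : (j == i) || (j == i.+1) -> (lw w j < lw w j.+1)%N -> good w ->
  good (swb j w).
Proof.
move=> ji wj gw v vs.
have jm : (j.+1 < n.+1)%N by case/orP: ji => /eqP ->.
have [d DTj] : exists d, D * rep_T j.+1 = d * D.
  by case/orP: ji => /eqP ->; eexists; [exact: DT | exact: DU].
have wne : swb j w != w.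
  apply: contraTneq wj => E; rewrite -[in X in (X < _)%N]E lw_swb ?swn_l; lia.
(* At the descent s_j w the coefficient is 1, so T_{j+1} applied to the vector moved to w gives back
   v plus a term at w. D kills both vectors at w, and D T_{j+1} = d D. *)
have -> : v = rep_T j.+1 (wlift w (v (swb j w))) - wlift w (diag_coef j w * v (swb j w)).
  apply: functional_extensionality_dep => u.
  rewrite -[RHS]/(rep_T j.+1 (wlift w (v (swb j w))) u - wlift w (diag_coef j w * v (swb j w)) u).
  rewrite TbE /wlift; case: eqP => [->|/eqP uw].
    by rewrite (negPf wne) mulr0 addr0 subrr vs // eq_sym.
  rewrite mulr0 add0r subr0.
  have [E|/eqP E] := altP (swb j u =P w).
    have uE : u = swb j w by rewrite -E swbK.
    rewrite uE; have wj' : lw w j != lw w j.+1 by rewrite -val_eqE /= ltn_eqF.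
    rewrite /swap_coef !lw_swb //; try lia.
    by rewrite swn_l swn_r [lw w j.+1 == _]eq_sym (negPf wj') wj mul1r.
  by rewrite mulr0 vs //; apply: contra_not_neq E => ->; rewrite swbK.
rewrite endo_funB -[D (rep_T _ _)]/((D * rep_T j.+1) _) DTj endo_mulE !gw.
- by rewrite endo_fun0 subr0.
- by move=> u /negPf uw; rewrite /wlift uw.
- by move=> u /negPf uw; rewrite /wlift uw.
Qed.

Lemma D_supp w v u : (forall u', u' != w -> v u' = 0) ->
  u != swb i (swb i.+1 (swb i w)) -> D v u = 0.
Proof.
move=> vs uw.
have [k km kE] : exists2 k, (k < n.+1)%N & lw u (tau k) != lw w k.
  apply: contrapT => H; case/negP: uw; apply/eqP/wordb_ext => k km.
  have taum : (tau k < n.+1)%N by rewrite /tau; do 2?case: eqP; lia.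
  have tauK : tau (tau k) = k by rewrite /tau; do 4?case: eqP; lia.
  have -> : lw (swb i (swb i.+1 (swb i w))) k = lw w (tau k).
    rewrite !lw_swb ?swn_lt // /tau; congr lw.
    have [->|k0] := eqVneq k i; first by rewrite swn_l swn_l swn_out; lia.
    have [->|k1] := eqVneq k i.+1.
      by rewrite ifN ?swn_r ?(@swn_out i.+1 i) ?swn_l //; lia.
    have [->|k2] := eqVneq k i.+2.
      by rewrite (@swn_out i i.+2) ?swn_r //; lia.
    by rewrite (@swn_out i) // swn_out // swn_out.
  apply/eqP/negPn/negP => kE; apply: H; exists (tau k) => //.
  by rewrite tauK.
have taum : (tau k < n.+1)%N by rewrite /tau; do 2?case: eqP; lia.
(* P for the letter of w at k kills v at place k. Moved through D it acts at place tau k, where it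
   is invertible on the word u. *)
pose f j : V := peval ((rep_X j : V) ^+ p) (P (lw w k)).
have fE j u' : f j u' = peval (rep_X j u' ^+ p) (P (lw w k)).
  by rewrite /f -(prod_projE u') peval_hom kalg_homX.
have fv : lmul V (f k) v = 0.
  apply: functional_extensionality_dep => u'; rewrite lmulbE.
  have [->|u'w] := eqVneq u' w; last by rewrite vs // mulr0.
  by rewrite fE (rep_X_spec q0 b_sum ti_system ti_cyc) // mul0r.
have Df : D * lmul V (f k) = lmul V (f (tau k)) * D.
  rewrite /f !peval_hom; apply: peval_intertwine; rewrite !kalg_homX.
  exact/exp_intertwine/D_Z.
have Dvu : f (tau k) u * D v u = 0.
  rewrite -[LHS]/((lmul V (f (tau k)) * D) v u) -Df endo_mulE fv.
  by rewrite endo_fun0.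
have [|d dE] := @peval_unit_on _ _ (rep_X (tau k) u ^+ p) 1 (P (lw u (tau k))) (P (lw w k))
  (fun z => separated_neq P_sep kE (z := z)).
  by rewrite mulr1 (rep_X_spec q0 b_sum ti_system ti_cyc).
rewrite mulr1 -fE in dE.
by rewrite -[LHS]mul1r -dE -mulrA Dvu mulr0.
Qed.

Lemma good_all : (forall w, (lw w i <= lw w i.+1)%N -> (lw w i.+1 <= lw w i.+2)%N -> good w) ->
  forall w, good w.
Proof.
(* 2 a_i + a_{i+1} drops when a descent at i or at i + 1 is exchanged. *)
move=> H w; have [N] := ubnP (2 * lw w i + lw w i.+1).
elim: N w => // N IHN w wN.
have step j : (j == i) || (j == i.+1) -> (lw w j.+1 < lw w j)%N -> good w.
  move=> ji d; have jm : (j.+1 < n.+1)%N by case/orP: ji => /eqP ->.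
  rewrite -[w](swbK _ jm); apply: good_step => //.
    by rewrite !lw_swb ?swn_l ?swn_r //; lia.
  apply: IHN; rewrite !lw_swb //; case/orP: ji d => /eqP -> d.
    by rewrite swn_l swn_r; lia.
  by rewrite swn_l swn_out //; lia.
have [d|nd] := ltnP (lw w i.+1) (lw w i); first by apply: (step i); rewrite ?eqxx.
have [d'|nd'] := ltnP (lw w i.+2) (lw w i.+1); first by apply: (step i.+1); rewrite ?eqxx ?orbT.
exact: H.
Qed.

Lemma good_sorted w : (lw w i <= lw w i.+1)%N -> (lw w i.+1 <= lw w i.+2)%N -> good w.
Proof.
move=> xy yz v vs; apply: functional_extensionality_dep => u.
have [{u}->|uw] := eqVneq u (swb i (swb i.+1 (swb i w))); last exact: D_supp vs uw.
pose w0 := swb i (swb i.+1 (swb i w)); rewrite -/w0.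
have w0E : w0 = swb i.+1 (swb i (swb i.+1 w)) by rewrite /w0 swb_braid.
rewrite -[LHS]/(t1 (t2 (t1 v)) w0 - t2 (t1 (t2 v)) w0).
(* Three equal letters: all exchanges fix w, and the claim is the braid relation inside one
   factor. *)
have [E|ne] := eqVneq (lw w i) (lw w i.+2).
  have xyE : lw w i = lw w i.+1 by apply/val_inj; move: xy yz; rewrite E /=; lia.
  have yzE : lw w i.+1 = lw w i.+2 by rewrite -xyE.
  have s1 : swb i w = w by rewrite swb_id.
  have s2 : swb i.+1 w = w by rewrite swb_id.
  rewrite /w0 s1 s2 s1 !TbE /swap_coef xyE yzE !eqxx !mul0r !addr0 !mulrA -mulrBl.
  have rm : (rank (val w) i.+2 < b (lw w i.+2))%N by rewrite rank_b.
  rewrite /diag_coef xyE yzE !eqxx (rank_succ yzE) in rm *.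
  by rewrite (hs_braid3 (ti_system _)) ?subrr ?mul0r // rank_succ.
have xz : (lw w i < lw w i.+2)%N by move: ne; rewrite -val_eqE /=; lia.
have l1 : lw (swb i w) i = lw w i.+1 by rewrite lw_swb ?swn_l.
have l1' : lw (swb i w) i.+1 = lw w i by rewrite lw_swb ?swn_r.
have l1'' : lw (swb i w) i.+2 = lw w i.+2 by rewrite lw_swb ?swn_out //; lia.
have l2 : lw (swb i.+1 w) i = lw w i by rewrite lw_swb ?swn_out //; lia.
have l2' : lw (swb i.+1 w) i.+1 = lw w i.+2 by rewrite lw_swb ?swn_l.
have l2'' : lw (swb i.+1 w) i.+2 = lw w i.+1 by rewrite lw_swb ?swn_r.
have l21 : lw (swb i.+1 (swb i w)) i = lw w i.+1.
  by rewrite lw_swb ?swn_out //; lia.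
have l21' : lw (swb i.+1 (swb i w)) i.+1 = lw w i.+2 by rewrite lw_swb ?swn_l.
have l21'' : lw (swb i.+1 (swb i w)) i.+2 = lw w i by rewrite lw_swb ?swn_r.
have l12 : lw (swb i (swb i.+1 w)) i = lw w i.+2 by rewrite lw_swb ?swn_l.
have l12' : lw (swb i (swb i.+1 w)) i.+1 = lw w i by rewrite lw_swb ?swn_r.
have l0 : lw w0 i = lw w i.+2 by rewrite lw_swb ?swn_l.
have l0' : lw w0 i.+1 = lw w i.+1 by rewrite lw_swb ?swn_r.
have l0'' : lw w0 i.+2 = lw w i by rewrite lw_swb ?swn_out //; lia.
have nex : lw w i.+2 != lw w i by rewrite eq_sym.
have v0 : v w0 = 0 by apply: (swap_supp (k := i) vs); rewrite l0.
have v12 : v (swb i (swb i.+1 w)) = 0 by apply: (swap_supp (k := i) vs); rewrite l12.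
have v21 : v (swb i.+1 (swb i w)) = 0 by apply: (swap_supp (k := i.+2) vs); rewrite l21''.
have K0 : swb i w0 = swb i.+1 (swb i w) by rewrite /w0 swbK.
have K0' : swb i.+1 w0 = swb i (swb i.+1 w) by rewrite w0E swbK.
have O12 : swap_coef i (swb i (swb i.+1 w)) = 1 by rewrite /swap_coef l12 l12' (negPf nex) xz.
have O21 : swap_coef i.+1 (swb i.+1 (swb i w)) = 1 by rewrite /swap_coef l21' l21'' (negPf nex) xz.
have t1E (g : V) : t1 g = (fun u => diag_coef i u * g u + swap_coef i u * g (swb i u)) by [].
have t2E (g : V) : t2 g = (fun u => diag_coef i.+1 u * g u + swap_coef i.+1 u * g (swb i.+1 u)) by [].
have E1 := expand_hexagon (diag_coef i) (diag_coef i.+1) (swbK w im) (swbK (swb i w) im2)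
  K0 K0' (swbK (swb i.+1 w) im) (erefl w0) v0 v12 v21 O12 O21.
have E2 := expand_hexagon (diag_coef i.+1) (diag_coef i) (swbK w im2) (swbK (swb i.+1 w) im)
  K0' K0 (swbK (swb i w) im2) (esym w0E) v0 v21 v12 O21 O12.
rewrite t1E t2E t1E; rewrite t2E t1E t2E.
rewrite E1 E2; apply/eqP; rewrite subr_eq0; apply/eqP.
(* Two equal letters: one term survives on each side, and the diagonal coefficients are the same
   generator of a factor because the ranks agree. *)
have [xyE|xyN] := eqVneq (lw w i) (lw w i.+1).
  have s1 : swb i w = w by rewrite swb_id.
  have zy : lw w i.+2 != lw w i.+1 by rewrite -xyE.
  have Ow : swap_coef i w = 0 by rewrite /swap_coef xyE eqxx.
  have O1 : swap_coef i w0 = 1.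
    by rewrite /swap_coef l0 l0' (negPf zy); move: xz; rewrite xyE => ->.
  have O2 : swap_coef i.+1 w0 = 0 by rewrite /swap_coef l0' l0'' xyE eqxx.
  rewrite s1 O1 O2 Ow !mul0r mulr0 add0r !mul1r !addr0; congr (_ * _).
  rewrite /diag_coef l0' l0'' xyE !eqxx; congr ti.
  by rewrite /w0 s1 !val_swb // rank_sw_gt // rank_sw_r // eq_sym.
have v1 : v (swb i w) = 0 by apply: (swap_supp (k := i) vs); rewrite l1 eq_sym.
have xyl : (lw w i < lw w i.+1)%N by move: xyN; rewrite -val_eqE /=; lia.
have O2 : swap_coef i.+1 w0 = 1 by rewrite /swap_coef l0' l0'' eq_sym (negPf xyN) xyl.
have [yzE|yzN] := eqVneq (lw w i.+1) (lw w i.+2).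
  have s2 : swb i.+1 w = w by rewrite swb_id.
  have O1 : swap_coef i w0 = 0 by rewrite /swap_coef l0 l0' yzE eqxx.
  have Ow : swap_coef i.+1 w = 0 by rewrite /swap_coef yzE eqxx.
  rewrite s2 O1 O2 Ow v1 !mul0r !mulr0 !mul1r !addr0 add0r; congr (_ * _).
  rewrite /diag_coef l0 l0' yzE !eqxx; congr ti.
  rewrite w0E s2 !val_swb // rank_sw_l; first by rewrite rank_sw_gt.
    by [].
  by rewrite -/(letter _ _) -(val_swb _ im) -/(lw _ _) -/(lw _ _) l1' l1''.
have v2 : v (swb i.+1 w) = 0.
  by apply: (swap_supp (k := i.+1) vs); rewrite l2' eq_sym.
have yzl : (lw w i.+1 < lw w i.+2)%N by move: yzN; rewrite -val_eqE /=; lia.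
have O1 : swap_coef i w0 = 1 by rewrite /swap_coef l0 l0' eq_sym (negPf yzN) yzl.
have Os1 : swap_coef i (swb i w) = 1 by rewrite /swap_coef l1 l1' eq_sym (negPf xyN) xyl.
have Os2 : swap_coef i.+1 (swb i.+1 w) = 1 by rewrite /swap_coef l2' l2'' eq_sym (negPf yzN) yzl.
by rewrite v1 v2 O1 O2 Os1 Os2 !mulr0 !mul1r.
Qed.

Lemma rep_T_braid : t1 * t2 * t1 = t2 * t1 * t2.
Proof.
have gd := good_all good_sorted.
apply/eqP; rewrite -subr_eq0; apply/eqP; apply: endo_ext => v.
rewrite endo_zeroE -/D.
have -> : v = \sum_w wlift w (v w).
  apply: functional_extensionality_dep => u.
  rewrite -(prod_projE u (\sum_w _)) rmorph_sum (bigD1 u) //= big1 ?addr0.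
    by rewrite /wlift /= prod_projE eqxx.
  by move=> w wu; rewrite prod_projE /wlift eq_sym (negPf wu).
elim: (index_enum _) => [|w r IHr]; first by rewrite big_nil endo_fun0.
rewrite big_cons endo_funD IHr addr0; apply: (gd w) => u /negPf uw.
by rewrite /wlift uw.
Qed.

End Braid.

Lemma rep_T_system : hecke_system q n.+1 rep_T.
Proof.
split=> [i /andP[i0 im]|n1|i i0 im|i j ij jm].
- case: i i0 im => // i _ im; have := rep_T_sq q0 P_sep b_sum ti_system ti_cyc ti_comm im.
  set t := rep_T _ => tt.
  have -> : kconst (endo_kalg V) q = kconst (endo_kalg V) (q - 1) + 1 by rewrite hecke_h1.
  set hh := kconst _ _ in tt *.
  transitivity (t * t - t * hh - hh - 1); first by ncring.
  rewrite tt -kconstC -/hh; ncring.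
- have e1 := rep_T_TXT q0 P_sep b_sum ti_system ti_cyc ti_comm n1.
  have c1 : lmul V (rep_X 1 : V) * rep_T 0 = rep_T 0 * lmul V (rep_X 1 : V).
    rewrite -[rep_T 0]/(lmul V (rep_X 0 : V)) -!kalg_homM; congr (lmul V _).
    apply: functional_extensionality_dep => w.
    exact: (rep_X_comm q0 ti_system ti_comm).
  apply: (braid4_of_comm e1 _ c1).
  by rewrite hecke_h1; apply: kconstC.
- case: i i0 im => // i _ im; exact: rep_T_braid.
- case: j ij jm => // j ij jm; case: i ij => [|i] ij.
    symmetry; apply: (rep_T_Z q0 P_sep b_sum ti_system ti_cyc ti_comm); lia.
  by apply: (rep_T_far q0 P_sep b_sum ti_system ti_cyc ti_comm); lia.
Qed.

End RepresentationBraid.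

Definition cyc_poly (K : fieldType) (p : nat) (X : seq K) : {poly K} :=
  \prod_(x <- X) ('X - (x ^+ p)%:P).

Lemma hecke_cyc_poly (K : fieldType) (p : nat) (q : K) (X : seq K) m : (0 < m)%N ->
  peval (hT p q X m 0%N ^+ p) (cyc_poly p X) = 0.
Proof.
move=> m0; rewrite rmorph_prod /= -[RHS](hecke_cyclotomicT p q X m0).
by apply: eq_bigr => x _; rewrite rmorphB /= pevalX pevalC.
Qed.

(** * Faithfulness at the block word *)

Section Injectivity.
Variables (K : closedFieldType) (q : K) (p n kappa : nat) (Qs : 'I_kappa -> seq K).
Let C c : {poly K} := cyc_poly p (Qs c).
Let P c : {poly K} := iter n.+1 (spread (q ^+ p)) (C c).
Hypotheses (q0 : q != 0) (P_sep : separated (q ^+ p) P).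
Variable E : 'I_kappa -> {poly K}.
Hypothesis E_prim : primary_family P E.
Variable Q : seq K.
Hypothesis Q_split : Q = \big[cat/[::]]_(c < kappa) Qs c.

Local Notation A := (hecke p q Q n.+1).
Local Notation T := (hT p q Q n.+1).

Lemma cyc_poly_split : cyc_poly p Q = \prod_c C c.
Proof.
rewrite Q_split; elim: (index_enum _) => [|c r IHr].
  by rewrite !big_nil /cyc_poly big_nil.
by rewrite !big_cons -IHr /C /cyc_poly big_cat.
Qed.

Lemma C_dvd c : exists R, P c = R * C c.
Proof. exact: (@iter_spread_dvd _ _ (C c) 0). Qed.

Lemma T_cyc : peval (T 0%N ^+ p) (\prod_c C c) = 0.
Proof. by rewrite -cyc_poly_split hecke_cyc_poly. Qed.

Let sT : hecke_system q n.+1 T := hecke_systemT _ _ _ _.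

Lemma P_spec i : (i < n.+1)%N -> peval (jm q T i ^+ p) (\prod_c P c) = 0.
Proof.
by move=> im; rewrite -iter_spread_prod; apply: (jm_spectrum q0 sT _ T_cyc im); rewrite // ltnW.
Qed.

(** When one P_c alone kills x, the idempotents become 0 and 1. This applies to the values of
    [rep_X] at each word. *)
Lemma E_val (B : kalgebra K) (x : B) c d : peval x (P c) = 0 ->
  peval x (E d) = if d == c then 1 else 0.
Proof.
move=> xP; have [PE EE ES] : [/\ forall c, peval x (P c) * peval x (E c) = 0,
    forall c d, c != d -> peval x (E c) * peval x (E d) = 0 & \sum_c peval x (E c) = 1].
  by apply: E_prim; rewrite (bigD1 c) //= rmorphM /= xP mul0r.
have E0 e : e != c -> peval x (E e) = 0.
  rewrite eq_sym => ce; have [|u uE] := @peval_unit_on _ _ x 1 (P c) (P e) (fun z => separated_neq P_sep ce (z := z)).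
    by rewrite mulr1.
  by rewrite -[LHS]mul1r -uE mulr1 -mulrA PE mulr0.
case: eqP => [->|/eqP]; last exact: E0.
by rewrite -ES (bigD1 c) //= big1 ?addr0.
Qed.

Section OneBlockWord.
Variables (b : 'I_kappa -> nat) (a : word n kappa).
Hypotheses (b_sum : \sum_c b c = n.+1) (ab : is_block_word b a).

Local Notation B := (hecke_tensor p q Qs b).
Local Notation V := (prod_kalg (fun _ : @wordb n kappa b => B)).

Definition tens_T c (k : nat) : B :=
  tensor_in (fun c => hecke p q (Qs c) (b c)) c (hT p q (Qs c) (b c) k).

Lemma tens_T_system c : hecke_system q (b c) (tens_T c).
Proof. exact: hecke_system_hom (hecke_systemT _ _ _ _). Qed.

Lemma tens_T_cyc c : (0 < b c)%N -> peval (tens_T c 0 ^+ p) (C c) = 0.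
Proof. by move=> bc; rewrite -kalg_homX -peval_hom hecke_cyc_poly // kalg_hom0. Qed.

Lemma tens_T_comm c d k l : c != d -> tens_T c k * tens_T d l = tens_T d l * tens_T c k.
Proof. exact: tensor_in_comm. Qed.

Local Notation rep_T := (@rep_T K q n kappa b B tens_T).
Local Notation rep_X := (@rep_X K q n kappa b B tens_T).

Lemma rep_hom_ex : exists f : kalg_hom A (endo_kalg V),
  forall k, (k < n.+1)%N -> f (T k) = rep_T k.
Proof.
apply: hecke_lift.
  exact: (rep_T_system q0 P_sep b_sum tens_T_system tens_T_cyc tens_T_comm).
move=> _; transitivity (lmul V (peval ((rep_X 0 : V) ^+ p) (cyc_poly p Q))).
  rewrite peval_hom kalg_homX rmorph_prod; apply: eq_bigr => x _.
  by rewrite rmorphB /= pevalX pevalC.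
suff -> : peval ((rep_X 0 : V) ^+ p) (cyc_poly p Q) = 0 by rewrite kalg_hom0.
apply: functional_extensionality_dep => w.
rewrite -(prod_projE w) peval_hom kalg_homX prod_projE cyc_poly_split.
(* The first letter has rank 0, so [rep_X 0] is the T_0 of a factor and satisfies that factor's
   relation. *)
have r0 : rank (val w) 0 = 0%N by rewrite /rank big_ord0.
have bw : (0 < b (lw w 0))%N by have := rank_b w (ltn0Sn n); rewrite r0.
rewrite /rep_X r0 (bigD1 (lw w 0)) //= rmorphM /= [peval _ (C _)]tens_T_cyc //.
by rewrite mul0r.
Qed.

Definition rep_hom := projT1 (cid rep_hom_ex).
Lemma rep_homE k : (k < n.+1)%N -> rep_hom (T k) = rep_T k.
Proof. exact: (projT2 (cid rep_hom_ex)). Qed.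

Lemma rep_jm k : (k < n.+1)%N -> rep_hom (jm q T k) = lmul V (rep_X k : V).
Proof.
move=> km; rewrite -(jm_Tb q0 P_sep b_sum tens_T_system tens_T_cyc tens_T_comm km) jm_hom.
by apply: eq_jm => i ik; rewrite rep_homE // (leq_trans _ km).
Qed.

Fact block_wordb_subproof : [forall c, content a c == b c].
Proof. by apply/forallP => c; rewrite (content_block b_sum ab). Qed.
Definition block_wordb : @wordb n kappa b :=
  exist (fun a => is_true [forall c, content a c == b c]) a block_wordb_subproof.

Lemma rep_ew v : rep_hom (ew q p E T a) v block_wordb = v block_wordb.
Proof.
rewrite kalg_hom_prod; pose f i : V := peval ((rep_X i : V) ^+ p) (E (letter a i)).
have fE (i : 'I_n.+1) : rep_hom (eps_at q p E T (a i) i) = lmul V (f i).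
  rewrite [LHS]peval_hom [LHS]/(peval (rep_hom (jm q T i ^+ p)) _) kalg_homX rep_jm //.
  by rewrite /f peval_hom kalg_homX letter_ord.
rewrite (eq_bigr (fun i : 'I_n.+1 => lmul V (f i))) // -kalg_hom_prod lmulbE.
rewrite -(prod_projE block_wordb) rmorph_prod /= big1 ?mul1r // => i _.
rewrite prod_projE /f -(prod_projE block_wordb) peval_hom kalg_homX prod_projE.
rewrite (@E_val _ _ (letter a i)) ?eqxx //.
exact: (rep_X_spec q0 b_sum tens_T_system tens_T_cyc block_wordb).
Qed.

Local Notation bmap :=
  (block_map q0 P_sep C_dvd E_prim sT P_spec T_cyc b_sum ab).

(** Checked on generators: at a block word, ranks number the places of each block, so the operators
    of block c act at a by the generators of the factor c. *)
Lemma rep_block_map z v : rep_hom (val (bmap z)) v block_wordb = z * v block_wordb.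
Proof.
have step (D : kalgebra K) (f : kalg_hom D B) (S : D -> Prop) :
    (forall y, S y -> forall v, rep_hom (val (bmap (f y))) v block_wordb = f y * v block_wordb) ->
    forall y, in_subalg S y ->
    forall v, rep_hom (val (bmap (f y))) v block_wordb = f y * v block_wordb.
  move=> Sf y; elim=> {y} [y /Sf //|c|x y _ IHx _ IHy|x y _ IHx _ IHy] v'.
  - rewrite !kalg_hom_const peirce_val_const kalg_homM kalg_hom_const.
    by rewrite endoVM endoVc rep_ew.
  - rewrite (kalg_homB f) (kalg_homB bmap) peirce_valB kalg_homB endoVD endoVN IHx IHy.
    by rewrite mulrBl.
  - rewrite (kalg_homM f) (kalg_homM bmap) peirce_valM kalg_homM endoVM IHx IHy.
    by rewrite mulrA.
move: v; apply: (step _ (kalg_id B) _ _ _ (tensor_generated z)) => _ [c [x ->]].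
apply: (step _ (tensor_in (fun c => hecke p q (Qs c) (b c)) c) _ _ _ (hecke_generated x)).
move=> _ [k kc ->] v; rewrite block_mapE block_homE // cut_val; last exact:
  (blockT0_ew q0 P_sep E_prim sT P_spec b_sum ab kc).
have kn : (off b c + k < n.+1)%N by have := off_total b c; rewrite b_sum; lia.
have rk : rank a (off b c + k) = k by apply: rank_block.
have lk : letter a (off b c + k) = c by apply: (block_word_letter ab kn); rewrite /block; lia.
rewrite kalg_homM endoVM; case: k kc kn rk lk => [|k] kc kn rk lk.
  rewrite addn0 in kn rk lk.
  rewrite [blockT0 _ _ _ _ _]/(jm q T (off b c)) rep_jm // lmulbE rep_ew.
  by rewrite /rep_X [rank _ _]rk [lw _ _]lk.
rewrite addnS in kn rk lk; rewrite blockT0S addnS rep_homE // TbE.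
have lk' : letter a (off b c + k) = c by apply: (block_word_letter ab); rewrite /block; lia.
have eqw : lw block_wordb (off b c + k) == lw block_wordb (off b c + k).+1.
  by rewrite /lw /= lk lk'.
rewrite /swap_coef eqw mul0r addr0 /diag_coef eqw rep_ew.
by rewrite [rank _ _]rk [lw _ _]lk'.
Qed.

(** The constant function 1 recovers z as the value at a. *)
Lemma block_map_inj z z' : bmap z = bmap z' -> z = z'.
Proof.
move=> zz; have := rep_block_map z 1; rewrite zz rep_block_map.
by rewrite -[(1 : V) block_wordb]/(1 : B) !mulr1 => ->.
Qed.

End OneBlockWord.
End Injectivity.

Lemma crossed_mulE (K : fieldType) (G : finZmodType) (A : kalgebra K)
    (act : kalg_action G A) (f h : crossed act) k :
  (f * h) k = \sum_g f g * act g (h (k - g)).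
Proof. by rewrite [LHS]ffunE. Qed.

Lemma crossed_addE (K : fieldType) (G : finZmodType) (A : kalgebra K)
    (act : kalg_action G A) (f h : crossed act) k : (f + h) k = f k + h k.
Proof. by rewrite [LHS]ffunE. Qed.

Lemma crossed_sumE (K : fieldType) (G : finZmodType) (A : kalgebra K)
    (act : kalg_action G A) I (r : seq I) (F : I -> crossed act) k :
  (\sum_(i <- r) F i) k = \sum_(i <- r) F i k.
Proof.
elim: r => [|i r IHr]; first by rewrite !big_nil ffunE.
by rewrite !big_cons crossed_addE IHr.
Qed.

(** * Fixed points of a cyclic group *)

Section FixedCorner.
Variables (K : fieldType) (A : kalgebra K) (p : nat).
Hypothesis p_gt1 : (1 < p)%N.
Variables (s : kalg_hom A A) (sp : forall x, iter p s x = x).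
Variables (S : A -> Prop) (zeta : K) (t t' : A).
Hypotheses (zeta_prim : p.-primitive_root zeta).
Hypotheses (t'K : t' * t = 1) (tK : t * t' = 1) (st : s t = kscale zeta t).
Hypothesis sS : forall x, S x -> s x = x.
Hypothesis t_conj : forall x, S x -> in_subalg S (t' * x * t).
Hypothesis t_pow : in_subalg S (t ^+ p).
Hypothesis A_gen : forall x, in_subalg (fun y => y = t \/ in_subalg S y) x.

Local Notation act := (cyclic_action p_gt1 sp).
Local Notation C := (crossed act).
Local Notation r := (kconst A p%:R^-1).

Lemma cyclic_actE (g : 'Z_p) x : act g x = iter g s x.
Proof. exact: kalg_iterE. Qed.

Lemma fixed_subalg x : in_subalg S x -> s x = x.
Proof.
elim=> {x} [x /sS //|c|x y _ sx _ sy|x y _ sx _ sy].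
- exact: kalg_hom_const.
- by rewrite kalg_homB sx sy.
- by rewrite kalg_homM sx sy.
Qed.

Lemma act_fixed (g : 'Z_p) x : in_subalg S x -> act g x = x.
Proof.
by rewrite cyclic_actE => xS; elim: (nat_of_ord g) => //= k ->; apply: fixed_subalg.
Qed.

Lemma conj_subalg x : in_subalg S x -> in_subalg S (t' * x * t).
Proof.
elim=> {x} [x /t_conj //|c|x y _ xS _ yS|x y _ xS _ yS].
- by rewrite -kconstC -mulrA t'K mulr1; apply: subalg_const.
- by rewrite mulrBr mulrBl; apply: subalg_sub.
- have -> : t' * (x * y) * t = t' * x * t * (t' * y * t).
    by rewrite !mulrA -(mulrA (t' * x) t t') tK mulr1.
  exact: subalg_mul.
Qed.

Inductive in_tspan : A -> Prop :=
| tspan0 : in_tspan 0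
| tspanB x y of in_tspan x & in_tspan y : in_tspan (x - y)
| tspan_t k h of in_subalg S h : in_tspan (t ^+ k * h).

Lemma in_tspan_all x : in_tspan x.
Proof.
have : forall z, in_tspan z -> in_tspan (z * x).
  have mulS z h : in_subalg S h -> in_tspan z -> in_tspan (z * h).
    move=> hS; elim=> {z} [|z w _ zt _ wt|k l lS].
    - by rewrite mul0r; apply: tspan0.
    - by rewrite mulrBl; apply: tspanB.
    - by rewrite -mulrA; apply/tspan_t/subalg_mul.
  elim: (A_gen x) => {x} [y [->|hS]|c|x y _ IHx _ IHy|x y _ IHx _ IHy] z zt.
  - elim: zt => {z} [|z w _ zt _ wt|k l lS].
    + by rewrite mul0r; apply: tspan0.
    + by rewrite mulrBl; apply: tspanB.
    + have -> : t ^+ k * l * t = t ^+ k.+1 * (t' * l * t).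
        by rewrite exprSr !mulrA -(mulrA (t ^+ k) t t') tK mulr1.
      exact/tspan_t/conj_subalg.
  - exact: mulS.
  - by apply: mulS => //; apply: subalg_const.
  - by rewrite mulrBr; apply: tspanB; [apply: IHx|apply: IHy].
  - by rewrite mulrA; apply/IHy/IHx.
move/(_ 1); rewrite mul1r; apply.
by rewrite -[1]mulr1 -(expr0 t); apply/tspan_t/subalg1.
Qed.

Lemma zp_card : #|'Z_p| = p.
Proof. by rewrite card_ord Zp_cast. Qed.

Lemma sum_zp (x : A) : \sum_(g : 'Z_p) x = kconst A p%:R * x.
Proof. by rewrite sumr_const zp_card rmorph_nat mulr_natl. Qed.

Lemma p_unit : p%:R != 0 :> K.
Proof. exact: prim_root_natf_neq0 zeta_prim. Qed.

Lemma s_pow k : s (t ^+ k) = kscale (zeta ^+ k) (t ^+ k).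
Proof. by rewrite kalg_homX st kscaleX. Qed.

Definition trace (x : A) : A := \sum_(g : 'Z_p) act g x.

Lemma traceB x y : trace (x - y) = trace x - trace y.
Proof. by rewrite /trace -sumrB; apply: eq_bigr => g _; rewrite kalg_homB. Qed.

Lemma trace_s x : trace (s x) = trace x.
Proof.
rewrite [RHS](reindex_inj (addIr 1)); apply: eq_bigr => g _.
by rewrite kactD; congr (act g _).
Qed.

Lemma trace_fixed x : in_subalg S x -> trace x = kconst A p%:R * x.
Proof.
move=> xS; rewrite /trace (eq_bigr (fun=> x)) => [|g _]; last exact: act_fixed.
exact: sum_zp.
Qed.

(** s acts on t^k h by zeta^k. If zeta^k = 1, then p divides k and the trace is p t^k h, in the
    subalgebra. Otherwise (zeta^k - 1) times the trace is 0. *)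
Lemma trace_in x : in_subalg S (trace x).
Proof.
elim: (in_tspan_all x) => {x} [|x y _ xS _ yS|k h hS].
- rewrite /trace big1 => [|g _]; first exact: subalg0.
  by rewrite kalg_hom0.
- by rewrite traceB; apply: subalg_sub.
have [|zk] := eqVneq (zeta ^+ k) 1.
  move/eqP; rewrite -(prim_order_dvd zeta_prim) => /dvdnP[m ->].
  have thS : in_subalg S (t ^+ (m * p) * h).
    apply: subalg_mul => //; rewrite mulnC exprM.
    elim: m => [|m IHm]; first exact: subalg1.
    by rewrite exprS; apply: subalg_mul.
  by rewrite trace_fixed //; apply: subalg_mul => //; apply: subalg_const.
suff -> : trace (t ^+ k * h) = 0 by apply: subalg0.
have E : kconst A (zeta ^+ k - 1) * trace (t ^+ k * h) = 0.
  rewrite rmorphB rmorph1 mulrBl mul1r -[X in _ - X]trace_s kalg_homM s_pow.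
  rewrite fixed_subalg // kscaleAl /trace mulr_sumr -sumrB big1 // => g _.
  by rewrite kalg_hom_scale subrr.
have -> : trace (t ^+ k * h) =
    kconst A (zeta ^+ k - 1)^-1 * (kconst A (zeta ^+ k - 1) * trace (t ^+ k * h)).
  by rewrite mulrA -rmorphM mulVf ?subr_eq0 // rmorph1 mul1r.
by rewrite E mulr0.
Qed.

Definition fixed_map (h : subalg S) : C := [ffun=> r * val h].
Definition fixed_idem : C := [ffun=> r].

Lemma rp x : kconst A p%:R * (r * x) = x.
Proof. by rewrite mulrA -rmorphM divff ?p_unit // rmorph1 mul1r. Qed.

Local Notation single a g := (crossed_single a g : C).

Lemma fixed_corner : full_corner C (subalg S).
Proof.
have vS (h : subalg S) : in_subalg S (val h) by apply/asboolP/(valP h).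
have rS : in_subalg S r by apply: subalg_const.
apply: (@FullCorner K C (subalg S) fixed_idem fixed_map).
- by move=> x y; apply/ffunP => g; rewrite [RHS]ffunE !ffunE -mulrDr.
- move=> x y; apply/ffunP => k; rewrite crossed_mulE ffunE.
  rewrite (eq_bigr (fun=> r * (r * val (x * y)))).
    by rewrite sum_zp rp.
  move=> g _; rewrite !ffunE act_fixed; last exact: subalg_mul.
  by rewrite -mulrA (mulrA (val x)) -kconstC -(mulrA r (val x)).
- move=> c; apply/ffunP => k.
  by rewrite [RHS]crossed_single_mull !ffunE act_fixed // kconstC.
- move=> x y /ffunP/(_ 0); rewrite !ffunE => E; apply: val_inj.
  by rewrite -[LHS]rp E rp.
(* All coefficients of e x e are equal, namely to p^-2 times the sum of the g(x(u)) over g and u. *)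
- move=> x; pose z := r * trace (\sum_g x g).
  have zS : in_subalg S z by apply: subalg_mul => //; apply: trace_in.
  have zS' : subalg_pred S z by apply/asboolP.
  exists (exist (fun x => subalg_pred S x) z zS'); apply/ffunP => k.
  rewrite crossed_mulE ffunE /=.
  transitivity (\sum_u r * (r * \sum_g act g (x (u - g)))).
    rewrite -!mulr_sumr exchange_big; congr (r * (r * _)).
    apply: eq_bigr => g _; rewrite rmorph_sum.
    rewrite (reindex_inj (addIr (- g))) //=.
  apply: eq_bigr => u _; rewrite crossed_mulE !ffunE act_fixed // -kconstC.
  by congr (r * _); rewrite mulr_sumr; apply: eq_bigr => g _; rewrite ffunE.
(* The coefficient at g of the sum of the t^-k e t^k is p^-1 times the sum of zeta^(g k), which is 1
   for g = 0 and 0 otherwise. *)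
have -> : 1 = \sum_(k < p) single (t' ^+ k) 0 * fixed_idem *
    single (t ^+ k) 0.
  apply/ffunP => g; rewrite crossed_sumE.
  have E (k : 'I_p) : (single (t' ^+ k) 0 * fixed_idem *
      single (t ^+ k) 0) g = r * kconst A ((zeta ^+ g) ^+ k).
    rewrite [LHS]crossed_single_mulr [X in X * _]crossed_single_mull ffunE.
    rewrite (act_fixed _ rS) kalg_homX cyclic_actE.
    have -> : iter g s t = kscale (zeta ^+ g) t.
      elim: (nat_of_ord g) => [|i IHi] /=; first by rewrite kscale1.
      by rewrite IHi kalg_hom_scale st /kscale mulrA -rmorphM exprSr.
    have tt : t' ^+ k * t ^+ k = 1.
      by rewrite -exprMn_comm ?t'K ?expr1n // /GRing.comm tK t'K.
    rewrite kscaleX kscaleAr /kscale [RHS]kconstC; congr (_ * _).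
    by rewrite -kconstC -mulrA tt mulr1.
  rewrite (eq_bigr _ (fun k _ => E k)) -mulr_sumr -rmorph_sum.
  have z1 : zeta ^+ g == 1 -> g = 0.
    rewrite -(prim_order_dvd zeta_prim) => /dvdnP[m gm]; apply: val_inj => /=.
    have := ltn_ord g; rewrite [X in (_ < X)%N](Zp_cast p_gt1) gm.
    by case: m {gm} => // m; rewrite mulSn ltnNge leq_addr.
  rewrite [LHS]ffunE; case: eqP => [->|/eqP g0].
    rewrite (eq_bigr (fun=> 1)) => [|k _]; last by rewrite expr0 expr1n.
    by rewrite sumr_const card_ord -rmorphM mulVf ?p_unit // rmorph1.
  suff -> : \sum_(k < p) (zeta ^+ g) ^+ k = 0 by rewrite rmorph0 mulr0.
  have g1 : zeta ^+ g - 1 != 0 by rewrite subr_eq0; apply: contraNneq g0 => /eqP/z1 ->.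
  apply: (mulfI g1); rewrite mulr0 -subrX1 -exprM mulnC exprM.
  by rewrite (prim_expr_order zeta_prim) expr1n subrr.
elim/big_ind: _ => [|x y xI yI|k _]; first exact: ideal_zero.
  by rewrite -[y]opprK -[- y]add0r; apply: ideal_sub xI _; apply: ideal_sub yI; apply: ideal_zero.
exact/ideal_mulr/ideal_mull/ideal_gen.
Qed.

End FixedCorner.

(** * Direct sums of crossed products *)

Section SumCorner.
Variables (K : fieldType) (G : finZmodType) (A : kalgebra K) (act : kalg_action G A).
Variables (I : finType) (B : I -> kalgebra K) (actB : forall i, kalg_action G (B i)).
Variables (e : I -> A) (f : forall i, B i -> A).
Hypothesis e_idem : forall i, e i * e i = e i.
Hypothesis e_orth : forall i j x, i != j -> e i * x * e j = 0.
Hypothesis e_fixed : forall g i, act g (e i) = e i.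
Hypothesis e_full : in_ideal (fun x => exists i, x = e i) (1 : A).
Hypothesis fD : forall i, {morph @f i : x y / x + y}.
Hypothesis fM : forall i, {morph @f i : x y / x * y}.
Hypothesis fC : forall i c, f (kconst (B i) c) = kconst A c * e i.
Hypothesis f_inj : forall i, injective (@f i).
Hypothesis f_onto : forall i x, exists z, @f i z = e i * x * e i.
Hypothesis f_act : forall i g z, act g (@f i z) = f (actB i g z).

Local Notation C := (crossed act).
Local Notation S := (prod_kalg (fun i => crossed (actB i))).

Let f_e i z : e i * @f i z * e i = f z.
Proof.
have e1 : e i = @f i 1 by rewrite -(rmorph1 (kconst (B i))) fC rmorph1 mul1r.
by rewrite e1 -!fM mulr1 mul1r.
Qed.

Let f0 i : @f i 0 = 0.
Proof. by apply: (addIr (@f i 0)); rewrite -fD !add0r. Qed.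

Let f_sum i J (r : seq J) (F : J -> B i) : f (\sum_(j <- r) F j) = \sum_(j <- r) f (F j).
Proof. exact: (big_morph _ (@fD i) (f0 i)). Qed.

Let ee0 i j : i != j -> e i * e j = 0.
Proof. by move=> ij; rewrite -(mulr1 (e i)) e_orth. Qed.

Let f_orth i j x y : i != j -> @f i x * @f j y = 0.
Proof.
move=> ij; rewrite -(f_e x) -(f_e y) -!mulrA (mulrA (e i) (e j)) ee0 //.
by rewrite !mul0r !mulr0.
Qed.

Let e_cut i j x : e i * (\sum_k @f k (x k)) * e j = if i == j then f (x j) else 0.
Proof.
case: eqP => [->|/eqP ij]; last exact: e_orth.
rewrite mulr_sumr mulr_suml (bigD1 j) //= f_e big1 ?addr0 // => k kj.
by rewrite -f_e !mulrA ee0 ?mul0r // eq_sym.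
Qed.

Definition sum_map (F : S) : C := [ffun g => \sum_i f (F i g)].
Definition sum_idem : C := crossed_single (\sum_i e i) 0.

(** As e_i A e_j = 0 for distinct i and j and each e_i is fixed by G, the corner cut out by the sum
    of the e_i splits into the crossed products of the e_i A e_i. *)
Lemma sum_corner : full_corner C S.
Proof.
have e_mul i : e i * \sum_j e j = e i.
  rewrite mulr_sumr (bigD1 i) //= e_idem big1 ?addr0 // => j ji.
  by rewrite ee0 // eq_sym.
apply: (@FullCorner K C S sum_idem sum_map).
- move=> F H; apply/ffunP => g; rewrite [RHS]ffunE !ffunE -big_split.
  by apply: eq_bigr => i _ /=; rewrite -fD; congr f; rewrite [LHS]ffunE.
- move=> F H; apply/ffunP => k; rewrite crossed_mulE ffunE.
  transitivity (\sum_i \sum_g @f i (F i g) * f (actB i g (H i (k - g)))).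
    apply: eq_bigr => i _; rewrite -[(F * H) i]/(F i * H i) crossed_mulE f_sum.
    by apply: eq_bigr => g _; rewrite fM.
  rewrite exchange_big; apply: eq_bigr => g _; rewrite !ffunE rmorph_sum mulr_suml.
  apply: eq_bigr => i _; rewrite mulr_sumr (bigD1 i) //= f_act big1 ?addr0 // => j ji.
  by rewrite f_act f_orth // eq_sym.
- move=> c; apply/ffunP => g; rewrite [RHS]crossed_single_mull ffunE.
  rewrite kact0 subr0 ffunE.
  rewrite (eq_bigr (fun i => if g == 0 then kconst A c * e i else 0)); last first.
    by move=> i _; rewrite ffunE; case: eqP => _; rewrite ?fC ?f0.
  by case: eqP => _; [rewrite mulr_sumr | rewrite big1 ?mulr0].
- move=> F H /ffunP FH; apply: functional_extensionality_dep => i.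
  apply/ffunP => g; apply: f_inj.
  have := e_cut i i (fun k => F k g); have := e_cut i i (fun k => H k g); rewrite eqxx => <- <-.
  by have := FH g; rewrite !ffunE => ->.
- move=> x; have [z zE] : exists z : forall i, G -> B i,
      forall i g, f (z i g) = e i * x g * e i.
    have H i : exists z : G -> B i, forall g, f (z g) = e i * x g * e i.
      exists (fun g => projT1 (cid (f_onto i (x g)))) => g.
      exact: (projT2 (cid (f_onto i (x g)))).
    by exists (fun i => projT1 (cid (H i))) => i; exact: (projT2 (cid (H i))).
  exists (fun i => [ffun g => z i g]); apply/ffunP => g.
  rewrite [RHS]crossed_single_mulr [X in X * _]crossed_single_mull kact0 subr0 ffunE.
  rewrite rmorph_sum mulr_suml mulr_suml; apply: eq_bigr => i _; rewrite ffunE zE.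
  rewrite mulr_sumr (bigD1 i) //= e_fixed big1 ?addr0 // => j ji.
  by rewrite e_fixed e_orth // eq_sym.
have step x : in_ideal (fun x => exists i, x = e i) x ->
    in_ideal (fun y : C => y = sum_idem) (crossed_single x 0).
  elim=> {x} [x [i ->]||x y _ IHx _ IHy|a x _ IHx|a x _ IHx].
  - have -> : crossed_single (e i) 0 = (crossed_single (e i) 0 : C) * sum_idem.
      by rewrite crossed_singleM kact0 addr0 e_mul.
    exact/ideal_mull/ideal_gen.
  - have -> : crossed_single 0 0 = 0 :> C by apply/ffunP => g; rewrite !ffunE if_same.
    exact: ideal_zero.
  - have -> : crossed_single (x - y) 0 = (crossed_single x 0 : C) - crossed_single y 0.
      by apply/ffunP => g; rewrite !ffunE; case: eqP; rewrite ?subr0.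
    exact: ideal_sub.
  - have -> : crossed_single (a * x) 0 = (crossed_single a 0 : C) * crossed_single x 0.
      by rewrite crossed_singleM kact0 addr0.
    exact: ideal_mull.
  - have -> : crossed_single (x * a) 0 = (crossed_single x 0 : C) * crossed_single a 0.
      by rewrite crossed_singleM kact0 addr0.
    exact: ideal_mulr.
exact: step e_full.
Qed.

End SumCorner.

(** * The two corners *)

Section SubalgebraCorner.
Variables (K : fieldType) (A : kalgebra K) (p : nat) (q eps : K) (m : nat).
Variables (T : nat -> A) (t' : A) (s : kalg_hom A A) (S : A -> Prop).
Hypotheses (p_gt1 : (1 < p)%N) (eps_prim : p.-primitive_root eps) (q0 : q != 0).
Hypotheses (sT : hecke_system q m.+1 T) (t'K : t' * T 0%N = 1) (tK : T 0%N * t' = 1).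
Hypothesis s_order : forall x, iter p s x = x.
Hypothesis sE : forall k, (k < m.+1)%N -> s (T k) = if k == 0%N then kscale eps (T k) else T k.
Hypothesis SE : forall x, S x <->
  [\/ x = T 0%N ^+ p, (1 < m.+1)%N /\ x = t' * T 1%N * T 0%N
    | exists2 k, (0 < k < m.+1)%N & x = T k].
Hypothesis T_gen : forall x, in_subalg (fun y => exists2 k, (k < m.+1)%N & y = T k) x.

Let S0p : S (T 0%N ^+ p). Proof. by apply/SE; constructor 1. Qed.
Let SU : (1 < m.+1)%N -> S (t' * T 1%N * T 0%N).
Proof. by move=> m1; apply/SE; constructor 2. Qed.
Let ST k : (0 < k < m.+1)%N -> S (T k).
Proof. by move=> km; apply/SE; constructor 3; exists k. Qed.

Let sS x : S x -> s x = x.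
Proof.
case/SE=> [->|[m1 ->]|[[|k] // km ->]].
- by rewrite kalg_homX sE // kscaleX (prim_expr_order eps_prim) kscale1.
- rewrite !kalg_homM !sE //= kscaleAr -!kscaleAl.
  (* s scales T_0 by eps, hence its inverse by eps^-1. *)
  suff -> : kscale eps (s t') = t' by [].
  rewrite -[LHS]mulr1 -tK mulrA kscaleAl -kscaleAr -[kscale eps _](sE (ltn0Sn m)).
  by rewrite -kalg_homM t'K kalg_hom1 mul1r.
- by rewrite sE.
Qed.

(* With U = T_0^-1 T_1 T_0, the braid relation gives                          *)
(* T_0^-1 U T_0 = U T_1 U^-1.                                                 *)
Let conj_S x : S x -> in_subalg S (t' * x * T 0%N).
Proof.
case/SE=> [->|[m1 ->]|[k /andP[k0 km] ->]].
- by rewrite -mulrA -exprSr exprS mulrA t'K mul1r; apply: subalg_gen.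
- set t := T 0%N; set u := T 1%N; pose U := t' * u * t.
  have US : in_subalg S U by apply/subalg_gen/SU.
  have uS : in_subalg S u by apply/subalg_gen/ST.
  pose h := kconst A (q - 1); pose u' := kconst A q^-1 * (u - h).
  have cancel_t y z : y * t * (t' * z) = y * z by rewrite -mulrA (mulrA t) tK mul1r.
  have U'S : in_subalg S (t' * u' * t).
    have -> : t' * u' * t = kconst A q^-1 * (U - h).
      rewrite /u' mulrA -kconstC -!mulrA; congr (_ * _).
      by rewrite mulrBl mulrBr mulrA (kconstC _ t) mulrA t'K mul1r.
    apply: subalg_mul; first exact: subalg_const.
    by apply: subalg_sub => //; apply: subalg_const.
  have uu' : u * u' = 1.
    rewrite /u' mulrA -kconstC -mulrA mulrBr (hecke_sq sT) // (kconstC _ u).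
    by rewrite -(addrA (u * _)) [u * _ + _]addrC addrK (hecke_hV _ q0).
  have UU' : U * (t' * u' * t) = 1.
    by rewrite /U -(mulrA t' u') cancel_t -mulrA (mulrA u) uu' mul1r t'K.
  have UtU : t' * U * t * U = U * u.
    rewrite /U -(mulrA t' u t) cancel_t -!mulrA.
    rewrite !(mulrA u) (mulrA (u * t)) -(hs_braid4 sT m1) -/t -/u.
    by rewrite -!mulrA (mulrA t' t) t'K mul1r.
  have -> : t' * U * t = U * u * (t' * u' * t) by rewrite -UtU -(mulrA (t' * U * t)) UU' mulr1.
  exact: subalg_mul (subalg_mul US uS) U'S.
- case: k k0 km => [|[|k]] // _ km; first exact/subalg_gen/SU.
  have -> : t' * T k.+2 * T 0%N = T k.+2.
    by rewrite -mulrA -(hs_comm sT) // mulrA t'K mul1r.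
  exact/subalg_gen/ST.
Qed.

Lemma cyclic_subalg_corner : full_corner (crossed (cyclic_action p_gt1 s_order)) (subalg S).
Proof.
apply: (fixed_corner p_gt1 s_order eps_prim t'K tK) => //; first exact: sE.
  exact: subalg_gen.
move=> x; apply: subalg_trans (T_gen x) => _ [k km ->]; apply: subalg_gen.
case: k km => [|k] km; first by left.
by right; apply/subalg_gen/ST.
Qed.

End SubalgebraCorner.

Section RpnCorner.
Variables (K : fieldType) (p : nat) (q eps : K) (Q : seq K) (m : nat).
Hypotheses (p_gt1 : (1 < p)%N) (eps_prim : p.-primitive_root eps).
Hypotheses (q0 : q != 0) (Q0 : forall x, x \in Q -> x != 0).
Let eps_p := prim_expr_order eps_prim.

Local Notation A := (hecke p q Q m.+1).
Local Notation T := (hT p q Q m.+1).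

Lemma sigma_hT k : (k < m.+1)%N ->
  sigma q Q eps_p m.+1 (T k) = if k == 0%N then kscale eps (T k) else T k.
Proof. by move=> km; rewrite (hTE _ _ _ (Ordinal km)) sigmaE. Qed.

Lemma hecke_rpn_genE (x : A) : hecke_rpn_gen x <->
  [\/ x = T 0%N ^+ p, (1 < m.+1)%N /\ x = kinv (T 0%N) * T 1%N * T 0%N
    | exists2 k, (0 < k < m.+1)%N & x = T k].
Proof.
split; first case=> [i i0|i j i0 j1|j j0]; rewrite -?hTE ?i0 ?j1.
- by constructor 1.
- by constructor 2; split; rewrite // -j1.
- by constructor 3; exists j; rewrite // j0 /=.
case=> [->|[m1 ->]|[k /andP[k0 km] ->]].
- by rewrite (hTE _ _ _ (@ord0 m)); apply: rpn_T0p.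
- rewrite (hTE _ _ _ (@ord0 m)) (hTE _ _ _ (Ordinal m1)).
  exact: rpn_T0T1T0.
- by rewrite (hTE _ _ _ (Ordinal km)); apply: rpn_T.
Qed.

Lemma rpn_corner :
  full_corner (crossed (cyclic_action p_gt1 (@sigma_order K p q Q eps eps_p m.+1)))
    (hecke_rpn p q Q m.+1).
Proof.
have [t'K tK] := @heckeT0_inv K p q Q m.+1 ord0 (ltnW p_gt1) Q0 erefl.
rewrite -!hTE in t'K tK.
apply: (@cyclic_subalg_corner _ _ _ q _ _ T _ _ _ p_gt1 eps_prim q0 _ t'K tK).
- exact: hecke_systemT.
- exact: sigma_hT.
- exact: hecke_rpn_genE.
- exact: hecke_generated.
Qed.

End RpnCorner.

(** * From orbits to separated spectra, and the conclusion *)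

Lemma root_cyc_poly (K : fieldType) p (X : seq K) z : root (cyc_poly p X) z ->
  exists2 x, x \in X & z = x ^+ p.
Proof.
rewrite /cyc_poly -(big_map (fun x => x ^+ p) predT (fun y => 'X - y%:P)).
by rewrite root_prod_XsubC => /mapP.
Qed.

(** A coincidence of roots up to a power of q^p reads x^p = (q^m y)^p. Then x and q^m y differ by a
    power of eps, so x and y are in one orbit. *)
Lemma cyc_poly_separated (K : fieldType) p (eps q : K) kappa (Qs : 'I_kappa -> seq K) n :
  p.-primitive_root eps -> q != 0 -> (forall c x, x \in Qs c -> x != 0) ->
  (forall a b x y, x \in Qs a -> y \in Qs b -> same_orbit eps q x y -> a = b) ->
  separated (q ^+ p) (fun c => iter n (spread (q ^+ p)) (cyc_poly p (Qs c))).
Proof.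
move=> eps_prim q0 Q0 orb a b z i ab ra rb.
have c0 : q ^+ p != 0 by rewrite expf_neq0.
have [j /root_cyc_poly[x xa xE]] := root_iter_spread c0 ra.
have [k /root_cyc_poly[y yb yE]] := root_iter_spread c0 rb.
apply: ab; apply: (orb _ _ x y xa yb).
pose w := q ^ (j - k - i) * y.
have w0 : w != 0 by rewrite mulf_neq0 ?expfz_neq0 // (Q0 b).
have wx : (x / w) ^+ p = 1.
  have wp : w ^+ p = x ^+ p.
    have -> : w ^+ p = (q ^+ p) ^ (j - k - i) * y ^+ p.
      by rewrite exprMn; congr (_ * _); rewrite !exprnP !exprz_exp mulrC.
    by rewrite -yE -xE !mulrA -!expfzDr // addrAC !subrK.
  by rewrite expr_div_n wp divff // expf_neq0 // (Q0 a).
have [l lE] := prim_rootP eps_prim wx.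
exists (l : nat), (j - k - i).
by rewrite -mulrA -/w -exprnP -lE divfK.
Qed.

Section BlockSumCorner.
Variables (K : closedFieldType) (q : K) (p n kappa : nat).
Variables (Qs : 'I_kappa -> seq K) (E : 'I_kappa -> {poly K}).
Let C c : {poly K} := \prod_(x <- Qs c) ('X - (x ^+ p)%:P).
Variable P : 'I_kappa -> {poly K}.
Hypotheses (q0 : q != 0) (P_sep : separated (q ^+ p) P).
Hypothesis C_dvd : forall c, exists R, P c = R * C c.
Hypothesis E_prim : primary_family P E.
Variables (A : kalgebra K) (T : nat -> A).
Hypothesis sT : hecke_system q n.+1 T.
Hypothesis P_spec : forall i, (i < n.+1)%N -> peval (jm q T i ^+ p) (\prod_c P c) = 0.
Hypothesis T_cyc : peval (T 0%N ^+ p) (\prod_c C c) = 0.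
Hypothesis A_gen : forall x, in_subalg (fun y => exists2 k, (k < n.+1)%N & y = T k) x.
Hypothesis block_inj : forall b a (b_sum : \sum_c b c = n.+1) (ab : is_block_word b a),
  injective (block_map q0 P_sep C_dvd E_prim sT P_spec T_cyc b_sum ab).
Variables (zeta : K) (zeta_p : zeta ^+ p = 1) (s : kalg_hom A A).
Hypotheses (p_gt1 : (1 < p)%N) (s_order : forall x, iter p s x = x).
Hypothesis s0 : s (T 0%N) = kscale zeta (T 0%N).
Hypothesis sS : forall i, (i.+1 < n.+1)%N -> s (T i.+1) = T i.+1.

Local Notation I := (composition kappa n.+1).
Implicit Type b : I.

Let cnt b : 'I_kappa -> nat := fun c => val b c.
Let cnt_sum b : \sum_c cnt b c = n.+1. Proof. exact/eqP/(valP b). Qed.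
Let bw b : word n kappa := projT1 (cid (block_word_ex (cnt_sum b))).
Let bwP b : is_block_word (cnt b) (bw b).
Proof. exact: (projT2 (cid (block_word_ex (cnt_sum b)))). Qed.
Let e b : A := ew q p E T (bw b).
Let bmap b := block_map q0 P_sep C_dvd E_prim sT P_spec T_cyc (cnt_sum b) (@bwP b).
Let f b (z : hecke_tensor p q Qs (cnt b)) : A := val (bmap b z).

Let e_orth b b' x : b != b' -> e b * x * e b' = 0.
Proof.
move=> bb'; apply: (block_orth q0 P_sep C_dvd E_prim sT P_spec T_cyc A_gen (cnt_sum b') (@bwP b')).
apply: contrapT => H; case/eqP: bb'; apply/val_inj/ffunP => c; apply/val_inj.
apply: contrapT => /eqP bc; apply: H; exists c.
by rewrite (content_block (cnt_sum b) (@bwP b)).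
Qed.

Let e_full : in_ideal (fun x => exists b, x = e b) (1 : A).
Proof.
rewrite -(ew_sum E_prim P_spec); elim/big_ind: _ => [|x y xI yI|a _].
- exact: ideal_zero.
- rewrite -[y]opprK -[- y]add0r; apply: ideal_sub xI _.
  by apply: ideal_sub yI; apply: ideal_zero.
apply: (ew_ideal q0 P_sep E_prim sT P_spec) => {a} b' a aa' ca.
have lt c : (content a c < n.+2)%N.
  by rewrite ltnS -(content_sum a) (bigD1 c) //= leq_addr.
have sum_b : (\sum_c [ffun c => Ordinal (lt c)] c == n.+1)%N.
  by rewrite -[X in _ == X](content_sum a); apply/eqP/eq_bigr => c _; rewrite ffunE.
exists (exist (fun b : {ffun 'I_kappa -> 'I_n.+2} => is_true (\sum_c b c == n.+1)%N) _ sum_b).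
rewrite /e; congr ew; apply: (block_word_uniq aa'); apply: eq_is_block_word (@bwP _) => c.
by rewrite /cnt /= ffunE /= ca.
Qed.

Lemma block_sum_corner :
  full_corner (crossed (cyclic_action p_gt1 s_order)) (hecke_sum q Qs n.+1 p_gt1 zeta_p).
Proof.
apply: (@sum_corner _ _ _ _ _ _ _ e f).
- by move=> b; apply: (ew_idem q0 E_prim sT P_spec).
- exact: e_orth.
- move=> g b; rewrite cyclic_actE; elim: (nat_of_ord g) => //= k ->.
  exact: (twist_ew q E zeta_p s0 sS).
- exact: e_full.
- by move=> b x y; rewrite /f kalg_homD peirce_valD.
- by move=> b x y; rewrite /f kalg_homM peirce_valM.
- by move=> b c; rewrite /f kalg_hom_const peirce_val_const.
- by move=> b x y /val_inj/block_inj.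
- move=> b x.
  have [z zE] := block_onto q0 P_sep C_dvd E_prim sT P_spec T_cyc A_gen (cnt_sum b) (@bwP b) x.
  by exists z; rewrite zE.
- move=> b g z; rewrite !cyclic_actE; elim: (nat_of_ord g) => //= k ->.
  exact: (twist_block_map q0 P_sep C_dvd E_prim sT P_spec T_cyc (cnt_sum b) (@bwP b) zeta_p s0 sS).
Qed.

End BlockSumCorner.

Lemma mem_bigcat (T : eqType) (I : Type) (r : seq I) (F : I -> seq T) x :
  x \in \big[cat/[::]]_(i <- r) F i = has (fun i => x \in F i) r.
Proof. by elim: r => [|i r IHr]; rewrite ?big_nil // big_cons mem_cat IHr. Qed.

Theorem theorem1 (K : closedFieldType) (r p n t : nat)
    (t_gt0 : (0 < t)%N) (r_eq : r = (p * t)%N)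
    (p_gt1 : (1 < p)%N) (n_ge3 : (3 <= n)%N)
    (eps : K) (eps_prim : p.-primitive_root eps)
    (q : K) (q_neq0 : q != 0)
    (Q : t.-tuple K) (Q_neq0 : forall i : 'I_t, tnth Q i != 0)
    (kappa : nat) (Qs : 'I_kappa -> seq K)
    (Q_split : tval Q = \big[cat/[::]]_(a < kappa) Qs a)
    (Q_orbits : forall (a b : 'I_kappa) (x y : K),
        x \in Qs a -> y \in Qs b -> same_orbit eps q x y -> a = b) :
  morita_equivalent (hecke_rpn p q (tval Q) n)
    (hecke_sum q Qs n p_gt1 (prim_expr_order eps_prim)).
Proof.
have Q0 x : x \in tval Q -> x != 0 by move=> /tnthP[i ->].
have Qs0 c x : x \in Qs c -> x != 0.
  move=> xc; apply: Q0; rewrite Q_split mem_bigcat; apply/hasP.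
  by exists c; rewrite ?mem_index_enum.
case: n n_ge3 => // n _.
have sep := @cyc_poly_separated K p eps q kappa Qs n.+1 eps_prim q_neq0 Qs0 Q_orbits.
have [E E_prim] := primary_polys (fun a b z => separated_neq sep (a := a) (b := b) (z := z)).
apply: morita_trans (morita_sym (morita_full_corner (rpn_corner n p_gt1 eps_prim q_neq0 Q0))) _.
apply: morita_full_corner.
apply: (@block_sum_corner K q p n kappa Qs E _ q_neq0 sep (C_dvd q p n Qs) E_prim
  _ _ (hecke_systemT _ _ _ _) (P_spec p q_neq0 Q_split) (T_cyc q p n Q_split)).
- exact: hecke_generated.
- exact: block_map_inj.
- by rewrite sigma_hT.
- by move=> i im; rewrite sigma_hT.
Qed.
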